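(* Let $\nu>0$, $f\in H$, and let $u$ be a strong solution of the periodic two-dimensional Navier--Stokes equations $u_t+\nu Au+B(u,u)=f$, $u(0)=u_0\in V$. Fix $t_0\ge0$ and assume $$U_0:=\operatorname*{ess\,sup}_{t\ge t_0}|u(t)|<\infty,\qquad U_1:=\operatorname*{ess\,sup}_{t\ge t_0}\|\nabla u(t)\|_{L^2}<\infty .$$ Let $m\in W^{2,\infty}(\mathbb T^2;\mathbb R^2)$ be a time-independent unit vector field admitting a controlled adapted covering, and assume $$K_m\lambda_1^{-1/2}U_0\|\mathcal A_m\|_{L^\infty}\le\frac{\nu}{4}.$$ Define $$A_*:=\frac{2K_m}{\nu}U_1^2,\qquad B_*^{\rm c}:=A_*\Bigl[1+\log\Bigl(1+\frac{4C_{\rm fr}A_*}{\nu}\Bigr)\Bigr].$$ Let $I_h:L^2(\mathbb T^2)\to L^2(\mathbb T^2)$, $h>0$, be linear operators satisfying $\|I_h\phi\|_{L^2}\le c_0\|\phi\|_{L^2}$ for $\phi\in L^2(\mathbb T^2)$ and $\|\phi-I_h\phi\|_{L^2}\le c_1h\|\nabla\phi\|_{L^2}$ for $\phi\in H^1(\mathbb T^2)$, with constants $c_0,c_1>0$ independent of $h$. If $\mu>0$, $$\mu\ge B_*^{\rm c}\qquad\text{and}\qquad c_1^2C_{\rm fr}\,\mu h^2\le\frac{\nu}{4},$$ then the strong solution $v$ of $$v_t+\nu Av+B(v,v)=f-\mu P_\sigma\bigl(\bigl(I_h((v-u)\cdot m)\bigr)m\bigr),\qquad v(0)=v_0\in V,$$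 satisfies $$|v(t)-u(t)|^2\le\exp\Bigl(-\frac{\nu\lambda_1}{2}(t-t_0)\Bigr)|v(t_0)-u(t_0)|^2,\qquad t\ge t_0 .$$
   Context: Functional setting. $\mathbb T^2=(\mathbb R/2\pi\mathbb Z)^2$. $H$ is the space of divergence-free, mean-zero fields in $L^2(\mathbb T^2)^2$, and $V=H^1(\mathbb T^2)^2\cap H$. $|\cdot|$ is the $L^2$ norm; $\|u\|=\|\nabla u\|_{L^2}$ for $u\in V$. $\lambda_1>0$ is a fixed Poincaré constant: $\lambda_1|u|^2\le\|u\|^2$ for $u\in V$ (one may take $\lambda_1=1$). $P_\sigma:L^2(\mathbb T^2)^2\to H$ is the orthogonal projection, $A=-P_\sigma\Delta$ with $D(A)=H^2(\mathbb T^2)^2\cap H$, $B(u,v)=P_\sigma((u\cdot\nabla)v)$, $b(u,v,w)=\int_{\mathbb T^2}(u\cdot\nabla v)\cdot w\,dx$. A strong solution (of either system) is one that for every $T>0$ lies in $C([0,T];V)\cap L^2(0,T;D(A))$ with time derivative in $L^2(0,T;H)$. Frame and shear defect. For a unit field $m$ ($|m|=1$ a.e.), $n:=m^\perp=(-m_2,m_1)$, $D_nF:=n\cdot\nabla F$ (componentwise on vectors), and $\mathcal A_m:=D_nn-(\nabla\cdot n)n$. Controlled adapted covering. A unit field $m\in W^{2,\infty}(\mathbb T^2;\mathbb R^2)$ admits a controlled adapted covering if there exist $L_y,L_s>0$, the torus $\widehat{\mathbb T}^2=(\mathbb R/L_y\mathbb Z)\times(\mathbb R/L_s\mathbb Z)$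 with periodic coordinates $Y=(y,s)$, a smooth finite covering map $\Phi:\widehat{\mathbb T}^2\to\mathbb T^2$, and a positive function $q\in W^{2,\infty}(\widehat{\mathbb T}^2)$ such that $\partial_s\Phi=q\,(n\circ\Phi)$ and, with $\Gamma(Y):=(D\Phi(Y))^{-1}$, $$\mathfrak C_\Phi:=\|D\Phi\|_{W^{2,\infty}}+\|\Gamma\|_{W^{2,\infty}}+\|q\|_{W^{2,\infty}}+\|q^{-1}\|_{W^{2,\infty}}<\infty .$$ One such covering is fixed. Constants. For $r\in H^1(\mathbb T^2)$ let $\mathcal L_m(r)=1+\log\bigl(1+\|r\|_{H^1(\mathbb T^2)}^2/|r|_{L^2}^2\bigr)$ if $r\not\equiv0$ and $\mathcal L_m(r)=1$ if $r\equiv0$. $K_m>0$ is a fixed constant, depending only on the chosen covering and $\|m\|_{W^{2,\infty}}$, with the following property (such a constant exists): for all $\nu>0$ and all $u,e\in V$ with $K_m\lambda_1^{-1/2}\|u\|_{L^2}\|\mathcal A_m\|_{L^\infty}\le\nu/4$, putting $r=e\cdot m$, one has $|b(e,u,e)|\le\frac{\nu}{2}\|\nabla e\|_{L^2}^2+\frac{K_m}{\nu}\|\nabla u\|_{L^2}^2\mathcal L_m(r)|r|_{L^2}^2$. $C_{\rm fr}$ is a fixed constant, depending only on $\|m\|_{W^{1,\infty}}$ and the Poincaré constant, such that $\|e\cdot m\|_{H^1(\mathbb T^2)}^2\le C_{\rm fr}\|\nabla e\|_{L^2}^2$ for all $e\in V$. *)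

(* Defs.v *)
From HB Require Import structures.
From mathcomp Require Import all_boot all_order all_algebra.
From mathcomp Require Import all_classical all_reals all_analysis ess_sup_inf.

Set Implicit Arguments.
Unset Strict Implicit.
Unset Printing Implicit Defensive.

Import Order.TTheory GRing.Theory Num.Theory.
Import numFieldNormedType.Exports.

Local Open Scope classical_set_scope.
Local Open Scope ring_scope.

(* A function on the torus (R/aZ) x (R/bZ) is a function on the plane that is
   periodic with periods p = (a, b); elements of Lebesgue and Sobolev spaces
   are such representatives, and identities between them are read almost
   everywhere for [torus_measure p].  Components and coordinates of the plane
   are indexed by 'I_2. *)

Section torus_functions.
Context {R : realType}.
Implicit Types (p x : R * R) (f g : R * R -> R).

Definition dir (i : 'I_2) : R * R := if i == 0 then (1, 0) else (0, 1).

Definition periodic p f : Prop :=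
  forall x, f (x.1 + p.1, x.2) = f x /\ f (x.1, x.2 + p.2) = f x.

(* The library's Lebesgue measure lives on [measurableTypeR R], an alias of R. *)
Definition cell p : set (measurableTypeR R * measurableTypeR R) :=
  `[0, p.1[%classic `*` `[0, p.2[%classic.

Lemma measurable_cell p : measurable (cell p).
Proof. exact: measurableX. Qed.

Definition torus_measure p :
    {measure set (measurableTypeR R * measurableTypeR R) -> \bar R} :=
  mrestr (@lebesgue_measure R \x @lebesgue_measure R)%E (measurable_cell p).

Definition iter_partial (s : seq 'I_2) f : R * R -> R :=
  foldr (fun i g x => 'D_(dir i) g x) f s.

Definition smooth f : Prop :=
  forall (s : seq 'I_2) x, differentiable (iter_partial s f) x.

Definition inner p f g : R := Rintegral (torus_measure p) setT (f \* g).

Definition Lspace p (q : \bar R) : set (R * R -> R) :=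
  [set f | periodic p f /\ f \in Lfun (torus_measure p) q].

Definition weak_partial p (i : 'I_2) f g : Prop :=
  forall phi, periodic p phi -> smooth phi ->
    inner p f (fun x => 'D_(dir i) phi x) = - inner p g phi.

(* W^{k,q}; W^{k,2} is H^k. *)
Fixpoint sobolev p (k : nat) (q : \bar R) f : Prop :=
  Lspace p q f /\
  if k is k'.+1 then
    forall i, exists g, weak_partial p i f g /\ sobolev p k' q g
  else True.

(* The weak partial derivative, which is unique up to a null set; the value is
   0 when there is no integrable one. *)
Definition wpartial p (i : 'I_2) f : R * R -> R :=
  xget (fun=> 0) [set g | Lspace p 1%E g /\ weak_partial p i f g].

(* |f|_{L^2}^2 for k = 0 and |f|_{L^2}^2 + |grad f|_{L^2}^2 for k = 1;
   k = 2 counts mixed derivatives twice, an equivalent norm. *)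
Fixpoint Hnorm_sq p (k : nat) f : R :=
  inner p f f +
  if k is k'.+1 then \sum_(i < 2) Hnorm_sq p k' (wpartial p i f) else 0.

End torus_functions.

Section vector_fields.
Context {R : realType}.

Definition vfield := 'I_2 -> R * R -> R.
Implicit Types u v w m : vfield.

Definition T2 : R * R := (pi *+ 2, pi *+ 2).

Definition dot u v : R * R -> R := fun x => \sum_(i < 2) u i x * v i x.

Definition ae_eqv u v : Prop :=
  {ae torus_measure T2, forall x, forall i, u i x = v i x}.

Definition L2vec : set vfield := [set u | forall i, Lspace T2 2%:E (u i)].

Definition innerv u v : R := \sum_(i < 2) inner T2 (u i) (v i).

Definition normL2 u : R := Num.sqrt (innerv u u).

Definition grad_norm u : R :=
  Num.sqrt (\sum_(i < 2) \sum_(j < 2)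
    inner T2 (wpartial T2 j (u i)) (wpartial T2 j (u i))).

Definition Hspace : set vfield := [set u | [/\ L2vec u,
  forall i, Rintegral (torus_measure T2) setT (u i) = 0 &
  forall phi, periodic T2 phi -> smooth phi ->
    \sum_(i < 2) inner T2 (u i) (fun x => 'D_(dir i) phi x) = 0]].

Definition Vspace : set vfield :=
  [set u | Hspace u /\ forall i, sobolev T2 1 2%:E (u i)].

Definition DAspace : set vfield :=
  [set u | Hspace u /\ forall i, sobolev T2 2 2%:E (u i)].

Definition normH2 u : R := Num.sqrt (\sum_(i < 2) Hnorm_sq T2 2 (u i)).

Definition leray_projection (P : vfield -> vfield) : Prop :=
  forall F, L2vec F ->
    Hspace (P F) /\ forall w, Hspace w -> innerv (F - P F) w = 0.

Definition weak_laplacian u : vfield :=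
  fun i x => \sum_(j < 2) wpartial T2 j (wpartial T2 j (u i)) x.

Definition advection u v : vfield :=
  fun i x => \sum_(j < 2) u j x * wpartial T2 j (v i) x.

Definition stokes (P : vfield -> vfield) u : vfield := - P (weak_laplacian u).

Definition bilinear (P : vfield -> vfield) u v : vfield := P (advection u v).

Definition trilinear u v w : R :=
  Rintegral (torus_measure T2) setT (dot (advection u v) w).

Definition poincare_constant (lam : R) : Prop :=
  0 < lam /\ forall u, Vspace u -> lam * normL2 u ^+ 2 <= grad_norm u ^+ 2.

End vector_fields.
Arguments vfield R : clear implicits.

Section evolution.
Context {R : realType}.
Implicit Types (T : R) (u g : R -> vfield R) (X : set (vfield R))
  (N : vfield R -> R).

Definition continuous_in T X N u : Prop :=
  forall t, 0 <= t <= T ->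
    X (u t) /\ (fun s => N (u s - u t)) @ within [set s | 0 <= s <= T] (nbhs t)
              --> (0 : R).

Definition simple_in X (s : R -> vfield R) : Prop :=
  exists (n : nat) (E : 'I_n -> set R) (w : 'I_n -> vfield R),
    (forall j, measurable (E j) /\ X (w j)) /\
    forall t i x, s t i x = \sum_(j < n) \1_(E j) t * w j i x.

(* The Bochner space L^2(0, T; X) for the norm N on X. *)
Definition bochner_L2 T X N u : Prop :=
  (exists s : nat -> R -> vfield R, (forall k, simple_in X (s k)) /\
     {ae @lebesgue_measure R, forall t, 0 < t < T ->
        X (u t) /\ N (s k t - u t) @[k --> \oo] --> (0 : R)}) /\
  (\int[@lebesgue_measure R]_(t in `]0%R, T[) (N (u t) ^+ 2)%:E < +oo)%E.

Definition test_function T (psi : R -> R) : Prop :=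
  (forall n t, derivable (derive1n n psi) t 1) /\
  exists a b, [/\ 0 < a, b < T & forall t, ~~ (a <= t <= b) -> psi t = 0].

(* The identity of H-valued integrals  int psi' u = - int psi g, tested
   against the elements of H. *)
Definition time_derivative T u g : Prop :=
  forall psi w, test_function T psi -> Hspace w ->
    Rintegral (@lebesgue_measure R) `]0, T[
      (fun t => derive1 psi t * innerv (u t) w) =
    - Rintegral (@lebesgue_measure R) `]0, T[
      (fun t => psi t * innerv (g t) w).

(* Strong solutions of  u_t + nu A u + B(u, u) = G, u(0) = u0. *)
Definition strong_solution (P : vfield R -> vfield R) (nu : R)
    (G : R -> vfield R) (u0 : vfield R) u : Prop :=
  [/\ forall T, 0 < T -> continuous_in T Vspace grad_norm u,
      forall T, 0 < T -> bochner_L2 T DAspace normH2 u,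
      exists ut : R -> vfield R,
        (forall T, 0 < T ->
           bochner_L2 T Hspace normL2 ut /\ time_derivative T u ut) /\
        {ae @lebesgue_measure R, forall t, 0 < t ->
           ae_eqv (ut t + nu *: stokes P (u t) + bilinear P (u t) (u t)) (G t)}
    & ae_eqv (u 0) u0].

Definition ess_sup_from (t0 : R) (f : R -> R) : \bar R :=
  ess_sup (mrestr (@lebesgue_measure R) (measurable_itv `[t0, +oo[))
    (fun t => (f t)%:E).

End evolution.

Section covering.
Context {R : realType}.

Definition torus_rel (p : R * R) : rel (R * R) := fun x y =>
  `[< exists k l : int, y = (x.1 + k%:~R * p.1, x.2 + l%:~R * p.2) >].

Lemma torus_rel_refl p : reflexive (torus_rel p).
Proof. by move=> [a b]; apply/asboolP; exists 0, 0; rewrite !mul0r !addr0. Qed.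

Lemma torus_rel_sym p : symmetric (torus_rel p).
Proof.
suff h x y : torus_rel p x y -> torus_rel p y x by move=> x y; apply/idP/idP => /h.
move=> /asboolP[k [l ->]]; apply/asboolP; exists (- k), (- l) => /=.
by rewrite !mulrNz !mulNr !addrK -surjective_pairing.
Qed.

Lemma torus_rel_trans p : transitive (torus_rel p).
Proof.
move=> y x z /asboolP[k [l ->]] /asboolP[k' [l' ->]]; apply/asboolP.
by exists (k + k'), (l + l') => /=; rewrite !mulrzDr !mulrDl !addrA.
Qed.

Canonical torus_equiv p := EquivRel (torus_rel p) (torus_rel_refl p)
  (@torus_rel_sym p) (@torus_rel_trans p).

Definition torus (p : R * R) := quotient_topology {eq_quot (torus_equiv p)}%qT.

Definition torus_pi (p : R * R) (x : R * R) : torus p := \pi_(torus p)%qT x.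

Definition finite_covering (X Y : topologicalType) (f : X -> Y) : Prop :=
  continuous f /\
  forall y, exists U : set Y, [/\ open U, U y &
    exists (n : nat) (S : 'I_n -> set X),
      [/\ (0 < n)%N, trivIset setT S, f @^-1` U = \bigcup_i S i &
          forall i, [/\ open (S i), set_bij (S i) U f &
            forall W, open W -> W `<=` S i -> open (f @` W)]]].

Definition perp (m : vfield R) : vfield R :=
  fun i x => if i == 0 then - m 1 x else m 0 x.

Definition jacobian (Phi : vfield R) (Y : R * R) : 'M[R]_2 :=
  \matrix_(i, j) 'D_(dir j) (Phi i) Y.

(* A map Phib between tori is smooth when it has a smooth lift Phi to the
   planes.  Finiteness of C_Phi is finiteness of each of its summands. *)
Definition controlled_adapted_covering (m : vfield R) (Ly Ls : R)
    (Phib : torus (Ly, Ls) -> torus (@T2 R))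
    (Phi : vfield R) (q : R * R -> R) : Prop :=
  let p := (Ly, Ls) in
  [/\ 0 < Ly, 0 < Ls,
      [/\ forall i, smooth (Phi i),
          forall Y, Phib (torus_pi p Y) = torus_pi T2 (Phi 0 Y, Phi 1 Y) &
          finite_covering Phib],
      (forall Y, 0 < q Y) /\
      {ae torus_measure p, forall Y, forall i,
         'D_(dir 1) (Phi i) Y = q Y * perp m i (Phi 0 Y, Phi 1 Y)} &
      [/\ forall Y, jacobian Phi Y \in unitmx,
          forall i j, sobolev p 2 +oo%E (fun Y => jacobian Phi Y i j),
          forall i j, sobolev p 2 +oo%E (fun Y => invmx (jacobian Phi Y) i j),
          sobolev p 2 +oo%E q &
          sobolev p 2 +oo%E (fun Y => (q Y)^-1)]].

End covering.

Section constants.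
Context {R : realType}.
Implicit Types (m u e : vfield R).

Definition unit_field m : Prop :=
  {ae torus_measure T2, forall x, dot m m x = 1}.

Definition shear_defect m : vfield R :=
  let n := perp m in
  fun i x => \sum_(j < 2) n j x * wpartial T2 j (n i) x
             - (\sum_(j < 2) wpartial T2 j (n j) x) * n i x.

Definition normLinfty (F : vfield R) : \bar R :=
  Lnorm (torus_measure T2) +oo%E (fun x => (Num.sqrt (dot F F x))%:E).

Definition log_factor (r : R * R -> R) : R :=
  if inner T2 r r == 0 then 1
  else 1 + ln (1 + Hnorm_sq T2 1 r / inner T2 r r).

Definition shear_small (K lam nu U : R) m : Prop :=
  ((K * (Num.sqrt lam)^-1 * U)%:E * normLinfty (shear_defect m)
     <= (nu / 4)%:E)%E.

Definition trilinear_constant (lam : R) m (K : R) : Prop :=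
  0 < K /\
  forall nu u e, 0 < nu -> Vspace u -> Vspace e ->
    shear_small K lam nu (normL2 u) m ->
    let r := dot e m in
    `|trilinear e u e| <= nu / 2 * grad_norm e ^+ 2
      + K / nu * grad_norm u ^+ 2 * log_factor r * inner T2 r r.

Definition frame_constant m (C : R) : Prop :=
  forall e, Vspace e -> Hnorm_sq T2 1 (dot e m) <= C * grad_norm e ^+ 2.

(* Operators on classes of L^2 functions act on representatives, so linearity
   is an almost everywhere identity; together with the L^2 bound it makes the
   class of I f depend only on that of f. *)
Definition linear_on_L2 (I : (R * R -> R) -> R * R -> R) : Prop :=
  (forall f, Lspace T2 2%:E f -> Lspace T2 2%:E (I f)) /\
  forall (a : R) f g, Lspace T2 2%:E f -> Lspace T2 2%:E g ->
    {ae torus_measure T2, forall x, I (a *: f + g) x = a * I f x + I g x}.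

Definition interpolant_family (Ih : R -> (R * R -> R) -> R * R -> R)
    (c0 c1 : R) : Prop :=
  forall h, 0 < h ->
  [/\ linear_on_L2 (Ih h),
      forall f, Lspace T2 2%:E f ->
        Num.sqrt (inner T2 (Ih h f) (Ih h f)) <= c0 * Num.sqrt (inner T2 f f) &
      forall f, sobolev T2 1 2%:E f ->
        Num.sqrt (inner T2 (f - Ih h f) (f - Ih h f)) <=
        c1 * h * Num.sqrt
          (\sum_(i < 2) inner T2 (wpartial T2 i f) (wpartial T2 i f))].

Definition Astar (nu K U1 : R) : R := 2 * K / nu * U1 ^+ 2.

Definition Bstar (nu K C U1 : R) : R :=
  Astar nu K U1 * (1 + ln (1 + 4 * C * Astar nu K U1 / nu)).

(* f - mu P_sigma ((I ((v - u) . m)) m) *)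
Definition nudged_forcing (P : vfield R -> vfield R) (f : vfield R) (mu : R)
    (I : (R * R -> R) -> R * R -> R) m (u v : R -> vfield R) : R -> vfield R :=
  fun t => f - mu *: P (fun i x => I (dot (v t - u t) m) x * m i x).

End constants.

(* Main.v *)
Require Import Defs.
From HB Require Import structures.
From mathcomp Require Import all_boot all_order all_algebra.
From mathcomp Require Import all_classical all_reals all_analysis ess_sup_inf.
From mathcomp Require Import measurable_realfun.
From mathcomp Require Import ring lra.
Require Import Defs.

(** The difference e = v - u of the two solutions satisfies an evolution equation
    whose energy balance, formally, is
      1/2 d/dt |e|^2 + nu |grad e|^2 + b(e, u, e) = - mu (I_h (e.m), e.m),
    because b(v, e, e) = 0 and the feedback acts only along m.  With r = e.m, the
    logarithmic inequality bounds |b(e, u, e)| by nu/2 |grad e|^2 plus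
    A_*/2 L(r) |r|^2.  As |r|_{H^1}^2 <= C_fr |grad e|^2, the tangent of ln at the
    point 1 + 4 C_fr A_*/nu turns A_* L(r) |r|^2 into at most
    mu |r|^2 + nu/4 |grad e|^2 when mu >= B_* ([log_absorb]).  By Young's
    inequality the feedback provides mu/2 |r|^2 at the price of nu/8 |grad e|^2,
    thanks to the smallness of mu h^2 ([nudging_young]).  A quarter of the viscous
    term is left over, and Poincare's inequality makes it the decay rate
    nu lambda_1 / 2 of |e|^2 ([energy_dissipation]).

    It remains to justify these formal steps for strong solutions.

    In space one needs integration by parts for Sobolev functions, the product
    rule, b(v, e, e) = 0 for v, e in H^2, and that H^2 functions are bounded.  All
    of it follows from Fourier truncation: the L^2 projection onto finitely many
    frequencies commutes with weak derivatives ([truncation_partial]) and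
    converges ([trig_poly_dense]).  Projections are built by Gram--Schmidt in an
    abstract space with a semi-inner product, since functions are representatives
    and not classes.  Density rests on a functional monotone class theorem
    ([bounded_closed_indic]) whose starting point is that the indicator of a
    rectangle is a bounded limit of trigonometric polynomials ([ray_approx]).

    In time, |e|^2 must be shown to decay although the derivative of e is only a
    distribution with values in H.  Tested with smoothed indicators of intervals it
    gives, for every fixed w in H,
      (e(t), w) - (e(s), w) = int_s^t (e'(x), w) dx   ([weak_FTC], [inner_primitive]).
    With w = e(s) + e(t) the left-hand side is |e(t)|^2 - |e(s)|^2, and on a short
    interval w is close to 2 e(x), so the energy estimate applies up to an error
    that is small compared with the integral of the norm of e'.  Chaining short
    intervals and letting the error tend to zero gives the exponential decay
    ([evolution_decay]). *)

Set Implicit Arguments.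
Unset Strict Implicit.
Unset Printing Implicit Defensive.
Import Order.TTheory GRing.Theory Num.Theory.
Import numFieldNormedType.Exports.
Local Open Scope classical_set_scope.
Local Open Scope ring_scope.

(** * Semi-inner products and orthogonal projection *)

Section semi_inner_products.
Context {R : realType} {V : lmodType R}.
Implicit Types (S : set V) (B : V -> V -> R).

Definition semi_inner S B : Prop :=
  [/\ S 0, forall a x y, S x -> S y -> S (a *: x + y),
      forall x y, S x -> S y -> B x y = B y x,
      forall a x y z, S x -> S y -> S z -> B (a *: x + y) z = a * B x z + B y z &
      forall x, S x -> 0 <= B x x].

Section theory.
Context S B (HB : semi_inner S B).

Lemma si0 : S 0. Proof. by case: HB. Qed.

Lemma siD x y : S x -> S y -> S (x + y).
Proof. by case: HB => _ h _ _ _ Sx Sy; rewrite -[x]scale1r; exact: h. Qed.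

Lemma siZ a x : S x -> S (a *: x).
Proof. by case: HB => s0 h _ _ _ Sx; rewrite -[_ *: _]addr0; exact: h. Qed.

Lemma siN x : S x -> S (- x).
Proof. by move=> Sx; rewrite -scaleN1r; exact: siZ. Qed.

Lemma siB x y : S x -> S y -> S (x - y).
Proof. by move=> Sx Sy; apply: siD => //; exact: siN. Qed.

Lemma si_sym x y : S x -> S y -> B x y = B y x.
Proof. by case: HB => _ _ h _ _; exact: h. Qed.

Lemma si_ge0 x : S x -> 0 <= B x x.
Proof. by case: HB => _ _ _ _; exact. Qed.

Lemma si_linl a x y z : S x -> S y -> S z ->
  B (a *: x + y) z = a * B x z + B y z.
Proof. by case: HB => _ _ _ h _; exact: h. Qed.

Lemma si_Dl x y z : S x -> S y -> S z -> B (x + y) z = B x z + B y z.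
Proof. by move=> *; rewrite -[x]scale1r si_linl// mul1r scale1r. Qed.

Lemma si_0l z : S z -> B 0 z = 0.
Proof.
move=> Sz; have := si_Dl si0 si0 Sz; rewrite addr0 => /eqP.
by rewrite addrC -subr_eq subrr eq_sym => /eqP.
Qed.

Lemma si_Zl a x z : S x -> S z -> B (a *: x) z = a * B x z.
Proof.
by move=> Sx Sz; rewrite -[a *: x]addr0 si_linl ?si_0l ?addr0//; exact: si0.
Qed.

Lemma si_Nl x z : S x -> S z -> B (- x) z = - B x z.
Proof. by move=> Sx Sz; rewrite -scaleN1r si_Zl// mulN1r. Qed.

Lemma si_Bl x y z : S x -> S y -> S z -> B (x - y) z = B x z - B y z.
Proof. by move=> Sx Sy Sz; rewrite si_Dl ?si_Nl//; exact: siN. Qed.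

Lemma si_Dr x y z : S x -> S y -> S z -> B x (y + z) = B x y + B x z.
Proof.
by move=> *; rewrite si_sym ?si_Dl//; [rewrite !(si_sym (x := x))|exact: siD].
Qed.

Lemma si_Br x y z : S x -> S y -> S z -> B x (y - z) = B x y - B x z.
Proof.
by move=> *; rewrite si_sym ?si_Bl//; [rewrite !(si_sym (x := x))|exact: siB].
Qed.

Lemma si_Zr a x z : S x -> S z -> B x (a *: z) = a * B x z.
Proof.
by move=> *; rewrite si_sym ?si_Zl//; [rewrite (si_sym (x := x))|exact: siZ].
Qed.

Lemma si_0r z : S z -> B z 0 = 0.
Proof. by move=> Sz; rewrite si_sym ?si_0l//; exact: si0. Qed.

Lemma si_sub_sq x y : S x -> S y ->
  B (x - y) (x - y) = B x x - 2 * B x y + B y y.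
Proof.
move=> Sx Sy; have Sxy := siB Sx Sy.
by rewrite si_Bl// !si_Br// (si_sym Sy Sx); lra.
Qed.

(** The form may vanish on nonzero vectors, so the discriminant argument has a
    degenerate case: if B y y = 0, the affine function t |-> B (x - t y) (x - t y)
    is nonnegative and hence constant. *)
Lemma si_CS_sq x y : S x -> S y -> B x y ^+ 2 <= B x x * B y y.
Proof.
move=> Sx Sy; have key t : 0 <= B x x - 2 * t * B x y + t ^+ 2 * B y y.
  have := si_ge0 (siB Sx (siZ t Sy)).
  rewrite si_sub_sq//; last exact: siZ.
  by rewrite !si_Zr// ?si_Zl//; [move=> h; nra|exact: siZ].
have [y0|ypos] := leP (B y y) 0.
  have {y0} y0 : B y y = 0 by apply/eqP; rewrite eq_le y0 si_ge0.
  rewrite y0 mulr0; case: (eqVneq (B x y) 0) => [->|bn0]; first by rewrite expr0n.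
  have := key ((B x x + 1) / (2 * B x y)).
  rewrite y0 mulr0 addr0 (_ : 2 * _ * _ = B x x + 1); last by field.
  by lra.
have := key (B x y / B y y); set b := B x y; set d := B y y; set c := B x x.
rewrite (_ : _ + _ = c - b ^+ 2 / d); last by field; rewrite gt_eqF.
by rewrite subr_ge0 ler_pdivrMr// mulrC.
Qed.

Lemma si_CS x y : S x -> S y ->
  `|B x y| <= Num.sqrt (B x x) * Num.sqrt (B y y).
Proof.
move=> Sx Sy; rewrite -sqrtrM ?si_ge0// -sqrtr_sqr.
by rewrite ler_wsqrtr// si_CS_sq.
Qed.

Lemma si_sqrt_sqr x : S x -> Num.sqrt (B x x) ^+ 2 = B x x.
Proof. by move=> Sx; rewrite sqr_sqrtr// si_ge0. Qed.

Lemma si_null x y : S x -> S y -> B x x = 0 -> B x y = 0.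
Proof.
move=> Sx Sy x0; apply/eqP; rewrite -normr_le0.
by apply: le_trans (si_CS Sx Sy) _; rewrite x0 sqrtr0 mul0r.
Qed.

Lemma si_triangle x y : S x -> S y ->
  Num.sqrt (B (x + y) (x + y)) <= Num.sqrt (B x x) + Num.sqrt (B y y).
Proof.
move=> Sx Sy; rewrite -ler_sqr ?nnegrE ?sqrtr_ge0 ?addr_ge0 ?sqrtr_ge0//.
have Sxy := siD Sx Sy.
rewrite sqrrD !si_sqrt_sqr// si_Dl// !si_Dr// (si_sym Sy Sx).
have := le_trans (ler_norm _) (si_CS Sx Sy).
by rewrite mulr2n; lra.
Qed.

Lemma si_sqN x : S x -> B (- x) (- x) = B x x.
Proof.
by move=> Sx; rewrite -scaleN1r si_Zl ?si_Zr//; [lra|exact: siZ].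
Qed.

Lemma si_sq_subC x y : S x -> S y -> B (x - y) (x - y) = B (y - x) (y - x).
Proof. by move=> Sx Sy; rewrite -opprB si_sqN//; exact: siB. Qed.

Lemma si_dist x y : S x -> S y ->
  `|Num.sqrt (B x x) - Num.sqrt (B y y)| <= Num.sqrt (B (x - y) (x - y)).
Proof.
move=> Sx Sy; rewrite ler_norml.
have h1 := si_triangle (siB Sx Sy) Sy; rewrite subrK in h1.
have h2 := si_triangle (siB Sy Sx) Sx; rewrite subrK si_sq_subC// in h2.
by apply/andP; split; lra.
Qed.

Lemma si_sum I (r : seq I) (a : I -> R) (w : I -> V) :
  (forall i, S (w i)) -> S (\sum_(i <- r) a i *: w i).
Proof.
move=> Sw; elim/big_rec: _ => [|i x _ Sx]; first exact: si0.
by apply: siD => //; exact: siZ.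
Qed.

Lemma si_sum_l I (r : seq I) (a : I -> R) (w : I -> V) z :
  (forall i, S (w i)) -> S z ->
  B (\sum_(i <- r) a i *: w i) z = \sum_(i <- r) a i * B (w i) z.
Proof.
move=> Sw Sz; elim: r => [|i r ih]; first by rewrite !big_nil si_0l.
by rewrite !big_cons si_linl ?ih//; exact: si_sum.
Qed.

Fixpoint span (w : nat -> V) (n : nat) : set V :=
  if n is k.+1 then [set p | exists a q, span w k q /\ p = a *: w k + q]
  else [set 0].

Definition orthogonal_to (W : set V) x : Prop := forall q, W q -> B x q = 0.

Context (w : nat -> V) (Sw : forall n, S (w n)).

Lemma span_sub n p : span w n p -> S p.
Proof.
elim: n p => [|n ih] p /=; first by move=> ->; exact: si0.
by move=> [a [q [/ih Sq ->]]]; apply: siD => //; exact: siZ.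
Qed.

Lemma span0 n : span w n 0.
Proof.
by elim: n => //= n ih; exists 0, 0; split => //; rewrite scale0r addr0.
Qed.

Lemma span_lin n a p q : span w n p -> span w n q -> span w n (a *: p + q).
Proof.
elim: n p q => [|n ih] p q /=; first by move=> -> ->; rewrite scaler0 addr0.
move=> [b [p' [Wp ->]]] [c [q' [Wq ->]]].
exists (a * b + c), (a *: p' + q'); split; first exact: ih.
by rewrite scalerDr scalerA scalerDl addrACA.
Qed.

Lemma spanS n p : span w n p -> span w n.+1 p.
Proof. by move=> Wp; exists 0, p; split=> //; rewrite scale0r add0r. Qed.

Lemma span_le m n p : (m <= n)%N -> span w m p -> span w n p.
Proof.
move=> /subnK <- Wp; elim: (n - m)%N => [//|k ih].
by rewrite addSn; exact: spanS.
Qed.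

Lemma span_gen m n : (m < n)%N -> span w n (w m).
Proof.
move=> mn; apply: (span_le mn); exists 1, 0; split; first exact: span0.
by rewrite scale1r addr0.
Qed.

(** Gram--Schmidt, one vector at a time.  A new direction z with B z z = 0 is
    harmless: then c = B (x - p) z / 0 = 0, and B (x - p) z = 0 anyway. *)
Lemma span_proj n x : S x ->
  exists2 p, span w n p & orthogonal_to (span w n) (x - p).
Proof.
elim: n x => [|n ih] x Sx.
  by exists 0 => // q ->; rewrite subr0 si_0r.
have [p Wp xp] := ih _ Sx; have [r Wr wr] := ih _ (Sw n).
have [Sp Sr] := (span_sub Wp, span_sub Wr).
pose z := w n - r; have Sz : S z by exact: siB.
pose c := B (x - p) z / B z z.
exists (c *: z + p).
  exists c, (- c *: r + p); split; first exact: span_lin.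
  by rewrite scalerBr addrA scaleNr.
have zq q : span w n q -> B z q = 0 by exact: wr.
have xz : B (x - p) z = c * B z z.
  have [z0|z0] := eqVneq (B z z) 0; last by rewrite /c divfK.
  by rewrite z0 mulr0 si_sym ?(si_null Sz _ z0)//; exact: siB.
have Sxp := siB Sx Sp.
have e : x - (c *: z + p) = (x - p) - c *: z by rewrite opprD addrA addrAC.
move=> _ [a [q [Wq ->]]]; have Sq := span_sub Wq.
have -> : a *: w n + q = a *: z + (a *: r + q).
  by rewrite /z scalerBr addrA subrK.
have Wrq : span w n (a *: r + q) by exact: span_lin.
have Srq := span_sub Wrq; have Sxp' := siB Sxp (siZ c Sz).
rewrite e si_Dr ?si_Zr//; last exact: siZ.
rewrite (si_Bl Sxp (siZ c Sz) Sz) (si_Bl Sxp (siZ c Sz) Srq) !si_Zl//.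
rewrite (zq _ Wrq) (xp _ Wrq) xz.
by rewrite subrr !mulr0 subr0 addr0.
Qed.

Lemma span_proj_best n x p q : S x -> span w n p ->
  orthogonal_to (span w n) (x - p) -> span w n q ->
  B (x - p) (x - p) <= B (x - q) (x - q).
Proof.
move=> Sx Wp xp Wq; have [Sp Sq] := (span_sub Wp, span_sub Wq).
have Wpq : span w n (p - q).
  by rewrite addrC -scaleN1r; exact: span_lin.
have Spq := siB Sp Sq; have Sxp := siB Sx Sp.
have -> : x - q = (x - p) + (p - q) by rewrite addrA subrK.
rewrite (si_Dl Sxp Spq (siD Sxp Spq)) (si_Dr Sxp Sxp Spq)
  (si_Dr Spq Sxp Spq).
by rewrite (si_sym Spq Sxp) (xp _ Wpq) addr0 add0r lerDl si_ge0.
Qed.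

Lemma span_proj_bounded n x p : S x -> span w n p ->
  orthogonal_to (span w n) (x - p) -> B p p <= B x x.
Proof.
move=> Sx Wp xp; have Sp := span_sub Wp; have Sxp := siB Sx Sp.
have -> : B x x = B (x - p) (x - p) + B p p.
  rewrite -[in LHS](subrK p x) (si_Dl Sxp Sp (siD Sxp Sp)) (si_Dr Sxp Sxp Sp)
    (si_Dr Sp Sxp Sp).
  by rewrite (si_sym Sp Sxp) (xp _ Wp) addr0 add0r.
by rewrite lerDr si_ge0.
Qed.

(** Projections are best approximations, so density of the spans is enough.  The
    doubled index matches [fourier] below, where 2n functions carry n
    frequencies. *)
Lemma span_proj_cvg x (p : nat -> V) : S x ->
  (forall e, 0 < e -> exists n q, span w n q /\ B (x - q) (x - q) < e) ->
  (forall n, span w n.*2 (p n)) ->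
  (forall n, orthogonal_to (span w n.*2) (x - p n)) ->
  B (x - p n) (x - p n) @[n --> \oo] --> 0.
Proof.
move=> Sx dense Wp xp; apply/cvgrPdist_lt => e e0.
have [n [q [Wq qe]]] := dense e e0.
exists n => // m /= nm; rewrite sub0r normrN ger0_norm.
  apply: le_lt_trans qe; apply: (span_proj_best Sx (Wp m) (xp m)).
  by apply: span_le Wq; rewrite (leq_trans nm)// -addnn leq_addr.
by apply: si_ge0; apply: siB => //; exact: span_sub (Wp m).
Qed.

End theory.

(** By Cauchy--Schwarz; the 1 in B z z + 1 only keeps the quotient defined. *)
Lemma si_cvg S B x (p : nat -> V) z : semi_inner S B -> S x -> S z ->
  (forall n, S (p n)) -> B (x - p n) (x - p n) @[n --> \oo] --> (0 : R) ->
  B (p n) z @[n --> \oo] --> B x z.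
Proof.
move=> HB Sx Sz Sp h; apply/cvgrPdist_le => e e0.
have := h; move/cvgrPdist_le.
have d0 : 0 < e ^+ 2 / (B z z + 1).
  by rewrite divr_gt0 ?exprn_gt0// ltr_wpDl// (si_ge0 HB).
move=> /(_ _ d0); apply: filterS => n /=; rewrite sub0r normrN.
have Sxp : S (x - p n) := siB HB Sx (Sp n).
rewrite ger0_norm ?(si_ge0 HB)// -(si_Bl HB)//.
rewrite ler_pdivlMr ?ltr_wpDl ?(si_ge0 HB)// => le.
rewrite -ler_sqr ?nnegrE// ?(ltW e0)//.
rewrite real_normK ?num_real//.
apply: le_trans (si_CS_sq HB Sxp Sz) _; apply: le_trans le.
by rewrite ler_wpM2l ?(si_ge0 HB)// lerDl.
Qed.

End semi_inner_products.

(** * Integration on a finite measure space *)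

Section almost_everywhere.
Context d (T : measurableType d) (R : realType).
Variable mu : {measure set T -> \bar R}.
Implicit Types P Q S : T -> Prop.

Lemma ae_mono P Q : {ae mu, forall x, P x} -> (forall x, P x -> Q x) ->
  {ae mu, forall x, Q x}.
Proof. by move=> aP PQ; apply: filterS aP. Qed.

Lemma ae_mono2 P Q S : {ae mu, forall x, P x} -> {ae mu, forall x, Q x} ->
  (forall x, P x -> Q x -> S x) -> {ae mu, forall x, S x}.
Proof. by move=> aP aQ PQS; apply: filterS2 aP aQ. Qed.

End almost_everywhere.

Section monotone_integral.
Context d (T : measurableType d) (R : realType).
Variable mu : {measure set T -> \bar R}.

(** The integral is a supremum over the simple functions below the integrand,
    whatever the latter is; in time, norms of vector valued functions need not be
    Borel measurable. *)
Lemma ge0_mono_integral (D : set T) (f g : T -> \bar R) :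
  (forall x, D x -> 0 <= f x)%E -> (forall x, D x -> f x <= g x)%E ->
  (\int[mu]_(x in D) f x <= \int[mu]_(x in D) g x)%E.
Proof.
move=> f0 fg; have g0 x : D x -> (0 <= g x)%E.
  by move=> Dx; apply: le_trans (f0 _ Dx) (fg _ Dx).
rewrite !ge0_integralE//; apply: ge_ereal_sup => _ [h hf <-].
apply: ereal_sup_ubound; exists h => // x /=; apply: le_trans (hf x) _.
by rewrite !patchE; case: ifPn => // /set_mem; exact: fg.
Qed.

End monotone_integral.

Section square_integrable.
Context d (T : measurableType d) (R : realType).
Variable mu : {measure set T -> \bar R}.
Hypothesis mufin : (mu setT < +oo)%E.
Implicit Types f g : T -> R.

Local Notation L2 := (Lfun mu 2%:E).
Definition ip f g : R := Rintegral mu setT (f \* g).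

Lemma Lfun_measurable q f : f \in Lfun mu q -> measurable_fun setT f.
Proof. by rewrite inE => /andP[]; rewrite inE. Qed.

Lemma L2P f : f \in L2 <->
  measurable_fun setT f /\ mu.-integrable setT (EFin \o (fun x => f x ^+ 2)).
Proof.
split=> [f2|[mf /integrableP[_ i2]]].
  by split; [exact: Lfun_measurable f2|exact: Lfun2_integrable_sqr].
rewrite inE; apply/andP; split; rewrite inE//= /finite_norm unlock.
apply: poweR_lty; apply: le_lt_trans i2; apply: ge0_le_integral => //=.
- apply/measurable_EFinP.
  apply/(@measurableT_comp _ _ _ _ _ _ (fun x : R => x `^ 2)%R) => //.
  exact: measurableT_comp.
- apply/measurable_EFinP; apply: measurableT_comp => //.
  exact: measurable_funX.
- by move=> x _; rewrite lee_fin normrX powR_mulrn.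
Qed.

Lemma L2_mul_integrable f g : f \in L2 -> g \in L2 ->
  mu.-integrable setT (EFin \o (f \* g)).
Proof. by move=> f2 g2; apply/Lfun1_integrable; exact: Lfun2_mul_Lfun1. Qed.

Lemma integrable_ae_le f g : measurable_fun setT f ->
  mu.-integrable setT (EFin \o g) -> {ae mu, forall x, `|f x| <= g x} ->
  mu.-integrable setT (EFin \o f).
Proof.
move=> mf /integrableP[mg ig] fg; apply/integrableP; split.
  exact/measurable_EFinP.
apply: le_lt_trans ig; apply: ae_ge0_le_integral => //.
- by apply: measurableT_comp => //; exact/measurable_EFinP.
- exact: measurableT_comp.
- apply: filterS fg => x h _ /=; rewrite lee_fin.
  by rewrite (le_trans h)// ler_norm.
Qed.

Lemma integrable_cstT (c : R) : mu.-integrable setT (EFin \o (fun=> c)).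
Proof.
apply: measurable_bounded_integrable => //.
exists `|c|; split; first exact: num_real.
by move=> y cy x _ /=; exact: ltW.
Qed.

Lemma L2_ae_le f g : measurable_fun setT f -> g \in L2 ->
  {ae mu, forall x, `|f x| <= `|g x|} -> f \in L2.
Proof.
move=> mf /L2P[mg ig] fg; apply/L2P; split => //.
apply: integrable_ae_le ig _; first exact: measurable_funX.
apply: filterS fg => x h; rewrite ger0_norm ?sqr_ge0//.
by rewrite -(real_normK (num_real (f x))) -(real_normK (num_real (g x))) ler_sqr.
Qed.

Lemma L2_bounded f M : measurable_fun setT f ->
  {ae mu, forall x, `|f x| <= M} -> f \in L2.
Proof.
move=> mf fM; apply/L2P; split => //.
apply: integrable_ae_le (integrable_cstT (M ^+ 2)) _; first exact: measurable_funX.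
apply: filterS fM => x h; rewrite ger0_norm ?sqr_ge0//.
rewrite -(real_normK (num_real (f x))) ler_sqr// nnegrE.
by rewrite (le_trans _ h).
Qed.

Lemma L2_bmul f g M : f \in L2 -> measurable_fun setT g ->
  {ae mu, forall x, `|g x| <= M} -> f \* g \in L2.
Proof.
move=> f2 mg gM; have mf := Lfun_measurable f2.
apply: (@L2_ae_le _ (M \o* f)).
- exact: measurable_funM.
- exact: (@Lfun_scale _ _ _ mu f M 2 (ler1n _ 2) f2).
- apply: filterS gM => x h /=; rewrite !normrM ler_wpM2l//.
  by rewrite (le_trans h)// ler_norm.
Qed.

Lemma L2_cst c : (fun _ : T => c) \in L2.
Proof. by apply: (@L2_bounded _ `|c|) => //; apply: aeW. Qed.

Lemma L2_lin a f g : f \in L2 -> g \in L2 -> a *: f + g \in L2.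
Proof.
move=> /L2P[mf f2] /L2P[mg g2]; apply/L2P; split.
  by apply: measurable_funD => //; exact: measurable_funM.
have h : mu.-integrable setT
    (EFin \o (fun x => 2 * a ^+ 2 * f x ^+ 2 + 2 * g x ^+ 2)).
  have i1 := integrableZl measurableT (2 * a ^+ 2) f2.
  have i2 := integrableZl measurableT 2 g2.
  exact: eq_integrable (integrableD measurableT i1 i2).
apply: integrable_ae_le h _.
  by apply: measurable_funX; apply: measurable_funD => //; exact: measurable_funM.
apply: aeW => x /=; rewrite ger0_norm ?sqr_ge0//.
rewrite -subr_ge0 [X in 0 <= X](_ : _ = (a * f x - g x) ^+ 2) ?sqr_ge0//.
by rewrite (_ : (a *: f + g) x = a * f x + g x)//; ring.
Qed.

Lemma semi_inner_L2 : semi_inner [set f | f \in L2] ip.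
Proof.
split => /=.
- exact: L2_cst.
- by move=> a f g; exact: L2_lin.
- by move=> f g _ _; congr fine; apply: eq_integral => x _ /=; rewrite mulrC.
- move=> a f g h f2 g2 h2; rewrite /ip.
  have i1 := L2_mul_integrable f2 h2; have i2 := L2_mul_integrable g2 h2.
  have i3 := integrableZl measurableT a i1.
  rewrite -RintegralZl// -RintegralD//.
  apply: eq_Rintegral => x _ /=.
  by rewrite (_ : (a *: f + g) x = a * f x + g x)//; ring.
- by move=> f _; apply: Rintegral_ge0 => x _ /=; rewrite -expr2 sqr_ge0.
Qed.

Lemma ae_Rintegral f g : measurable_fun setT f -> measurable_fun setT g ->
  {ae mu, forall x, f x = g x} -> Rintegral mu setT f = Rintegral mu setT g.
Proof.
move=> mf mg fg; congr fine; apply: ae_eq_integral => //.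
- exact/measurable_EFinP.
- exact/measurable_EFinP.
- by apply: filterS fg => x /= -> _.
Qed.

Lemma ip_ae f g h : measurable_fun setT f -> measurable_fun setT g ->
  measurable_fun setT h ->
  {ae mu, forall x, f x = g x} -> ip f h = ip g h.
Proof.
move=> mf mg mh fg; apply: ae_Rintegral; [exact: measurable_funM..|].
by apply: filterS fg => x /= ->.
Qed.

Lemma ip_eq0_ae f : f \in L2 -> ip f f = 0 -> {ae mu, forall x, f x = 0}.
Proof.
move=> f2; have := L2_mul_integrable f2 f2; rewrite /ip /Rintegral => i2 f0.
have mf := Lfun_measurable f2.
have : (\int[mu]_x `|(f x * f x)%:E| = 0)%E.
  have -> : (\int[mu]_x `|(f x * f x)%:E| = \int[mu]_x (f x * f x)%:E)%E.
    by apply: eq_integral => x _; rewrite gee0_abs// lee_fin -expr2 sqr_ge0.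
  by rewrite -[LHS]fineK ?f0//; exact: integrable_fin_num.
have mff : measurable_fun setT (EFin \o (f \* f)).
  by apply/measurable_EFinP; exact: measurable_funM.
move/(ae_eq_integral_abs mu measurableT mff).
apply: filterS => x /(_ I) /= [] /eqP.
by rewrite -expr2 sqrf_eq0 => /eqP.
Qed.

Lemma L2_aeS f g : f \in L2 -> measurable_fun setT g ->
  {ae mu, forall x, f x = g x} -> g \in L2.
Proof.
move=> f2 mg fg; apply: (L2_ae_le mg f2).
by apply: filterS fg => x ->.
Qed.

Lemma L2_integrable f : f \in L2 -> mu.-integrable setT (EFin \o f).
Proof.
move=> f2; apply/Lfun1_integrable; apply: Lfun_subset12 => //.
by rewrite ge0_fin_numE.
Qed.

(** The positive part of |f| - C is dominated by |f - p| for every p bounded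
    by C, so it has zero norm in the limit. *)
Lemma L2_lim_bounded f (p : nat -> T -> R) C : f \in L2 ->
  (forall n, p n \in L2) -> (forall n, {ae mu, forall x, `|p n x| <= C}) ->
  ip (f - p n) (f - p n) @[n --> \oo] --> (0 : R) ->
  {ae mu, forall x, `|f x| <= C}.
Proof.
move=> f2 p2 pC h; pose g x := Num.max (`|f x| - C) 0.
have mf := Lfun_measurable f2.
have mg : measurable_fun setT g.
  apply: measurable_maxr => //; apply: measurable_funB => //.
  exact: measurableT_comp.
have HB := semi_inner_L2.
have fp2 n : f - p n \in L2 := siB HB f2 (p2 n).
have gp n : {ae mu, forall x, `|g x| <= `|(f - p n) x|}.
  apply: filterS (pC n) => x pnx; rewrite ger0_norm ?le_max ?lexx ?orbT//.
  rewrite /g ge_max normr_ge0 andbT lerBlDr.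
  have := ler_normD ((f - p n) x) (p n x).
  rewrite (_ : (f - p n) x + p n x = f x); last exact: subrK.
  by move=> k; apply: (le_trans k); rewrite lerD2l.
have g2 : g \in L2 := L2_ae_le mg (fp2 0%N) (gp 0%N).
have g0 : ip g g = 0.
  apply/eqP; rewrite eq_le (si_ge0 HB)// andbT.
  apply: (@ler_cvg_to _ _ _ _ (fun=> ip g g) _ _ _ (cvg_cst _) h).
  apply: nearW => n; rewrite -lee_fin /ip.
  have i1 := L2_mul_integrable g2 g2.
  have i2 := L2_mul_integrable (fp2 n) (fp2 n).
  rewrite /Rintegral !fineK ?integrable_fin_num//.
  apply: ae_ge0_le_integral => //.
  - by move=> x _; rewrite lee_fin /= -expr2 sqr_ge0.
  - by case/integrableP : i1.
  - by move=> x _; rewrite lee_fin /= -expr2 sqr_ge0.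
  - by case/integrableP : i2.
  - apply: filterS (gp n) => x k _; rewrite lee_fin /= -!expr2.
    by rewrite -(real_normK (num_real (g x)))
      -(real_normK (num_real ((f - p n) x))) ler_sqr.
apply: filterS (ip_eq0_ae g2 g0) => x gx0; rewrite -subr_le0 -gx0.
by rewrite /g le_max lexx.
Qed.

End square_integrable.

(** * The measure of the torus *)

Section restricted_measure.
Context d (T : measurableType d) (R : realType).
Variables (m : {measure set T -> \bar R}) (D : set T) (mD : measurable D).

Lemma ae_mrestr (P : T -> Prop) :
  {ae m, forall x, D x -> P x} -> {ae (mrestr m mD), forall x, P x}.
Proof.
move=> [N [mN N0 sN]]; exists (N `|` ~` D); split.
- by apply: measurableU => //; exact: measurableC.
- rewrite /= /mrestr setIUl setICl setU0; apply/eqP; rewrite -measure_le0.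
  by rewrite -N0 le_measure// ?inE//; exact: measurableI.
- move=> x /= nP; have [xD|xD] := pselect (D x); last by right.
  by left; apply: sN => /= h; apply: nP; exact: h.
Qed.

Lemma mrestr_ae (P : T -> Prop) :
  {ae (mrestr m mD), forall x, P x} -> {ae m, forall x, D x -> P x}.
Proof.
move=> [N [mN N0 sN]]; exists (N `&` D); split => //; first exact: measurableI.
by move=> x /= /not_implyP[xD nP]; split => //; exact: sN.
Qed.

Lemma ge0_integral_mrestr (f : T -> \bar R) : measurable_fun setT f ->
  (forall x, 0 <= f x)%E ->
  (\int[mrestr m mD]_x f x = \int[m]_(x in D) f x)%E.
Proof.
move=> mf f0; rewrite (@ge0_negligible_integral _ _ _ _ setT (~` D))//.
- rewrite setTD setCK; apply: eq_measure_integral => A mA AD.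
  by rewrite /= /mrestr (setIidl AD).
- exact: measurableC.
- by rewrite /= /mrestr setICl measure0.
Qed.

Lemma integral_mrestr (f : T -> \bar R) : measurable_fun setT f ->
  (\int[mrestr m mD]_x f x = \int[m]_(x in D) f x)%E.
Proof.
move=> mf; rewrite [LHS]integralE [RHS]integralE !ge0_integral_mrestr//.
- exact: measurable_funeneg.
- exact: measurable_funepos.
Qed.

End restricted_measure.

Section torus_measure_theory.
Context {R : realType}.
Local Notation mu := (@torus_measure R T2).
Local Notation leb := (@lebesgue_measure R).
Local Notation L := (pi *+ 2 : R).
Local Notation I := (`[0, L[%classic : set (measurableTypeR R)).
Local Notation PL := (measurableTypeR R * measurableTypeR R)%type.

Lemma L_gt0 : 0 < L. Proof. by rewrite mulrn_wgt0 ?pi_gt0. Qed.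

Lemma leb_I : leb I = L%:E.
Proof. by rewrite lebesgue_measure_itv/= lte_fin L_gt0 sube0. Qed.

Lemma torus_finite : (mu setT < +oo)%E.
Proof.
rewrite /= /mrestr setTI product_measure1E//.
by have := leb_I; rewrite /= => ->; rewrite ltry.
Qed.

Lemma ae_cell : {ae mu, forall x, cell T2 x}.
Proof. by apply: ae_mrestr; exact: aeW. Qed.

Let patch_cell (f : PL -> \bar R) x y : (f \_ (cell (T2 : R * R))) (x, y) =
  ((fun x' => ((fun y' => f (x', y')) \_ I) y) \_ I) x.
Proof.
rewrite !patchE; case: ifPn => [/set_mem[/= Ix Iy]|nc].
  by rewrite (mem_set (A := I) Ix) (mem_set (A := I) Iy).
case: ifPn => // /set_mem Ix; case: ifPn => // /set_mem Iy.
by move: nc; rewrite mem_set.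
Qed.

(** The cell carries a product measure, but only after extension by zero to the
    plane, where [patch_cell] lets Tonelli's theorem apply. *)
Lemma ge0_torus_integral (f : PL -> \bar R) : measurable_fun setT f ->
  (forall x, 0 <= f x)%E ->
  (\int[mu]_z f z = \int[leb]_(x in I) \int[leb]_(y in I) f (x, y))%E.
Proof.
move=> mf f0; rewrite ge0_integral_mrestr// integral_mkcond.
have mfc : measurable_fun setT (f \_ (cell (T2 : R * R))).
  apply/(measurable_restrict _ (measurable_cell _) measurableT).
  by apply: measurable_funS mf.
have fc0 z : (0 <= (f \_ (cell (T2 : R * R))) z)%E.
  by rewrite patchE; case: ifPn.
rewrite (@fubini_tonelli1 _ _ _ _ R leb leb _ mfc fc0).
rewrite [RHS]integral_mkcond; apply: eq_integral => x _.
rewrite /fubini_F patchE; case: ifPn => Ix.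
  rewrite [RHS]integral_mkcond; apply: eq_integral => y _.
  by rewrite patch_cell patchE Ix.
by apply: integral0_eq => y _; rewrite patch_cell patchE (negbTE Ix).
Qed.

Lemma torus_integral12 (f : PL -> R) :
  mu.-integrable setT (EFin \o f) ->
  (\int[mu]_z (f z)%:E = \int[leb]_(x in I) \int[leb]_(y in I) (f (x, y))%:E)%E.
Proof.
move=> /[dup] intf /integrableP[mf fi]; rewrite integral_mrestr// integral_mkcond.
have intc : (leb \x leb)%E.-integrable setT ((EFin \o f) \_ (cell (T2 : R * R))).
  apply/(integrable_mkcond _ (measurable_cell _)); apply/integrableP; split.
    exact: measurable_funS mf.
  move: fi; rewrite ge0_integral_mrestr//.
  exact: measurableT_comp.
rewrite -(@integral12_prod_meas1 _ _ _ _ R leb leb _ intc).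
rewrite [RHS]integral_mkcond; apply: eq_integral => x _.
rewrite /fubini_F patchE; case: ifPn => Ix.
  rewrite [RHS]integral_mkcond; apply: eq_integral => y _.
  by rewrite patch_cell patchE Ix.
by apply: integral0_eq => y _; rewrite patch_cell patchE (negbTE Ix).
Qed.

Lemma torus_integral21 (f : PL -> R) :
  mu.-integrable setT (EFin \o f) ->
  (\int[mu]_z (f z)%:E = \int[leb]_(y in I) \int[leb]_(x in I) (f (x, y))%:E)%E.
Proof.
move=> /[dup] intf /integrableP[mf fi]; rewrite integral_mrestr// integral_mkcond.
have intc : (leb \x leb)%E.-integrable setT ((EFin \o f) \_ (cell (T2 : R * R))).
  apply/(integrable_mkcond _ (measurable_cell _)); apply/integrableP; split.
    exact: measurable_funS mf.
  move: fi; rewrite ge0_integral_mrestr//.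
  exact: measurableT_comp.
rewrite -(@integral21_prod_meas1 _ _ _ _ R leb leb _ intc).
rewrite [RHS]integral_mkcond; apply: eq_integral => y _.
rewrite /fubini_G patchE; case: ifPn => Iy.
  rewrite [RHS]integral_mkcond; apply: eq_integral => x _.
  by rewrite patch_cell !patchE Iy.
by apply: integral0_eq => x _; rewrite patch_cell !patchE (negbTE Iy) if_same.
Qed.

Lemma ae_line (b : R) : {ae mu, forall x, x.1 != b /\ x.2 != b}.
Proof.
apply: ae_mrestr.
exists ([set b] `*` setT `|` setT `*` [set b]); split.
- by apply: measurableU; exact: measurableX.
- apply/eqP; rewrite -measure_le0.
  apply: (le_trans (measureU2 _ _ _)); [exact: measurableX..|].
  have e1 := @product_measure1E _ _ _ _ R leb leb [set b] setT
    (measurable_set1 b) measurableT.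
  have e2 := @product_measure1E _ _ _ _ R leb leb setT [set b]
    measurableT (measurable_set1 b).
  rewrite /= in e1 e2 *; rewrite e1 e2.
  have := @lebesgue_measure_set1 R b => /= ->.
  by rewrite mul0e mule0 adde0.
- move=> [x y] /= /not_implyP[_ /not_andP[|]] /negP; rewrite negbK => /eqP ->.
  + by left.
  + by right.
Qed.

(** Every open set of the plane is a countable union of rational boxes. *)
Lemma continuous_measurable_plane (f : R * R -> R) : continuous f ->
  measurable_fun (setT : set PL) f.
Proof.
move=> cf.
apply: (measurability _ (RGenOpens.measurableE R)) => _ [_ [a [b ->]] <-].
rewrite setTI; set U := `]a, b[%classic; have oU : open U by exact: interval_open.
have oV : open (f @^-1` U) by exact: open_comp.
pose box (q : rat * rat * rat) : set PL :=
  ball (ratr q.1.1 : R) (ratr q.2) `*` ball (ratr q.1.2 : R) (ratr q.2).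
rewrite (_ : f @^-1` U =
    \bigcup_(q in [set q | box q `<=` f @^-1` U]) box q); last first.
  apply/seteqP; split=> [[x y] Vxy|z [q /= qV]]; last exact: qV.
  have : nbhs ((x, y) : R * R) (f @^-1` U) by exact: open_nbhs_nbhs.
  move=> /nbhs_ballP[e /= e0 eV].
  have [d] := rat_in_itvoo (divr_gt0 e0 (ltr0Sn R 1)).
  rewrite in_itv/= => /andP[d0 de].
  have pick (t : R) : exists r : rat, `|ratr r - t| < ratr d.
    have : t - ratr d < t + ratr d by lra.
    move=> /rat_in_itvoo[r]; rewrite in_itv/= => /andP[a1 a2].
    by exists r; rewrite ltr_distl; apply/andP; split; lra.
  have [r xr] := pick x; have [s ys] := pick y.
  exists (r, s, d); last by split; rewrite /= /ball/=.
  move=> [x' y'] [/= bx by']; apply: eV; split; rewrite /= /ball/= in bx by' *.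
    rewrite (_ : x - x' = - (ratr r - x) + (ratr r - x')); last by lra.
    by rewrite (le_lt_trans (ler_normD _ _))// normrN; lra.
  rewrite (_ : y - y' = - (ratr s - y) + (ratr s - y')); last by lra.
  by rewrite (le_lt_trans (ler_normD _ _))// normrN; lra.
rewrite bigcup_mkcond.
apply: countable_bigcupT_measurable; first exact: countableP.
move=> q; case: ifPn => // _.
by apply: measurableX; exact: measurable_ball.
Qed.

(** Continuity on the closed period cell, which is compact. *)
Lemma continuous_bounded_ae (f : R * R -> R) : continuous f ->
  exists M, {ae mu, forall x, `|f x| <= M}.
Proof.
move=> cf.
have cK : compact (`[0, L] `*` `[0, L] : set (R * R)).
  by apply: compact_setX; exact: segment_compact.
have /compact_bounded[M [_ Mf]] : compact (f @` (`[0, L] `*` `[0, L])).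
  by apply: continuous_compact => //; exact: continuous_subspaceT.
exists (M + 1); apply: filterS ae_cell => -[x y] [/= ].
rewrite !in_itv/= => /andP[x0 xL] /andP[y0 yL].
apply: (Mf (M + 1)); first by rewrite ltrDl.
by exists (x, y) => //; split; rewrite /= in_itv/= ?x0 ?y0 ltW.
Qed.

End torus_measure_theory.

(** * Smooth periodic functions *)

Section smooth_functions.
Context {R : realType}.
Implicit Types (f g : R * R -> R) (i : 'I_2) (s : seq 'I_2).
Local Notation pd i f := (fun x => 'D_(dir i) f x).

Lemma iter_partial_rcons s i f :
  iter_partial (rcons s i) f = iter_partial s (pd i f).
Proof. by rewrite /iter_partial -cats1 foldr_cat. Qed.

Lemma smooth_differentiable f x : smooth f -> differentiable f x.
Proof. by move=> sf; exact: (sf [::]). Qed.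

Lemma smooth_derivable f x v : smooth f -> derivable f x v.
Proof. by move=> sf; apply: diff_derivable; exact: smooth_differentiable. Qed.

Lemma smooth_continuous f : smooth f -> continuous f.
Proof.
by move=> sf x; apply: differentiable_continuous; exact: smooth_differentiable.
Qed.

Lemma smooth_partial i f : smooth f -> smooth (pd i f).
Proof. by move=> sf s x; rewrite -iter_partial_rcons; exact: sf. Qed.

(** Smoothness up to order n, the induction invariant for closure properties. *)
Let smooth_to n f := forall s x, (size s <= n)%N ->
  differentiable (iter_partial s f) x.

Let smooth_toS n f : smooth_to n.+1 f <->
  (forall x, differentiable f x) /\ forall i, smooth_to n (pd i f).
Proof.
split=> [sf|[df sf] s x].
  split=> [x|i s x sn]; first exact: (sf [::]).
  by rewrite -iter_partial_rcons; apply: sf; rewrite size_rcons.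
case/lastP: s => [_|s i]; first exact: df.
by rewrite size_rcons ltnS iter_partial_rcons; exact: sf.
Qed.

Let smooth_toW n f : smooth_to n.+1 f -> smooth_to n f.
Proof. by move=> sf s x sn; apply: sf; rewrite leqW. Qed.

Let smooth_toP f : smooth f <-> forall n, smooth_to n f.
Proof.
by split=> [sf n s x _|sf s x]; [exact: sf|exact: (sf (size s))].
Qed.

Let smooth_to_lin n a f g : smooth_to n f -> smooth_to n g ->
  smooth_to n (a *: f + g).
Proof.
elim: n f g => [|n ih] f g sf sg.
  move=> [|//] x _; apply: differentiableD; last exact: (sg [::]).
  by apply: differentiableZ; exact: (sf [::]).
have [df pf] := (smooth_toS n f).1 sf; have [dg pg] := (smooth_toS n g).1 sg.
apply/smooth_toS; split=> [x|i].
  by apply: differentiableD => //; exact: differentiableZ.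
rewrite (_ : pd i _ = a *: pd i f + pd i g); first exact: ih.
apply/funext => x; rewrite deriveD ?deriveZ//; try exact: diff_derivable.
by apply: derivableZ; exact: diff_derivable.
Qed.

Let smooth_to_mul n f g : smooth_to n f -> smooth_to n g ->
  smooth_to n (f \* g).
Proof.
elim: n f g => [|n ih] f g sf sg.
  by move=> [|//] x _; apply: differentiableM; [exact: (sf [::])|exact: (sg [::])].
have [df pf] := (smooth_toS n f).1 sf; have [dg pg] := (smooth_toS n g).1 sg.
apply/smooth_toS; split=> [x|i]; first exact: differentiableM.
rewrite (_ : pd i _ = 1 *: (f \* pd i g) + (g \* pd i f)).
  by apply: smooth_to_lin; apply: ih => //; exact: smooth_toW.
apply/funext => x; rewrite scale1r.
by rewrite (@deriveM _ _ f g)//; exact: diff_derivable.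
Qed.

Lemma smooth_lin a f g : smooth f -> smooth g -> smooth (a *: f + g).
Proof.
move=> /smooth_toP sf /smooth_toP sg; apply/smooth_toP => n.
exact: smooth_to_lin.
Qed.

Lemma smooth_mul f g : smooth f -> smooth g -> smooth (f \* g).
Proof.
move=> /smooth_toP sf /smooth_toP sg; apply/smooth_toP => n.
exact: smooth_to_mul.
Qed.

Lemma partial_lin i a f g x : smooth f -> smooth g ->
  'D_(dir i) (a *: f + g) x = a * 'D_(dir i) f x + 'D_(dir i) g x.
Proof.
move=> sf sg; rewrite deriveD ?deriveZ//; try exact: smooth_derivable.
by apply: derivableZ; exact: smooth_derivable.
Qed.

Lemma partial_mul i f g x : smooth f -> smooth g ->
  'D_(dir i) (f \* g) x = f x * 'D_(dir i) g x + g x * 'D_(dir i) f x.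
Proof. by move=> sf sg; rewrite (@deriveM _ _ f g)//; exact: smooth_derivable. Qed.

Lemma smooth0 : smooth (0 : R * R -> R).
Proof.
apply/smooth_toP; elim=> [|n ih].
  by move=> [|//] x _; exact: differentiable_cst.
apply/smooth_toS; split=> [x|i]; first exact: differentiable_cst.
have -> : pd i (0 : R * R -> R) = 0.
  by apply/funext => x; exact: (derive_cst (0 : R)).
exact: ih.
Qed.

Lemma periodic_lin p a f g : periodic p f -> periodic p g ->
  periodic p (a *: f + g).
Proof.
move=> pf pg x; have [f1 f2] := pf x; have [g1 g2] := pg x.
by split; rewrite /= !fctE ?f1 ?f2 ?g1 ?g2.
Qed.

Lemma periodic_mul p f g : periodic p f -> periodic p g -> periodic p (f \* g).
Proof.
move=> pf pg x; have [f1 f2] := pf x; have [g1 g2] := pg x.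
by split; rewrite /= ?f1 ?f2 ?g1 ?g2.
Qed.

Let increment_eq (V W : normedModType R) (f : V -> R) (g : W -> R) v w x y :
  (forall h : R, f (h *: v + x) = g (h *: w + y)) ->
  'D_v f x = 'D_w g y /\ (derivable f x v -> derivable g y w).
Proof.
move=> e; have e0 : f x = g y by have := e 0; rewrite !scale0r !add0r.
suff E : (fun h : R => h^-1 *: ((f \o shift x) (h *: v) - f x)) =
         (fun h : R => h^-1 *: ((g \o shift y) (h *: w) - g y)).
  by rewrite /derive /derivable E.
by apply/funext => h /=; rewrite e e0.
Qed.

Lemma periodic_partial p i f : periodic p f -> periodic p (pd i f).
Proof.
move=> pf x; split.
- apply: (proj1 (increment_eq _)) => h; rewrite -(pf (h *: dir i + x)).1.
  by congr (f (_, _)); rewrite /= addrA.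
- apply: (proj1 (increment_eq _)) => h; rewrite -(pf (h *: dir i + x)).2.
  by congr (f (_, _)); rewrite /= addrA.
Qed.

Let line0 f x y (h : R) : f (h *: dir 0 + (x, y)) = f (h *: 1 + x, y).
Proof. by congr (f (_, _)); rewrite /= scaler0 add0r. Qed.

Let line1 f x y (h : R) : f (h *: dir 1 + (x, y)) = f (x, h *: 1 + y).
Proof. by congr (f (_, _)); rewrite /= scaler0 add0r. Qed.

Lemma partial0_line f x y : 'D_(dir 0) f (x, y) = 'D_1 (fun t => f (t, y)) x.
Proof. exact: (proj1 (increment_eq (line0 f x y))). Qed.

Lemma partial1_line f x y : 'D_(dir 1) f (x, y) = 'D_1 (fun t => f (x, t)) y.
Proof. exact: (proj1 (increment_eq (line1 f x y))). Qed.

Lemma derivable0_line f x y : derivable f (x, y) (dir 0) ->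
  derivable (fun t => f (t, y)) x 1.
Proof. exact: (proj2 (increment_eq (line0 f x y))). Qed.

Lemma derivable1_line f x y : derivable f (x, y) (dir 1) ->
  derivable (fun t => f (x, t)) y 1.
Proof. exact: (proj2 (increment_eq (line1 f x y))). Qed.

Lemma continuous_line0 f y : continuous f -> continuous (fun t => f (t, y)).
Proof.
move=> cf t; apply: (@continuous_comp _ _ _ (fun t => (t, y)) f); last exact: cf.
exact: (@cvg_pair _ _ _ (nbhs t) (nbhs t) (nbhs y) _ _ _ id (fun=> y) cvg_id (cvg_cst y)).
Qed.

Lemma continuous_line1 f x : continuous f -> continuous (fun t => f (x, t)).
Proof.
move=> cf t; apply: (@continuous_comp _ _ _ (fun t => (x, t)) f); last exact: cf.
exact: (@cvg_pair _ _ _ (nbhs t) (nbhs x) (nbhs t) _ _ _ (fun=> x) id (cvg_cst x) cvg_id).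
Qed.

Lemma FTC_line (g dg : R -> R) (a b : R) : a < b ->
  (forall t, derivable g t 1) -> (forall t, 'D_1 g t = dg t) -> continuous dg ->
  (\int[lebesgue_measure]_(t in `[a, b]) (dg t)%:E = (g b - g a)%:E)%E.
Proof.
move=> ab dgt dgE cg; have cgg : continuous g.
  by move=> t; apply: differentiable_continuous; exact/derivable1_diffP.
rewrite (continuous_FTC2 (F := g) ab)//.
- exact: continuous_subspaceT.
- by split=> [t _||]; [exact: dgt| |];
    [apply: cvg_at_right_filter|apply: cvg_at_left_filter]; exact: cgg.
- by move=> t _; rewrite derive1E.
Qed.

Lemma FTC_line_bndo (g dg : R -> R) (a b : R) : a < b ->
  (forall t, derivable g t 1) -> (forall t, 'D_1 g t = dg t) -> continuous dg ->
  (\int[lebesgue_measure]_(t in `[a, b[) (dg t)%:E = (g b - g a)%:E)%E.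
Proof.
move=> ab dgt dgE cg; rewrite integral_itv_bndo_bndc; first exact: FTC_line.
apply/measurable_EFinP; apply: measurable_funTS.
exact: continuous_measurable_fun.
Qed.

End smooth_functions.

Section smooth_periodic.
Context {R : realType}.
Implicit Types (f g phi psi : R * R -> R) (i : 'I_2).
Local Notation pd i f := (fun x => 'D_(dir i) f x).
Local Notation mu := (@torus_measure R T2).
Local Notation leb := (@lebesgue_measure R).
Local Notation L := (pi *+ 2 : R).
Local Notation I := (`[0, L[%classic : set (measurableTypeR R)).
Local Notation L2 := (Lspace (@T2 R) 2%:E).

Lemma semi_inner_torus : semi_inner L2 (inner T2).
Proof.
have [h1 h2 h3 h4 h5] := semi_inner_L2 (@torus_finite R).
split.
- by split => //; exact: h1.
- by move=> a x y [px x2] [py y2]; split; [exact: periodic_lin|exact: h2].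
- by move=> x y [_ x2] [_ y2]; exact: h3.
- by move=> a x y z [_ x2] [_ y2] [_ z2]; exact: h4.
- by move=> x [_ x2]; exact: h5.
Qed.

Lemma smooth_measurable phi : smooth phi -> measurable_fun setT
  (phi : measurableTypeR R * measurableTypeR R -> R).
Proof.
by move=> sphi; apply: continuous_measurable_plane; exact: smooth_continuous.
Qed.

Lemma smooth_bounded phi : smooth phi -> exists M, {ae mu, forall x, `|phi x| <= M}.
Proof.
by move=> sphi; apply: continuous_bounded_ae; exact: smooth_continuous.
Qed.

Lemma smooth_L2 phi : periodic T2 phi -> smooth phi -> L2 phi.
Proof.
move=> pphi sphi; split => //; have [M phiM] := smooth_bounded sphi.
by apply: (L2_bounded (@torus_finite R) _ phiM); exact: smooth_measurable.
Qed.

Lemma smooth_integrable phi : smooth phi -> mu.-integrable setT (EFin \o phi).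
Proof.
move=> sphi; have [M phiM] := smooth_bounded sphi.
apply: L2_integrable; first exact: torus_finite.
by apply: (L2_bounded (@torus_finite R) _ phiM); exact: smooth_measurable.
Qed.

Lemma Rintegral_partial i phi : periodic T2 phi -> smooth phi ->
  Rintegral mu setT (pd i phi) = 0.
Proof.
move=> pphi sphi; have sdphi := smooth_partial i sphi.
have int_d := smooth_integrable sdphi; have L0 := @L_gt0 R.
have cd := smooth_continuous sdphi.
rewrite /Rintegral.
suff -> : (\int[mu]_x ('D_(dir i) phi x)%:E = 0)%E by [].
have sp : forall x, derivable phi x (dir i).
  by move=> x; exact: smooth_derivable.
have [e|e] : i = 0 \/ i = 1.
  by case: i {sdphi int_d cd sp} => -[|[|//]] ?; [left|right]; exact: val_inj.
- rewrite torus_integral21//; apply: integral0_eq => y _.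
  apply: etrans (FTC_line_bndo (g := fun t => phi (t, y)) L0 _ _ _) _.
  + by move=> t; apply: derivable0_line; rewrite -e.
  + by move=> t; rewrite -partial0_line -e.
  + exact: (continuous_line0 (y := y) cd).
  + have [h _] := pphi (0, y); rewrite /= add0r in h.
    by rewrite h subrr.
- rewrite torus_integral12//; apply: integral0_eq => x _.
  apply: etrans (FTC_line_bndo (g := fun t => phi (x, t)) L0 _ _ _) _.
  + by move=> t; apply: derivable1_line; rewrite -e.
  + by move=> t; rewrite -partial1_line -e.
  + exact: (continuous_line1 (x := x) cd).
  + have [_ h] := pphi (x, 0); rewrite /= add0r in h.
    by rewrite h subrr.
Qed.

Lemma smooth_parts i phi psi : periodic T2 phi -> smooth phi ->
  periodic T2 psi -> smooth psi ->
  inner T2 phi (pd i psi) = - inner T2 (pd i phi) psi.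
Proof.
move=> pphi sphi ppsi spsi.
have pp := periodic_mul pphi ppsi; have sp := smooth_mul sphi spsi.
have := Rintegral_partial i pp sp.
under eq_Rintegral do rewrite partial_mul//.
rewrite RintegralD//.
- move=> /(@eqP _ (inner T2 phi (pd i psi) + _)); rewrite addr_eq0 => /eqP ->.
  congr (- _).
  by apply: eq_Rintegral => x _; rewrite /= mulrC.
- by apply: smooth_integrable; apply: smooth_mul => //; exact: smooth_partial.
- by apply: smooth_integrable; apply: smooth_mul => //; exact: smooth_partial.
Qed.

(** The one-dimensional embedding of W^(1,1) in the bounded functions: bound
    |g x0| by |g t| plus the total variation, and average over t. *)
Let line_sup (g dg : R -> R) x0 : 0 <= x0 < L -> (forall t, derivable g t 1) ->
  (forall t, 'D_1 g t = dg t) -> continuous dg ->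
  ((L * `|g x0|)%:E <= \int[leb]_(t in I) `|g t|%:E
     + L%:E * \int[leb]_(t in I) `|dg t|%:E)%E.
Proof.
move=> /andP[x00 x0L] dgt dgE cdg; have L0 := @L_gt0 R.
have cg : continuous g.
  by move=> t; apply: differentiable_continuous; exact/derivable1_diffP.
have mg : measurable_fun setT g by exact: continuous_measurable_fun.
have mdg : measurable_fun setT dg.
  exact: continuous_measurable_fun.
have mI : measurable I by exact: measurable_itv.
set J := (\int[leb]_(t in I) `|dg t|%:E)%E.
have J0 : (0 <= J)%E by apply: integral_ge0 => t _; rewrite lee_fin.
have step a b : a < b -> 0 <= a -> b < L -> (`|g b - g a|%:E <= J)%E.
  move=> ab a0 bL; rewrite -abse_EFin -(FTC_line ab dgt dgE cdg).
  apply: (le_trans (le_abse_integral _ _ _)) => //=.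
    by apply/measurable_EFinP; exact: measurable_funTS.
  apply: ge0_subset_integral => //=.
  - by apply/measurable_EFinP; apply: measurableT_comp => //; exact: measurable_funTS.
  - by move=> t /=; rewrite !in_itv/= => /andP[h1 h2]; apply/andP; split; lra.
have pt t : I t -> (`|g x0|%:E <= `|g t|%:E + J)%E.
  rewrite /= in_itv/= => /andP[t0 tL].
  have : (`|g x0 - g t|%:E <= J)%E.
    have [xt|xt|->] := ltgtP x0 t.
    + by rewrite distrC; exact: step.
    + exact: step.
    + by rewrite subrr normr0.
  move=> h; apply: (le_trans _ (leeD2l _ h)); rewrite -EFinD lee_fin.
  by have := ler_normD (g t) (g x0 - g t); rewrite subrKC.
have -> : ((L * `|g x0|)%:E = \int[leb]_(t in I) `|g x0|%:E)%E.
  by rewrite integral_cst//= leb_I -EFinM mulrC.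
have -> : (L%:E * J = \int[leb]_(t in I) J)%E.
  by rewrite integral_cst//= muleC leb_I.
rewrite -ge0_integralD//=.
- apply: ge0_le_integral => //=.
  + apply: emeasurable_funD => //; apply/measurable_EFinP.
    by apply: measurableT_comp => //; exact: measurable_funTS.
- apply/measurable_EFinP.
  by apply: measurableT_comp => //; exact: measurable_funTS.
Qed.

Let absint (f : R * R -> R) := (\int[mu]_z `|f z|%:E)%E.

(** The one-dimensional bound in each variable in turn.  Only L^1 norms of mixed
    derivatives of order at most one in each variable appear, so an H^2 bound
    controls the right-hand side. *)
Lemma smooth_sup phi x : smooth phi -> cell T2 x ->
  ((L * L * `|phi x|)%:E <= absint phi + L%:E * absint (pd 1%R phi)
     + L%:E * (absint (pd 0%R phi) + L%:E * absint (pd 1%R (pd 0%R phi))))%E.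
Proof.
move=> sphi; case: x => x0 y0 [/=]; rewrite !in_itv/= => Ix Iy.
have L0 := @L_gt0 R.
have key (h : R * R -> R) : smooth h ->
   (L%:E * \int[leb]_(t in I) `|h (t, y0)|%:E <=
     absint h + L%:E * absint (pd 1%R h))%E.
  move=> sh; have sdh := smooth_partial 1 sh.
  have ch := smooth_continuous sh; have cdh := smooth_continuous sdh.
  have mah : measurable_fun setT (fun z => `|h z|%:E : \bar R).
    by apply/measurable_EFinP; apply: measurableT_comp => //; exact: smooth_measurable.
  have madh : measurable_fun setT (fun z => `|'D_(dir 1) h z|%:E : \bar R).
    by apply/measurable_EFinP; apply: measurableT_comp => //; exact: smooth_measurable.
  rewrite -ge0_integralZl//=; last 2 first.
  - apply/measurable_EFinP; apply: measurable_funTS; apply: measurableT_comp => //.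
    by apply: continuous_measurable_fun; exact: (continuous_line0 (y := y0) ch).
  - by rewrite lee_fin ltW.
  rewrite /absint -ge0_integralZl//=; last by rewrite lee_fin ltW.
  rewrite -ge0_integralD//=; last 2 first.
  - by move=> z _; rewrite mule_ge0// lee_fin ltW.
  - exact: measurable_funeM.
  rewrite ge0_torus_integral//=; last 2 first.
  - by apply: emeasurable_funD => //; exact: measurable_funeM.
  - by move=> z; rewrite adde_ge0// mule_ge0// lee_fin ltW.
  apply: ge0_mono_integral => t It; first by rewrite lee_fin mulr_ge0// ltW.
  have ml : measurable_fun I (fun y => `|h (t, y)|%:E : \bar R).
    apply/measurable_EFinP; apply: measurableT_comp => //; apply: measurable_funTS.
    by apply: continuous_measurable_fun; exact: (continuous_line1 (x := t) ch).
  have mdl : measurable_fun I (fun y => `|'D_(dir 1) h (t, y)|%:E : \bar R).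
    apply/measurable_EFinP; apply: measurableT_comp => //; apply: measurable_funTS.
    by apply: continuous_measurable_fun; exact: (continuous_line1 (x := t) cdh).
  have := @line_sup (fun y => h (t, y)) (fun y => 'D_(dir 1) h (t, y)) y0 Iy.
  rewrite ge0_integralD//=; last 2 first.
  - by move=> y _; rewrite mule_ge0// lee_fin ltW.
  - exact: measurable_funeM.
  rewrite ge0_integralZl//=; last by rewrite lee_fin ltW.
  apply; last exact: (continuous_line1 (x := t) cdh).
    by move=> y; apply: derivable1_line; exact: smooth_derivable.
  by move=> y; rewrite -partial1_line.
have sd0 := smooth_partial 0 sphi.
have := key _ sphi; have := key _ sd0.
have := @line_sup (fun t => phi (t, y0)) (fun t => 'D_(dir 0) phi (t, y0)) x0 Ix
  (fun t => derivable0_line (@smooth_derivable _ _ _ _ sphi))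
  (fun t => esym (partial0_line phi t y0))
  (continuous_line0 (y := y0) (smooth_continuous sd0)).
have A0 : (0 <= \int[leb]_(t in I) `|phi (t, y0)|%:E)%E.
  by apply: integral_ge0 => t _; rewrite lee_fin.
have B0 : (0 <= \int[leb]_(t in I) `|'D_(dir 0) phi (t, y0)|%:E)%E.
  by apply: integral_ge0 => t _; rewrite lee_fin.
move: (\int[leb]_(t in I) `|phi (t, y0)|%:E)%E A0 => A A0.
move: (\int[leb]_(t in I) `|'D_(dir 0) phi (t, y0)|%:E)%E B0 => B B0.
move: (absint phi) (absint (pd 1%R phi)) (absint (pd 0%R phi))
  (absint (pd 1%R (pd 0%R phi))) => a1 a2 a3 a4 h k1 k0.
have L0E : (0 <= L%:E)%E by rewrite lee_fin ltW.
rewrite -mulrA EFinM; apply: (le_trans (lee_wpmul2l L0E h)).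
rewrite ge0_muleDr//; last by rewrite mule_ge0.
by apply: leeD => //; exact: lee_wpmul2l.
Qed.

End smooth_periodic.

(** * Trigonometric polynomials *)

Section trigonometric_polynomials.
Context {R : realType}.
Implicit Types (f g p q : R * R -> R) (i : 'I_2) (k : int * int).
Local Notation pd i f := (fun x => 'D_(dir i) f x).
Local Notation L2 := (Lspace (@T2 R) 2%:E).

Definition trig k (t : R) : R * R -> R :=
  fun x => cos (k.1%:~R * x.1 + k.2%:~R * x.2 + t).

Definition freq k i : R := if i == 0 then k.1%:~R else k.2%:~R.

Lemma ord2P i : i = 0 \/ i = 1.
Proof. by case: i => -[|[|//]] ?; [left|right]; exact: val_inj. Qed.

Lemma trig_differentiable k t x : differentiable (trig k t) x.
Proof.
have d1 : differentiable (fst : R * R -> R) x.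
  by apply: linear_differentiable => y; apply: cvg_fst.
have d2 : differentiable (snd : R * R -> R) x.
  by apply: linear_differentiable => y; apply: cvg_snd.
have dl : differentiable
    (k.1%:~R *: fst + k.2%:~R *: snd + (fun=> t) : R * R -> R) x.
  apply: differentiableD; last exact: differentiable_cst.
  by apply: differentiableD; exact: differentiableZ.
apply: (@differentiable_comp _ _ _ _ _ (@cos R)) dl _.
by apply/derivable1_diffP; exact: derivable_cos.
Qed.

Lemma derive_cos_affine (a b x : R) :
  'D_1 (fun t => cos (a * t + b)) x = - (a * sin (a * x + b)).
Proof.
have d1 : is_derive x 1 (fun t : R => a * t + b) a.
  by apply: is_derive_eq; rewrite /GRing.scale/= !(mulr0, add0r, addr0, mulr1).
have := @is_derive1_comp R cos (fun t => a * t + b) x _ _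
  (is_derive_cos _) d1.
by move=> [_ /=]; rewrite /comp => ->; rewrite mulrC mulrN.
Qed.

Lemma partial_trig i k t x :
  'D_(dir i) (trig k t) x = freq k i * trig k (t + pi / 2) x.
Proof.
case: x => x y; rewrite /trig /freq /= addrA cosDpihalf mulrN.
case: (ord2P i) => -> /=.
- rewrite partial0_line (_ : (fun t0 => _) =
    (fun s => cos (k.1%:~R * s + (k.2%:~R * y + t)))); last first.
    by apply/funext => s; rewrite addrA.
  by rewrite derive_cos_affine addrA.
- rewrite partial1_line (_ : (fun t0 => _) =
    (fun s => cos (k.2%:~R * s + (k.1%:~R * x + t)))); last first.
    by apply/funext => s /=;  rewrite addrCA addrA.
  by rewrite derive_cos_affine; congr (- (_ * sin _)); ring.
Qed.

Lemma trig_smooth k t : smooth (trig k t).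
Proof.
suff h s : exists c t', iter_partial s (trig k t) = c *: trig k t'.
  move=> s x; have [c [t' ->]] := h s.
  by apply: differentiableZ; exact: trig_differentiable.
elim: s => [|i s [c [t' /= ->]]]; first by exists 1, t; rewrite scale1r.
exists (c * freq k i), (t' + pi / 2); apply/funext => x.
rewrite deriveZ; first by rewrite partial_trig [LHS]mulrA.
by apply: diff_derivable; exact: trig_differentiable.
Qed.

Lemma cosDint (x : R) (k : int) : cos (x + k%:~R * (pi *+ 2)) = cos x.
Proof.
have nat n y : cos (y + n%:R * (pi *+ 2)) = cos y :> R.
  elim: n y => [|n ih] y; first by rewrite mul0r addr0.
  by rewrite -natr1 mulrDl mul1r addrA cosD2pi ih.
case: k => n; first exact: nat.
by rewrite NegzE mulrNz mulNr -[LHS](nat n.+1) subrK.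
Qed.

Lemma trig_periodic k t : periodic T2 (trig k t).
Proof.
move=> [x y]; rewrite /trig /T2 /=; split.
- by rewrite -[RHS](cosDint _ k.1); congr cos => /=; ring.
- by rewrite -[RHS](cosDint _ k.2); congr cos => /=; ring.
Qed.

Definition freqn n : int * int := odflt (0, 0) (unpickle n).
(** The real Fourier system: a cosine at each even index and, as the shift by
    pi / 2 is a sine, a sine of the same frequency at the next one. *)
Definition fourier n : R * R -> R :=
  trig (freqn n./2) (if odd n then - (pi / 2) else 0).
Definition trig_poly p := exists n, span fourier n p.

Lemma fourier_L2 n : L2 (fourier n).
Proof. by apply: smooth_L2; [exact: trig_periodic|exact: trig_smooth]. Qed.

Lemma span_prop (P : set (R * R -> R)) n p : P 0 ->
  (forall a q m, (m < n)%N -> P q -> P (a *: fourier m + q)) ->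
  span fourier n p -> P p.
Proof.
move=> P0; elim: n p => [|n ih] p step; first by move=> ->.
move=> [a [q [Wq ->]]]; apply: (step) => //; apply: ih => // b r m mn.
by apply: (step); rewrite ltnW.
Qed.

Lemma span_smooth n p : span fourier n p -> smooth p.
Proof.
apply: span_prop; first exact: smooth0.
by move=> a q m _; apply: smooth_lin; exact: trig_smooth.
Qed.

Lemma span_periodic n p : span fourier n p -> periodic T2 p.
Proof.
apply: span_prop; first by move=> x.
by move=> a q m _; apply: periodic_lin; exact: trig_periodic.
Qed.

Lemma trig_freqn_span j t n : (j < n)%N -> span fourier n.*2 (trig (freqn j) t).
Proof.
move=> jn; have -> : trig (freqn j) t = cos t *: fourier j.*2 +
    (- sin t *: fourier j.*2.+1 + 0).
  apply/funext => x; rewrite !fctE /fourier /= uphalf_double doubleK odd_double /=.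
  by rewrite /trig !addr0 cosBpihalf cosD /GRing.scale /=; ring.
apply: span_lin; first by apply: span_gen; rewrite ltn_double.
apply: span_lin; last exact: span0.
by apply: span_gen; rewrite -leq_double in jn; rewrite (leq_trans _ jn)// doubleS.
Qed.

Lemma trig_span k t n : (pickle k < n)%N -> span fourier n.*2 (trig k t).
Proof. by move=> /(@trig_freqn_span _ t); rewrite /freqn pickleK. Qed.

(** Differentiation only shifts the phase, so it preserves the span of a set of
    whole frequencies; this is why truncation will commute with derivatives. *)
Lemma span_partial i n p : span fourier n.*2 p ->
  span fourier n.*2 (pd i p).
Proof.
move=> Wp; suff: smooth p /\ span fourier n.*2 (pd i p) by case.
move: Wp; apply: (span_prop (P := [set p | smooth p /\ span fourier n.*2 (pd i p)])).
  split; first exact: smooth0.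
  rewrite (_ : pd i 0 = 0); first exact: span0.
  by apply/funext => x; exact: (derive_cst (0 : R)).
move=> a q m mn [sq Wq]; split.
  by apply: smooth_lin => //; exact: trig_smooth.
rewrite (_ : pd i _ = a *: (freq (freqn m./2) i *: trig (freqn m./2)
    ((if odd m then - (pi / 2) else 0) + pi / 2)) + pd i q); last first.
  apply/funext => x; rewrite partial_lin//; last exact: trig_smooth.
  by rewrite partial_trig.
apply: span_lin => //; rewrite -[_ *: _]addr0.
apply: span_lin; last exact: span0.
apply: trig_freqn_span; rewrite -ltn_double; apply: leq_ltn_trans mn.
by rewrite -[leqRHS]odd_double_half leq_addl.
Qed.

End trigonometric_polynomials.

(** * Indicators as limits of trigonometric polynomials *)

Section monotone_class.
Context {R : realType}.
Implicit Types (f g p q : R * R -> R).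
Local Notation mu := (@torus_measure R T2).
Local Notation L := (pi *+ 2 : R).
Local Notation PL := (measurableTypeR R * measurableTypeR R)%type.

Lemma trig_poly_lin a p q : trig_poly p -> trig_poly q -> trig_poly (a *: p + q).
Proof.
move=> [m Wp] [n Wq]; exists (maxn m n); apply: span_lin.
  by apply: span_le Wp; rewrite leq_maxl.
by apply: span_le Wq; rewrite leq_maxr.
Qed.

Lemma trig_poly_trig k (t : R) : trig_poly (trig k t).
Proof. by exists (pickle k).+1.*2; exact: trig_span. Qed.

(** 2 cos u cos v = cos (u + v) + cos (u - v). *)
Lemma trig_poly_mul p q : trig_poly p -> trig_poly q -> trig_poly (p \* q).
Proof.
have t0 : trig_poly (0 : R * R -> R) by exists 0%N.
move=> [m Wp] [n Wq]; move: Wp.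
apply: (span_prop (P := [set p | trig_poly (p \* q)])).
  by rewrite /= (_ : _ \* _ = 0)//; apply/funext => x /=; rewrite mul0r.
move=> a r j _ /= Tr.
rewrite (_ : _ \* q = a *: (fourier j \* q) + (r \* q)); last first.
  by apply/funext => x /=; rewrite mulrDl; congr (_ + _); exact: (esym (mulrA _ _ _)).
apply: trig_poly_lin => //; move: Wq.
apply: (span_prop (P := [set q | trig_poly (fourier j \* q)])).
  by rewrite /= (_ : _ \* _ = 0)//; apply/funext => x /=; rewrite mulr0.
move=> b s i _ /=; rewrite /fourier.
move: (if odd j then _ else _) (if odd i then _ else _) => t t'.
move: (freqn j./2) (freqn i./2) => k k' Ts.
rewrite (_ : _ \* _ = (b / 2) *: trig (k + k') (t + t') +
    ((b / 2) *: trig (k - k') (t - t') + (trig k t \* s))); last first.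
  apply/funext => x.
  suff : trig k t x * (b * trig k' t' x) = b / 2 * trig (k + k') (t + t') x +
      b / 2 * trig (k - k') (t - t') x.
    move=> h; rewrite /= mulrDr; apply: etrans (congr1 (+%R^~ _) h) _.
    by rewrite -addrA.
  rewrite /trig /= !mulrzDr mulrNz.
  set u := k.1%:~R * x.1 + k.2%:~R * x.2 + t.
  set v := k'.1%:~R * x.1 + k'.2%:~R * x.2 + t'.
  rewrite (_ : _ + (t + t') = u + v); last by rewrite /u /v; ring.
  rewrite (_ : _ + (t - t') = u - v); last by rewrite /u /v; ring.
  by rewrite (cosD u v) (cosB u v); field.
by do 2!(apply: trig_poly_lin; first exact: trig_poly_trig).
Qed.

(** For z in [0, 1], Bernoulli's inequality squeezes (1 - z^n)^(2^n) between
    1 - (2 z)^n and 1 / (1 + (2 z)^n), so that it switches at z = 1/2. *)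
Definition switch n (z : R) := 1 - (1 - z ^+ n) ^+ (2 ^ n).

Let one_sub_pow (a : R) m : 0 <= a <= 1 ->
  1 - m%:R * a <= (1 - a) ^+ m /\ (1 - a) ^+ m * (1 + m%:R * a) <= 1.
Proof.
move=> /andP[a0 a1]; elim: m => [|m [ih1 ih2]].
  by rewrite !expr0 !mul0r subr0 addr0 mul1r.
have p0 : 0 <= (1 - a) ^+ m by rewrite exprn_ge0// subr_ge0.
have m0 : 0 <= m%:R :> R by [].
rewrite exprS -natr1; split; first by nra.
rewrite (_ : _ * _ = (1 - a) ^+ m * ((1 + m%:R * a) - (m%:R + 1) * a ^+ 2)).
  apply: le_trans ih2; rewrite ler_wpM2l// gerBl.
  by apply: mulr_ge0; [lra|exact: sqr_ge0].
by ring.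
Qed.

Lemma switch_bounded n z : 0 <= z <= 1 -> `|switch n z| <= 1.
Proof.
move=> /andP[z0 z1]; have zn1 : z ^+ n <= 1 by rewrite exprn_ile1.
have zn0 : 0 <= z ^+ n by rewrite exprn_ge0.
have h0 : 0 <= (1 - z ^+ n) ^+ (2 ^ n) by rewrite exprn_ge0// subr_ge0.
have h1 : (1 - z ^+ n) ^+ (2 ^ n) <= 1.
  by rewrite exprn_ile1// ?subr_ge0// gerBl.
by rewrite /switch ler_norml; apply/andP; split; lra.
Qed.

Lemma switch_cvg z : 0 <= z <= 1 -> z != 1 / 2 ->
  switch n z @[n --> \oo] --> (if 1 / 2 < z then 1 else 0 : R).
Proof.
move=> /andP[z0 z1] zh.
have zn n : 0 <= z ^+ n <= 1 by rewrite exprn_ge0//= exprn_ile1.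
have e n : (2 ^ n)%:R * z ^+ n = (2 * z) ^+ n by rewrite natrX exprMn.
have [lt|gt|eq] := ltgtP z (1 / 2); last by rewrite eq eqxx in zh.
- apply: (@squeeze_cvgr _ _ _ _ (fun=> 0) (fun n => (2 * z) ^+ n)).
  + apply: nearW => n; have [h1 _] := one_sub_pow (2 ^ n) (zn n).
    rewrite e in h1; rewrite /switch; apply/andP; split; last by lra.
    have /andP[zn0 zn1] := zn n; rewrite subr_ge0 exprn_ile1// ?subr_ge0//.
    by rewrite gerBl.
  + exact: cvg_cst.
  + by apply: cvg_expr; rewrite ger0_norm; lra.
- apply: (@squeeze_cvgr _ _ _ _ (fun n => 1 - ((2 * z)^-1) ^+ n) (fun=> 1)).
  + apply: nearW => n; have [_ h2] := one_sub_pow (2 ^ n) (zn n).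
    rewrite e in h2; have /andP[zn0 zn1] := zn n.
    have p0 : 0 <= (1 - z ^+ n) ^+ (2 ^ n) by rewrite exprn_ge0// subr_ge0.
    rewrite /switch; apply/andP; split; last by rewrite gerBl.
    rewrite lerD2l lerN2 exprVn -[leRHS]mul1r ler_pdivlMr ?exprn_gt0//; last lra.
    by apply: le_trans h2; rewrite ler_wpM2l// lerDr.
  + rewrite -[X in _ --> X]subr0; apply: cvgB; first exact: cvg_cst.
    apply: cvg_expr; rewrite ger0_norm ?invr_ge0; last by lra.
    by rewrite invf_lt1; lra.
  + exact: cvg_cst.
Qed.

Lemma trig_poly1 : trig_poly (fun=> 1 : R).
Proof.
suff -> : (fun=> 1) = trig (0, 0) (0 : R) by exact: trig_poly_trig.
by apply/funext => x; rewrite /trig !mul0r !addr0 cos0.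
Qed.

Lemma trig_poly_exp p n : trig_poly p -> trig_poly (fun x => p x ^+ n).
Proof.
move=> Tp; elim: n => [|n ih]; first exact: trig_poly1.
rewrite (_ : (fun x => _) = p \* (fun x => p x ^+ n)).
  exact: trig_poly_mul.
by apply/funext => x; rewrite exprS.
Qed.

Lemma trig_poly_switch p n : trig_poly p -> trig_poly (fun x => switch n (p x)).
Proof.
move=> Tp; have T1 := trig_poly1.
have h1 q : trig_poly q -> trig_poly (fun x => 1 - q x).
  move=> Tq; rewrite (_ : (fun x => _) = -1 *: q + (fun=> 1)).
    exact: trig_poly_lin.
  by apply/funext => x; rewrite !fctE /GRing.scale/=; ring.
by apply/h1/trig_poly_exp/h1/trig_poly_exp.
Qed.

(** Because cos (t - b/2) - cos (b/2) = 2 sin (t/2) sin ((b - t)/2), and the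
    first sine is positive inside a period. *)
Lemma cos_ray (t b : R) : 0 < t < L -> 0 < b < L -> t != b ->
  cos (t - b / 2) != cos (b / 2) /\ (cos (b / 2) < cos (t - b / 2)) = (t < b).
Proof.
move=> /andP[t0 tL] /andP[b0 bL] tb.
have L2pi : L = 2 * pi by rewrite mulr_natl.
have e : cos (t - b / 2) - cos (b / 2) = 2 * sin (t / 2) * sin ((b - t) / 2).
  rewrite (_ : t - b / 2 = t / 2 - (b - t) / 2); last by field.
  rewrite [in X in _ - X](_ : b / 2 = t / 2 + (b - t) / 2); last by field.
  by rewrite cosB cosD; ring.
have s0 : 0 < sin (t / 2) by apply: sin_gt0_pi; apply/andP; split; lra.
rewrite -subr_eq0 -subr_gt0 e.
have [lt|gt|eq] := ltgtP t b; last by rewrite eq eqxx in tb.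
- have s1 : 0 < sin ((b - t) / 2) by apply: sin_gt0_pi; apply/andP; split; lra.
  by rewrite mulr_gt0// ?mulr_gt0// gt_eqF// !mulr_gt0.
- have s1 : 0 < sin ((t - b) / 2) by apply: sin_gt0_pi; apply/andP; split; lra.
  rewrite (_ : (b - t) / 2 = - ((t - b) / 2)); last by lra.
  by rewrite sinN mulrN oppr_eq0 oppr_gt0 gt_eqF ?mulr_gt0// ltNge ltW ?mulr_gt0.
Qed.

Let coord (j : bool) (x : R * R) := if j then x.1 else x.2.

(** A ray is where a cosine exceeds a constant; the switch, applied to an affine
    image of that cosine with values in [0, 1], is a trigonometric polynomial. *)
Lemma ray_approx (j : bool) (b : R) : exists s : nat -> R * R -> R,
  [/\ forall n, trig_poly (s n), forall n x, `|s n x| <= 1 &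
   {ae mu, forall x, s n x @[n --> \oo] --> (\1_(`]-oo, b[) (coord j x) : R)}].
Proof.
have ae0 := ae_cell (R := R).
have [b0|b0] := leP b 0.
  exists (fun _ _ => 0); split=> [n|n x|].
  - by exists 0%N.
  - by rewrite normr0.
  - apply: filterS ae0 => -[x y] [/=]; rewrite !in_itv/= => /andP[x0 _] /andP[y0 _].
    rewrite indicE memNset; first exact: cvg_cst.
    by case: j; rewrite /= in_itv/= => /lt_le_trans/(_ b0); rewrite ltNge ?x0 ?y0.
have [bL|bL] := leP L b.
  exists (fun _ _ => 1); split=> [n|n x|].
  - exact: trig_poly1.
  - by rewrite normr1.
  - apply: filterS ae0 => -[x y] [/=]; rewrite !in_itv/= => /andP[_ xL] /andP[_ yL].
    rewrite indicE mem_set; first exact: cvg_cst.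
    by case: j; rewrite /= in_itv/= (lt_le_trans _ bL).
pose k : int * int := if j then (1, 0) else (0, 1).
(* The factor 1/4 puts z in [0, 1], with z = 1/2 at the end of the ray. *)
pose z := (1 / 4) *: trig k (- (b / 2)) + (1 / 2 - cos (b / 2) / 4) *: (fun=> 1).
have zE x : z x = 1 / 2 + (cos (coord j x - b / 2) - cos (b / 2)) / 4.
  rewrite /z !fctE /trig /k /coord /GRing.scale /=.
  by case: (j) => /=; rewrite !(mul0r, mul1r, addr0, add0r); field.
have z01 x : 0 <= z x <= 1.
  rewrite zE; have := cos_le1 (coord j x - b / 2); have := cos_le1 (b / 2).
  have := cos_geN1 (coord j x - b / 2); have := cos_geN1 (b / 2).
  by move=> *; apply/andP; split; lra.
have Tz : trig_poly z.
  rewrite /z; apply: trig_poly_lin; first exact: trig_poly_trig.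
  rewrite -[X in trig_poly X]addr0; apply: trig_poly_lin; first exact: trig_poly1.
  by exists 0%N.
exists (fun n x => switch n (z x)); split=> [n|n x|].
- exact: trig_poly_switch.
- exact: switch_bounded.
- have aeb := ae_line b; have ae00 := ae_line (0 : R).
  apply: filterS2 (filterI ae0 ae00) aeb => x [Cx [x10 x20]] [x1b x2b].
  case: Cx => /=; rewrite !in_itv/= => /andP[x1 xL1] /andP[x2 xL2].
  have cx : 0 < coord j x < L /\ coord j x != b.
    by case: (j) => /=; rewrite ?x1b ?x2b ?xL1 ?xL2 lt_neqAle eq_sym ?x10 ?x20 ?x1 ?x2.
  have b0L : 0 < b < L by rewrite b0.
  have [h1 h2] := cos_ray cx.1 b0L cx.2.
  have zh : z x != 1 / 2.
    by rewrite zE; apply: contra h1 => /eqP hh; apply/eqP; lra.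
  have h := switch_cvg (z01 x) zh; rewrite indicE.
  have -> : ((coord j x \in `]-oo, b[%classic) : nat)%:R =
      (if 1 / 2 < z x then 1 else 0 : R).
    rewrite mem_setE in_itv/= -h2 zE.
    rewrite (_ : (1 / 2 < _) = (cos (b / 2) < cos (coord j x - b / 2))).
      by case: ifP.
    by apply/idP/idP => ?; lra.
  exact: h.
Qed.

(** The closure hypothesis of the functional monotone class theorem. *)
Definition bounded_closed (K : set (R * R -> R)) : Prop :=
  (forall a f g, K f -> K g -> K (a *: f + g)) /\
  forall (s : nat -> R * R -> R) f M, (forall n, K (s n)) ->
    measurable_fun (setT : set PL) f -> (forall n x, `|s n x| <= M) ->
    {ae mu, forall x, s n x @[n --> \oo] --> f x} -> K f.

Section closure.
Variable K : set (R * R -> R).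
Hypotheses (cK : bounded_closed K) (TK : forall p, trig_poly p -> K p).

Let K0 : K 0. Proof. by apply: TK; exists 0%N. Qed.

(** Dynkin's lemma for the sets S whose indicator, pulled back along pr and
    multiplied by a fixed bounded member h of K, lies in K. *)
Let K_dynkin d' (T' : measurableType d') (pr : PL -> T') (G : set (set T'))
    (h : R * R -> R) : measurable_fun setT pr ->
  measurable_fun (setT : set PL) h -> (forall x, `|h x| <= 1) -> K h ->
  @measurable _ T' = <<s G >> -> setI_closed G ->
  (forall S, G S -> K (fun x => \1_S (pr x) * h x)) ->
  forall S, measurable S -> K (fun x => \1_S (pr x) * h x).
Proof.
move=> mpr mh h1 Kh GE GI KG S mS; have [Klin Klim] := cK.
apply: (dynkin_induction (P := [set S | K (fun x => \1_S (pr x) * h x)]) GE GI).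
- rewrite /= (_ : (fun x => _) = h)//.
  by apply/funext => x; rewrite indicT mul1r.
- exact: KG.
- move=> A mA /= KA.
  rewrite (_ : (fun x => _) = -1 *: (fun x => \1_A (pr x) * h x) + h).
    exact: Klin.
  apply/funext => x; rewrite !fctE !indicE in_setC /GRing.scale/=.
  by case: (_ \in _) => /=; ring.
- move=> F mF tF KF /=.
  pose s n x := (\sum_(k < n) \1_(F k) (pr x)) * h x.
  have s0 x : ~ (\bigcup_k F k) (pr x) -> forall n, s n x = 0.
    move=> nF n; rewrite /s big1 ?mul0r// => k _.
    by rewrite indicE memNset// => Fk; apply: nF; exists k.
  have s1 x m : F m (pr x) -> forall n, s n x = if (m < n)%N then h x else 0.
    move=> Fm n; rewrite /s; elim: n => [|n ih]; first by rewrite big_ord0 mul0r.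
    rewrite big_ord_recr mulrDl ih [in RHS]ltnS [in RHS]leq_eqVlt indicE.
    have [<-|mn] := eqVneq m n; first by rewrite ltnn mem_set// mul1r add0r.
    rewrite memNset ?mul0r ?addr0// => Fn; move/eqP: mn; apply.
    by apply: (tF m n) => //; exists (pr x).
  apply: (Klim s _ 1).
  + elim=> [|n ih].
      rewrite (_ : s 0%N = 0)//; apply/funext => x.
      by rewrite /s big_ord0 mul0r.
    rewrite (_ : s n.+1 = 1 *: (fun x => \1_(F n) (pr x) * h x) + s n).
      by apply: Klin => //; exact: KF.
    apply/funext => x; rewrite /s big_ord_recr/= mulrDl addrC.
    by rewrite !fctE /GRing.scale/= mul1r.
  + apply: measurable_funM => //; apply: measurableT_comp => //.
    exact/measurable_indic/bigcup_measurable.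
  + move=> n x; have [[m _ Fm]|nF] := pselect ((\bigcup_k F k) (pr x)).
      by rewrite (s1 _ _ Fm); case: ifP => _ //; rewrite normr0.
    by rewrite s0// normr0.
  + apply: aeW => x; have [[m _ Fm]|nF] := pselect ((\bigcup_k F k) (pr x)).
      rewrite indicE mem_set ?mul1r; last by exists m.
      apply: cvg_near_cst; exists m.+1 => // n /= mn.
      by rewrite (s1 _ _ Fm) mn.
    rewrite indicE memNset// mul0r.
    by apply: cvg_near_cst; apply: nearW => n; exact: s0.
- by rewrite -GE.
Qed.

Let K_ae f g M : K f -> measurable_fun (setT : set PL) g ->
  (forall x, `|f x| <= M) -> {ae mu, forall x, f x = g x} -> K g.
Proof.
move=> Kf mg fM fg; have [_ Klim] := cK.
apply: (Klim (fun=> f) _ M) => //.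
by apply: (ae_mono fg) => x ->; exact: cvg_cst.
Qed.

Let ray (b : R) : set (measurableTypeR R) := `]-oo, b[%classic.

Let norm_indic (T' : Type) (A : set T') y : `|\1_A y : R| <= 1.
Proof. by rewrite indicE; case: (_ \in _); rewrite ?normr1 ?normr0. Qed.

Let measurable_indic_comp d' (T' : measurableType d') (pr : PL -> T') (A : set T') :
  measurable_fun setT pr -> measurable A ->
  measurable_fun setT (fun x => \1_A (pr x) : R).
Proof.
by move=> mpr mA; apply: measurableT_comp => //; exact: measurable_indic.
Qed.

Let ray_setI_closed : setI_closed (@RGenInftyO.G R).
Proof.
move=> _ _ [a ->] [b ->]; exists (Num.min a b); apply/seteqP; split => t /=;
  rewrite !in_itv/= lt_min; [by case=> -> ->|by move=> /andP[]].
Qed.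

Let rays b b' : K (fun x => \1_(ray b) x.1 * \1_(ray b') x.2).
Proof.
have [_ Klim] := cK.
have [s [Ts s1 sb]] := ray_approx true b.
have [s' [Ts' s1' sb']] := ray_approx false b'.
apply: (Klim (fun n => s n \* s' n) _ 1).
- by move=> n; apply/TK/trig_poly_mul.
- by apply: measurable_funM; apply: measurable_indic_comp => //;
    exact: measurable_itv.
- by move=> n x /=; rewrite normrM -[leRHS]mulr1 ler_pM.
- by apply: (ae_mono2 sb sb') => x h h'; exact: cvgM.
Qed.

(** Rays in both variables come from [ray_approx]; Dynkin's lemma then extends
    one factor at a time to measurable rectangles, and from these to the product
    sigma-algebra.  The ray of length L is almost everywhere the whole cell. *)
Lemma bounded_closed_indic (A : set PL) : measurable A -> K \1_A.
Proof.
have GE : @measurable _ (measurableTypeR R) = <<s @RGenInftyO.G R >>.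
  exact: RGenInftyO.measurableE.
have ray_full : {ae mu, forall x, \1_(ray L) x.1 = 1 :> R /\ \1_(ray L) x.2 = 1 :> R}.
  apply: filterS (ae_cell (R := R)) => -[x y] [/=].
  rewrite !in_itv/= => /andP[_ xL] /andP[_ yL].
  by rewrite !indicE !mem_set//= in_itv.
have K_ray_full (h : PL -> R) (g : PL -> R) : (forall x, `|h x| <= 1) ->
    measurable_fun setT g -> K h -> {ae mu, forall x, h x = g x} -> K g.
  by move=> h1 mg Kh hg; apply: K_ae Kh mg h1 hg.
have Kstrip1 b' A1 : measurable A1 -> K (fun x => \1_A1 x.1 * \1_(ray b') x.2).
  move=> mA1; apply: (K_dynkin (pr := fst) (G := @RGenInftyO.G R)
    (h := fun x => \1_(ray b') x.2)) => //.
  - by apply: measurable_indic_comp => //; exact: measurable_itv.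
  - apply: (K_ray_full _ _ _ _ (rays L b')).
    + by move=> x; rewrite normrM -[leRHS]mulr1 ler_pM ?norm_indic.
    + by apply: measurable_indic_comp => //; exact: measurable_itv.
    + by apply: (ae_mono ray_full) => x [-> _]; rewrite mul1r.
  - by move=> _ [b ->]; exact: rays.
have Kprod A1 A2 : measurable A1 -> measurable A2 ->
    K (fun x => \1_A2 x.2 * \1_A1 x.1).
  move=> mA1 mA2; apply: (K_dynkin (pr := snd) (G := @RGenInftyO.G R)
    (h := fun x => \1_A1 x.1)) => //.
  - exact: measurable_indic_comp.
  - apply: (K_ray_full _ _ _ _ (Kstrip1 L A1 mA1)).
    + by move=> x; rewrite normrM -[leRHS]mulr1 ler_pM.
    + exact: measurable_indic_comp.
    + by apply: (ae_mono ray_full) => x [_ ->]; rewrite mulr1.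
  - move=> _ [b ->]; rewrite (_ : (fun x => _) =
      fun x => \1_A1 x.1 * \1_(ray b) x.2); first exact: Kstrip1.
    by apply/funext => x; rewrite mulrC.
move=> mA; rewrite (_ : \1_A = fun x => \1_A (id x) * 1); last first.
  by apply/funext => x; rewrite mulr1.
apply: (K_dynkin (pr := id) (h := fun=> 1)
    (G := [set A `*` B | A in measurable & B in measurable])) => //.
- by move=> x; rewrite normr1.
- by apply: TK; exact: trig_poly1.
- by rewrite measurable_prod_measurableType.
- move=> _ _ [A1 mA1 [B1 mB1 <-]] [A2 mA2 [B2 mB2 <-]]; rewrite -setXI.
  exists (A1 `&` A2); first exact: measurableI.
  by exists (B1 `&` B2) => //; exact: measurableI.
- move=> _ [A1 mA1 [B1 mB1 <-]].
  rewrite (_ : (fun x => _) = fun x => \1_B1 x.2 * \1_A1 x.1).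
    exact: Kprod.
  apply/funext => -[x y]; rewrite mulr1 /= !indicE -natrM mulnb andbC.
  by rewrite in_setX.
Qed.

End closure.
End monotone_class.

(** * Totality and density of trigonometric polynomials *)

Lemma cvg_norm_le (R : realType) (s : nat -> R) (l M : R) :
  s n @[n --> \oo] --> l -> (forall n, `|s n| <= M) -> `|l| <= M.
Proof.
move=> cv sM; have cvn : `|s n| @[n --> \oo] --> `|l| by exact: cvg_norm.
by apply: (ler_cvg_to cvn (cvg_cst M)); exact: nearW.
Qed.

Section dominated_L2.
Context d (T : measurableType d) (R : realType).
Variable mu : {measure set T -> \bar R}.
Implicit Types f g G : T -> R.

Lemma Rintegral_dominated (s : nat -> T -> R) f G :
  (forall n, measurable_fun setT (s n)) -> measurable_fun setT f ->
  mu.-integrable setT (EFin \o G) ->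
  {ae mu, forall x, forall n, `|s n x| <= G x} ->
  {ae mu, forall x, s n x @[n --> \oo] --> f x} ->
  Rintegral mu setT (s n) @[n --> \oo] --> Rintegral mu setT f.
Proof.
move=> ms mf iG sG sf.
have [] := @dominated_convergence _ _ _ mu setT measurableT
  (fun n => EFin \o s n) (EFin \o f) (EFin \o G) _ _ _ iG _.
- by move=> n; exact/measurable_EFinP.
- exact/measurable_EFinP.
- apply: (ae_mono sf) => x h _ /=.
  by apply: cvg_EFin; [exact: nearW|exact: h].
- by apply: (ae_mono sG) => x h n _; rewrite lee_fin.
move=> i_f _ cv; apply: fine_cvg; rewrite fineK; first exact: cv.
exact: integrable_fin_num.
Qed.

Lemma L2_dominated (s : nat -> T -> R) f G :
  (forall n, measurable_fun setT (s n)) -> measurable_fun setT f ->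
  G \in Lfun mu 2%:E -> {ae mu, forall x, forall n, `|s n x| <= G x} ->
  {ae mu, forall x, s n x @[n --> \oo] --> f x} ->
  f \in Lfun mu 2%:E /\ ip mu (f - s n) (f - s n) @[n --> \oo] --> (0 : R).
Proof.
move=> ms mf G2 sG sf; have mG := Lfun_measurable G2.
have fG : {ae mu, forall x, `|f x| <= G x}.
  apply: (ae_mono2 sG sf) => x h cv.
  exact: cvg_norm_le cv h.
split.
  apply: (L2_ae_le mf G2); apply: (ae_mono fG) => x h.
  by rewrite (le_trans h)// ler_norm.
have -> : (0 : R) = Rintegral mu setT (cst 0).
  by rewrite /Rintegral integral0.
apply: (@Rintegral_dominated _ _ (fun x => 4 * (G \* G) x)).
- move=> n; apply: measurable_funM; exact: measurable_funB.
- exact: measurable_cst.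
- exact: (integrableZl measurableT 4 (L2_mul_integrable G2 G2)).
- apply: (ae_mono2 sG fG) => x h1 h2 n.
  have h3 := h1 n; rewrite normrM.
  have h4 : `|(f - s n) x| <= 2 * G x.
    by apply: (le_trans (ler_normB _ _)); lra.
  rewrite (_ : 4 * _ = (2 * G x) * (2 * G x)); last by rewrite /=; ring.
  by rewrite ler_pM.
- apply: (ae_mono sf) => x h.
  have cv : f x - s n x @[n --> \oo] --> f x - f x.
    by apply: cvgB => //; exact: cvg_cst.
  have h2 := cvgM cv cv; rewrite subrr mulr0 in h2; exact: h2.
Qed.

End dominated_L2.

Section density.
Import HBNNSimple.
Context {R : realType}.
Implicit Types (f g p q : R * R -> R).
Local Notation mu := (@torus_measure R T2).
Local Notation PL := (measurableTypeR R * measurableTypeR R)%type.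
Local Notation mufin := (@torus_finite R).

Lemma trig_poly_smooth p : trig_poly p -> smooth p.
Proof. by move=> [n]; exact: span_smooth. Qed.

Lemma trig_poly_periodic p : trig_poly p -> periodic T2 p.
Proof. by move=> [n]; exact: span_periodic. Qed.

(** The bounded functions orthogonal to g form a bounded closed class containing
    the trigonometric polynomials, hence every indicator. *)
Lemma trig_poly_total (g : PL -> R) : mu.-integrable setT (EFin \o g) ->
  (forall p, trig_poly p -> Rintegral mu setT (g \* p) = 0) ->
  {ae mu, forall x, g x = 0}.
Proof.
move=> ig gT; have mg : measurable_fun setT g.
  by apply/measurable_EFinP; exact: measurable_int ig.
pose K : set (R * R -> R) := [set f : R * R -> R | [/\ measurable_fun (setT : set PL) f,
  exists M : R, {ae mu, forall x : PL, `|f x| <= M} & Rintegral mu setT (g \* f) = 0]].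
have int_gf (f : PL -> R) (M : R) : measurable_fun (setT : set PL) f ->
    {ae mu, forall x : PL, `|f x| <= M} -> mu.-integrable setT (EFin \o (g \* f)).
  move=> mf fM.
  have i2 := integrableZl measurableT M (integrable_norm ig).
  apply: (integrable_ae_le _ i2); first exact: measurable_funM.
  by apply: (ae_mono fM) => x h; rewrite /= normrM mulrC ler_wpM2r.
have cK : bounded_closed K.
  split=> [a f f' [mf [M fM] f0] [mf' [M' fM'] f0']|s f M Ks mf sM sf].
    split.
    - by apply: measurable_funD => //; exact: measurable_funM.
    - exists (`|a| * M + M'); apply: (ae_mono2 fM fM') => x h h'.
      rewrite (le_trans (ler_normD _ _))// lerD//.
      by rewrite normrM ler_wpM2l.
    - have i1 := int_gf _ _ mf fM; have i2 := int_gf _ _ mf' fM'.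
      have i3 := integrableZl measurableT a i1.
      rewrite (_ : _ \* _ = fun x => a * (g \* f) x + (g \* f') x).
        rewrite [LHS](RintegralD measurableT i3 i2).
        by rewrite [X in X + _](RintegralZl a measurableT i1) [X in _ * X]f0 [X in _ + X]f0' mulr0 addr0.
      by apply/funext => x; rewrite !fctE /GRing.scale/=; ring.
  have fM : {ae mu, forall x : PL, `|f x| <= M}.
    by apply: (ae_mono sf) => x cv; apply: (cvg_norm_le cv).
  split => //; first by exists M.
  have cv : Rintegral mu setT (g \* s n) @[n --> \oo] --> Rintegral mu setT (g \* f).
    have i2 := integrableZl measurableT M (integrable_norm ig).
    apply: (Rintegral_dominated _ _ i2).
    - by move=> n; have [ms _ _] := Ks n; exact: measurable_funM.
    - exact: measurable_funM.
    - by apply: aeW => x n; rewrite /= normrM mulrC ler_wpM2r.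
    - by apply: (ae_mono sf) => x h; apply: cvgM => //; exact: cvg_cst.
  have e : (fun n => Rintegral mu setT (g \* s n)) = fun=> 0.
    by apply/funext => n; have [_ _ ->] := Ks n.
  rewrite e in cv; exact: (cvg_unique _ cv (cvg_cst _)).
have TK p : trig_poly p -> K p.
  move=> Tp; have sp := trig_poly_smooth Tp; split; last exact: gT.
  - exact: smooth_measurable.
  - exact: smooth_bounded.
have h0 : ae_eq mu setT (EFin \o g) (cst 0%E).
  apply: (integral_ae_eq measurableT ig) => // E _ mE.
  have [_ _ h] := bounded_closed_indic cK TK mE.
  have e : (\int[mu]_x ((g \* \1_E) x)%:E = \int[mu]_(x in E) (EFin \o g) x)%E.
    rewrite [RHS]integral_mkcond; apply: eq_integral => x _.
    by rewrite patchE /= indicE; case: (_ \in _); rewrite /= ?mulr1 ?mulr0.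
  have fe : fine (\int[mu]_(x in E) (EFin \o g) x)%E = 0 by rewrite -e; exact: h.
  rewrite integral0 -[LHS]fineK ?fe//; apply: integrable_fin_num => //.
  exact: integrableS ig.
by apply: (ae_mono h0) => x /(_ I) [].
Qed.

Let HB := semi_inner_L2 mufin.

Lemma si_sum_sq (V : lmodType R) S (B : V -> V -> R) x y : semi_inner S B ->
  S x -> S y -> B (x + y) (x + y) <= 2 * B x x + 2 * B y y.
Proof.
move=> hB Sx Sy; have Sxy := siD hB Sx Sy.
rewrite (si_Dl hB)// !(si_Dr hB)// (si_sym hB Sy Sx).
by have := si_ge0 hB (siB hB Sx Sy); rewrite (si_sub_sq hB)//; lra.
Qed.

Lemma trig_poly_Lfun p : trig_poly p -> p \in Lfun mu 2%:E.
Proof.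
move=> Tp; have [] // := smooth_L2 (trig_poly_periodic Tp) (trig_poly_smooth Tp).
Qed.

(** The L^2 closure of the trigonometric polynomials is a bounded closed class,
    so it contains the indicators, then the simple functions and their monotone
    limits. *)
Lemma trig_poly_dense f e : f \in Lfun mu 2%:E -> 0 < e ->
  exists2 p, trig_poly p & ip mu (f - p) (f - p) < e.
Proof.
pose K : set (R * R -> R) := [set f | f \in Lfun mu 2%:E /\
  forall e, 0 < e -> exists2 p, trig_poly p & ip mu (f - p) (f - p) < e].
suff : forall g, g \in Lfun mu 2%:E -> K g.
  by move=> KL /KL[_]; apply.
clear f e.
have Kclosed g : g \in Lfun mu 2%:E ->
    (forall e, 0 < e -> exists2 k, K k & ip mu (g - k) (g - k) < e) -> K g.
  move=> g2 h; split=> // eps e0.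
  have e4 : 0 < eps / 4 by lra.
  have [k [k2 Kk] gk] := h _ e4; have [p Tp kp] := Kk _ e4.
  exists p => //; have p2 := trig_poly_Lfun Tp.
  rewrite (_ : g - p = (g - k) + (k - p)); last by rewrite addrA subrK.
  apply: le_lt_trans (si_sum_sq HB (siB HB g2 k2) (siB HB k2 p2)) _.
  by lra.
have Klin a f g : K f -> K g -> K (a *: f + g).
  move=> [f2 Kf] [g2 Kg]; split; first exact: L2_lin.
  move=> eps e0.
  have e1 : 0 < eps / (4 * (a ^+ 2 + 1)).
    by rewrite divr_gt0// mulr_gt0// ltr_wpDl// sqr_ge0.
  have e4 : 0 < eps / 4 by lra.
  have [p Tp fp] := Kf _ e1; have [q Tq gq] := Kg _ e4.
  exists (a *: p + q); first exact: trig_poly_lin.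
  have p2 := trig_poly_Lfun Tp; have q2 := trig_poly_Lfun Tq.
  have fp2 := siB HB f2 p2; have gq2 := siB HB g2 q2.
  rewrite (_ : _ - _ = a *: (f - p) + (g - q)); last first.
    by rewrite scalerBr opprD addrACA.
  apply: le_lt_trans (si_sum_sq HB (siZ HB a fp2) gq2) _.
  rewrite (si_Zl HB)// ?(si_Zr HB)//; last exact: (siZ HB).
  have : a ^+ 2 * ip mu (f - p) (f - p) <= eps / 4.
    rewrite (_ : eps / 4 = (a ^+ 2 + 1) * (eps / (4 * (a ^+ 2 + 1)))); last first.
      by field; rewrite gt_eqF// ltr_wpDl// sqr_ge0.
    rewrite ler_pM ?sqr_ge0 ?(si_ge0 HB)//; last exact: ltW.
    by rewrite lerDl.
  by rewrite expr2 -mulrA; lra.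
have Kdom (s : nat -> PL -> R) g G : (forall n, K (s n)) ->
    measurable_fun (setT : set PL) g -> G \in Lfun mu 2%:E ->
    {ae mu, forall x, forall n, `|s n x| <= G x} ->
    {ae mu, forall x, s n x @[n --> \oo] --> g x} -> K g.
  move=> Ks mg G2 sG sg.
  have ms n : measurable_fun setT (s n).
    by have [/Lfun_measurable] := Ks n.
  have [g2 cv] := L2_dominated ms mg G2 sG sg.
  apply: Kclosed => // eps e0.
  have /cvgrPdist_lt/(_ _ e0)[n _ /(_ n (leqnn n))] := cv.
  rewrite sub0r normrN => h; exists (s n) => //.
  exact: le_lt_trans (ler_norm _) h.
have cK : bounded_closed K.
  split=> // s g M Ks mg sM sg.
  apply: (Kdom s g (fun=> M)) => //; first exact: (L2_cst mufin M).
  by apply: aeW => x n; exact: sM.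
have TK p : trig_poly p -> K p.
  move=> Tp; split=> [|eps e0]; first exact: trig_poly_Lfun.
  by exists p => //; rewrite subrr (si_0l HB)//; exact: (si0 HB).
have K1 (A : set PL) : measurable A -> K \1_A.
  by move=> mA; exact: bounded_closed_indic.
have K0 : K 0 by apply: TK; exists 0%N.
have Kns (h : {nnsfun PL >-> R}) : K h.
  rewrite (_ : (h : PL -> R) =
      \sum_(y <- finmap.enum_fset (fset_set (range h))) (y *: \1_(h @^-1` [set y]))); last first.
    apply/funext => x; rewrite fimfunE fsbig_finite//= fct_sumE.
    by apply: eq_bigr.
  elim/big_rec: _ => [//|y k _ Kk]; apply: Klin => //; apply: K1.
  exact: measurable_sfunP.
have Kpos (g : PL -> R) : g \in Lfun mu 2%:E -> (forall x, 0 <= g x) -> K g.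
  move=> g2 g0; have mg := Lfun_measurable g2.
  have mEg : measurable_fun (setT : set PL) (EFin \o g) by exact/measurable_EFinP.
  have g0E (x : PL) : setT x -> (0 <= (EFin \o g) x)%E by rewrite lee_fin.
  pose s := nnsfun_approx measurableT mEg.
  apply: (Kdom s g g) => //.
  - apply: aeW => x n; rewrite ger0_norm ?fun_ge0//.
    by have := le_approx n g0E (I : setT x); rewrite nnsfun_approxE lee_fin.
  - apply: aeW => x; have := cvg_nnsfun_approx measurableT mEg g0E (I : setT x).
    by move=> /fine_cvg.
move=> g g2; have mg := Lfun_measurable g2.
have part (c : R) : `|c| = 1 -> K (fun x : PL => Num.max (c * g x) 0).
  move=> c1; apply: Kpos => [|x]; last by rewrite le_max lexx orbT.
  apply: (@L2_ae_le _ _ _ mu _ g) => //.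
    by apply: measurable_maxr => //; exact: measurable_funM.
  apply: aeW => x; rewrite ger0_norm ?le_max ?lexx ?orbT// ge_max normr_ge0 andbT.
  by rewrite (le_trans (ler_norm _))// normrM c1 mul1r.
rewrite (_ : g = -1 *: (fun x => Num.max (-1 * g x) 0) + (fun x => Num.max (1 * g x) 0)).
  by apply: Klin; apply: part; rewrite ?normrN normr1.
apply/funext => x; rewrite !fctE /GRing.scale/= !mulN1r mul1r.
by case: (leP (g x) 0) => h; case: (leP (- g x) 0) => h'; lra.
Qed.

End density.

(** * Weak derivatives and Fourier truncation *)

Section sobolev_theory.
Context {R : realType}.
Implicit Types (f g phi : R * R -> R) (i j : 'I_2).
Local Notation pd i f := (fun x => 'D_(dir i) f x).
Local Notation mu := (@torus_measure R T2).
Local Notation PL := (measurableTypeR R * measurableTypeR R)%type.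
Local Notation mufin := (@torus_finite R).
Local Notation L2 := (Lspace (@T2 R) 2%:E).
Local Notation L1 := (Lspace (@T2 R) 1%E).
Local Notation wp i f := (wpartial (@T2 R) i f).
Local Notation weak i f g := (weak_partial (@T2 R) i f g).
Local Notation H1 := (sobolev (@T2 R) 1 2%:E).
Local Notation H2 := (sobolev (@T2 R) 2 2%:E).
Local Notation ip := (inner (@T2 R)).
Local Notation HT := (@semi_inner_torus R).

Lemma L2_measurable f : L2 f -> measurable_fun (setT : set PL) f.
Proof. by case=> _; exact: Lfun_measurable. Qed.

Lemma L2_L1 f : L2 f -> L1 f.
Proof.
move=> [pf f2]; split=> //; apply: (Lfun_subset12 _ f2).
by rewrite ge0_fin_numE//; exact: mufin.
Qed.

Lemma L1_integrable f : L1 f -> mu.-integrable setT (EFin \o f).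
Proof. by move=> [_ f1]; apply/Lfun1_integrable. Qed.

Lemma integrable_bmul (f g : PL -> R) M : mu.-integrable setT (EFin \o f) ->
  measurable_fun setT g -> {ae mu, forall x, `|g x| <= M} ->
  mu.-integrable setT (EFin \o (f \* g)).
Proof.
move=> i_f mg gM; have mf : measurable_fun setT f.
  by apply/measurable_EFinP; exact: measurable_int i_f.
have i2 := integrableZl measurableT M (integrable_norm i_f).
apply: (integrable_ae_le _ i2); first exact: measurable_funM.
by apply: (ae_mono gM) => x h; rewrite /= normrM mulrC ler_wpM2r.
Qed.

Lemma integrable_smul (f : PL -> R) phi : mu.-integrable setT (EFin \o f) ->
  smooth phi -> mu.-integrable setT (EFin \o (f \* phi)).
Proof.
move=> i_f sphi; have [M phiM] := smooth_bounded sphi.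
exact: (integrable_bmul i_f (smooth_measurable sphi) phiM).
Qed.

(** Trigonometric polynomials are test functions, and they separate integrable
    functions by [trig_poly_total]. *)
Lemma weak_unique i f g g' : L1 g -> L1 g' -> weak i f g -> weak i f g' ->
  {ae mu, forall x, g x = g' x}.
Proof.
move=> g1 g1' wg wg'; have ig := L1_integrable g1; have ig' := L1_integrable g1'.
have i0 : mu.-integrable setT (EFin \o (g - g')).
  exact: eq_integrable (integrableB measurableT ig ig').
have h : {ae mu, forall x, (g - g') x = 0}.
  apply: trig_poly_total => // p Tp.
  have [sp pp] := (trig_poly_smooth Tp, trig_poly_periodic Tp).
  have -> : (g - g') \* p = fun x => (g \* p) x - (g' \* p) x.
    by apply/funext => x; rewrite /= mulrBl.
  have ip1 := integrable_smul ig sp; have ip2 := integrable_smul ig' sp.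
  rewrite [LHS](RintegralB measurableT ip1 ip2).
  have := wg p pp sp; rewrite wg'// => /oppr_inj /=.
  by rewrite /inner => ->; rewrite subrr.
by apply: (ae_mono h) => x /eqP; rewrite subr_eq0 => /eqP.
Qed.

(** What makes [wpartial], a choice among all weak derivatives, usable: any weak
    derivative at hand agrees with the chosen one. *)
Lemma wpartialP i f g : L1 g -> weak i f g ->
  [/\ L1 (wp i f), weak i f (wp i f) & {ae mu, forall x, wp i f x = g x}].
Proof.
move=> g1 wg; have [w1 ww] : [set g | L1 g /\ weak i f g] (wp i f).
  by apply: (xgetPex (fun=> 0)); exists g.
by split => //; exact: weak_unique wg.
Qed.

Lemma L2_ae f g : L2 f -> periodic T2 g -> measurable_fun (setT : set PL) g ->
  {ae mu, forall x, f x = g x} -> L2 g.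
Proof. by move=> [pf f2] pg mg fg; split => //; exact: L2_aeS f2 mg fg. Qed.

Lemma ip_ael f f' g : L2 f -> L2 f' -> L2 g ->
  {ae mu, forall x, f x = f' x} -> ip f g = ip f' g.
Proof.
move=> /L2_measurable mf /L2_measurable mf' /L2_measurable mg ff'.
exact: ip_ae.
Qed.

Lemma weak_ael i f f' g : L2 f -> L2 f' -> {ae mu, forall x, f x = f' x} ->
  weak i f g -> weak i f' g.
Proof.
move=> f2 f2' ff' w phi pphi sphi; rewrite -w//; apply/esym/ip_ael => //.
by apply: smooth_L2; [exact: periodic_partial|exact: smooth_partial].
Qed.

Lemma H1_L2 f : H1 f -> L2 f. Proof. by case. Qed.

Lemma H1_wpartial i f : H1 f -> L2 (wp i f) /\ weak i f (wp i f).
Proof.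
move=> [f2 /(_ i)[g [wg [g2 _]]]].
have [w1 ww wgE] := wpartialP (L2_L1 g2) wg; split => //.
apply: (L2_ae g2); first by case: w1.
- by case: w1 => _; exact: Lfun_measurable.
- by apply: (ae_mono wgE).
Qed.

Lemma H1_intro f (g : 'I_2 -> R * R -> R) : L2 f -> (forall i, L2 (g i)) ->
  (forall i, weak i f (g i)) -> H1 f.
Proof. by move=> f2 g2 wg; split => // i; exists (g i). Qed.

Lemma wpartial_ae i f g : L2 g -> weak i f g -> {ae mu, forall x, wp i f x = g x}.
Proof. by move=> g2 wg; have [] := wpartialP (L2_L1 g2) wg. Qed.

Lemma H1_ae f f' : H1 f -> L2 f' -> {ae mu, forall x, f x = f' x} -> H1 f'.
Proof.
move=> hf f2' ff'; apply: (H1_intro (g := fun i => wp i f) f2') => i.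
- by have [] := H1_wpartial i hf.
- by apply: (weak_ael _ f2' ff'); [exact: H1_L2|have [] := H1_wpartial i hf].
Qed.

Lemma H2_H1 f : H2 f -> H1 f.
Proof. by move=> [f2 h]; split => // i; have [g [wg [g2 _]]] := h i; exists g. Qed.

Lemma H2_wpartial i f : H2 f -> H1 (wp i f).
Proof.
move=> hf; have [w2 ww] := H1_wpartial i (H2_H1 hf).
case: hf => f2 /(_ i)[g [wg hg]].
apply: (H1_ae hg w2); have := wpartial_ae (H1_L2 hg) wg.
by move=> h; apply: (ae_mono h).
Qed.

Lemma weak_lin i a f f' g g' : L2 f -> L2 f' -> L2 g -> L2 g' ->
  weak i f f' -> weak i g g' -> weak i (a *: f + g) (a *: f' + g').
Proof.
move=> f2 f2' g2 g2' wf wg phi pphi sphi.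
have phi2 := smooth_L2 pphi sphi.
have dphi2 : L2 (pd i phi).
  by apply: smooth_L2; [exact: periodic_partial|exact: smooth_partial].
by rewrite !(si_linl HT)// wf// wg//; ring.
Qed.

Lemma H1_lin a f g : H1 f -> H1 g -> H1 (a *: f + g).
Proof.
move=> hf hg; have [_ h _ _ _] := HT.
apply: (H1_intro (g := fun i => a *: wp i f + wp i g)).
- by apply: h; exact: H1_L2.
- by move=> i; apply: h; have [] := H1_wpartial i hf; have [] := H1_wpartial i hg.
- move=> i; have [? ?] := H1_wpartial i hf; have [? ?] := H1_wpartial i hg.
  by apply: weak_lin => //; exact: H1_L2.
Qed.

Lemma wpartial_lin i a f g : H1 f -> H1 g ->
  {ae mu, forall x, wp i (a *: f + g) x = (a *: wp i f + wp i g) x}.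
Proof.
move=> hf hg; have [_ h _ _ _] := HT.
have [? ?] := H1_wpartial i hf; have [? ?] := H1_wpartial i hg.
apply: wpartial_ae; first exact: h.
by apply: weak_lin => //; exact: H1_L2.
Qed.

Definition truncation f (p : nat -> R * R -> R) := forall n,
  span fourier n.*2 (p n) /\ orthogonal_to ip (span fourier n.*2) (f - p n).

Lemma truncation_exists f : L2 f -> exists p, truncation f p.
Proof.
move=> f2; have h n := span_proj HT (@fourier_L2 R) n.*2 f2.
have [p hp] := choice (fun n => let: ex_intro2 p a b := h n in
  ex_intro (fun p => _ /\ _) p (conj a b)).
by exists p.
Qed.

Lemma truncation_L2 f p n : truncation f p -> L2 (p n).
Proof. by move=> /(_ n)[Wp _]; exact: (span_sub HT (@fourier_L2 R) Wp). Qed.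

Lemma truncation_smooth f p n : truncation f p -> smooth (p n).
Proof. by move=> /(_ n)[Wp _]; exact: span_smooth Wp. Qed.

Lemma truncation_periodic f p n : truncation f p -> periodic T2 (p n).
Proof. by move=> /(_ n)[Wp _]; exact: span_periodic Wp. Qed.

Lemma truncation_cvg f p g : L2 f -> L2 g -> truncation f p ->
  ip (p n) g @[n --> \oo] --> ip f g.
Proof.
move=> f2 g2 tp; apply: (si_cvg HT) => // [n|]; first exact: truncation_L2 tp.
apply: (span_proj_cvg HT (@fourier_L2 R) f2) => [e e0|n|n]; try by case: (tp n).
have [p' [n Wp] fp] := trig_poly_dense f2.2 e0.
by exists n, p'.
Qed.

Lemma truncation_cvg_sq f p : L2 f -> truncation f p ->
  ip (f - p n) (f - p n) @[n --> \oo] --> (0 : R).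
Proof.
move=> f2 tp.
apply: (span_proj_cvg HT (@fourier_L2 R) f2) => [e e0|n|n]; try by case: (tp n).
have [p' [n Wp] fp] := trig_poly_dense f2.2 e0.
by exists n, p'.
Qed.

(** For q in the span, (f' - dp, q) = - (f - p, dq), and dq is in the span too:
    derivatives of truncations are truncations of derivatives. *)
Lemma truncation_partial i f f' p : L2 f -> L2 f' -> weak i f f' ->
  truncation f p -> truncation f' (fun n => pd i (p n)).
Proof.
move=> f2 f2' wf tp n; have [Wp fp] := tp n; split; first exact: span_partial.
have Wdp := span_partial i Wp.
have [p2 dp2] := (span_sub HT (@fourier_L2 R) Wp, span_sub HT (@fourier_L2 R) Wdp).
move=> q Wq; have Wdq := span_partial i Wq.
have [q2 dq2] := (span_sub HT (@fourier_L2 R) Wq, span_sub HT (@fourier_L2 R) Wdq).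
have [sp pp] := (span_smooth Wp, span_periodic Wp).
have [sq pq] := (span_smooth Wq, span_periodic Wq).
have e1 := wf q pq sq; have e2 := smooth_parts i pp sp pq sq.
have := fp _ Wdq; rewrite (si_Bl HT)// e1 e2 => h.
by rewrite (si_Bl HT)//; lra.
Qed.

(** Neither factor is smooth, so f is replaced by its truncations, which are
    test functions for g' and converge together with their derivatives. *)
Lemma weak_parts i f f' g g' : L2 f -> L2 f' -> L2 g -> L2 g' ->
  weak i f f' -> weak i g g' -> ip f g' = - ip f' g.
Proof.
move=> f2 f2' g2 g2' wf wg; have [p tp] := truncation_exists f2.
have c1 := truncation_cvg f2 g2' tp.
have c2 := truncation_cvg f2' g2 (truncation_partial f2 f2' wf tp).
suff e : (fun n => ip (p n) g') = - (fun n => ip (pd i (p n)) g).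
  by rewrite e in c1; exact: (cvg_unique _ c1 (cvgN c2)).
apply/funext => n; rewrite opprfctE.
have [sp pp] := (truncation_smooth n tp, truncation_periodic n tp).
have p2 := truncation_L2 n tp.
have dp2 := truncation_L2 n (truncation_partial f2 f2' wf tp).
by rewrite (si_sym HT p2)// (si_sym HT dp2)// wg// opprK.
Qed.

End sobolev_theory.

(** * Products and bounded functions *)

Section products.
Context {R : realType}.
Implicit Types (f g phi psi : R * R -> R) (i j : 'I_2) (M : R).
Local Notation pd i f := (fun x => 'D_(dir i) f x).
Local Notation mu := (@torus_measure R T2).
Local Notation PL := (measurableTypeR R * measurableTypeR R)%type.
Local Notation mufin := (@torus_finite R).
Local Notation L2 := (Lspace (@T2 R) 2%:E).
Local Notation wp i f := (wpartial (@T2 R) i f).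
Local Notation weak i f g := (weak_partial (@T2 R) i f g).
Local Notation H2 := (sobolev (@T2 R) 2 2%:E).
Local Notation ip := (inner (@T2 R)).
Local Notation HT := (@semi_inner_torus R).
Local Notation bdd f := (exists M : R, {ae mu, forall x : PL, `|f x| <= M}).

Lemma L2_mul_bdd f g : L2 f -> periodic T2 g -> measurable_fun (setT : set PL) g ->
  bdd g -> L2 (f \* g).
Proof.
move=> [pf f2] pg mg [M gM]; split; first exact: periodic_mul.
exact: L2_bmul f2 mg gM.
Qed.

Lemma L2_mul_smooth f phi : L2 f -> periodic T2 phi -> smooth phi -> L2 (f \* phi).
Proof.
move=> f2 pphi sphi; apply: L2_mul_bdd => //; first exact: smooth_measurable.
exact: smooth_bounded.
Qed.

Lemma L2_integrable2 f g : L2 f -> L2 g -> mu.-integrable setT (EFin \o (f \* g)).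
Proof. by move=> [_ f2] [_ g2]; exact: L2_mul_integrable. Qed.

Lemma L2_add f g : L2 f -> L2 g -> L2 (f + g).
Proof. exact: (siD HT). Qed.

Lemma inner_mulA f g h : ip (f \* g) h = ip f (g \* h).
Proof. by rewrite /inner; congr (Rintegral _ _ _); apply/funext => x /=; rewrite mulrA. Qed.

Lemma innerC f g : ip f g = ip g f.
Proof. by rewrite /inner; congr (Rintegral _ _ _); apply/funext => x /=; rewrite mulrC. Qed.

Lemma weak_mul_smooth i f f' phi : L2 f -> L2 f' -> weak i f f' ->
  periodic T2 phi -> smooth phi ->
  weak i (f \* phi) ((f' \* phi) + (f \* pd i phi)).
Proof.
move=> f2 f2' wf pphi sphi psi ppsi spsi.
have pp := periodic_mul pphi ppsi; have sp := smooth_mul sphi spsi.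
have [pdphi sdphi] := (periodic_partial i pphi, smooth_partial i sphi).
have [pdpsi sdpsi] := (periodic_partial i ppsi, smooth_partial i spsi).
have := wf _ pp sp.
have -> : pd i (phi \* psi) = (phi \* pd i psi) + (pd i phi \* psi).
  by apply/funext => x; rewrite partial_mul//; congr (_ + _); exact: mulrC.
have s1 := smooth_L2 (periodic_mul pphi pdpsi) (smooth_mul sphi sdpsi).
have s2 := smooth_L2 (periodic_mul pdphi ppsi) (smooth_mul sdphi spsi).
have psi2 := smooth_L2 ppsi spsi.
rewrite (si_Dr HT)// (si_Dl HT)//; [|exact: L2_mul_smooth..].
by rewrite !inner_mulA => h; lra.
Qed.

(** The product rule, from integration by parts against g phi. *)
Lemma weak_mul i f f' g g' : L2 f -> L2 f' -> L2 g -> L2 g' ->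
  weak i f f' -> weak i g g' -> weak i (f \* g) ((f' \* g) + (f \* g')).
Proof.
move=> f2 f2' g2 g2' wf wg phi pphi sphi.
have [pdphi sdphi] := (periodic_partial i pphi, smooth_partial i sphi).
have wgphi := weak_mul_smooth g2 g2' wg pphi sphi.
have gp2 := L2_mul_smooth g2 pphi sphi.
have g'p2 := L2_mul_smooth g2' pphi sphi.
have gdp2 := L2_mul_smooth g2 pdphi sdphi.
have := weak_parts f2 f2' gp2 (L2_add g'p2 gdp2) wf wgphi.
rewrite (si_Dr HT)// inner_mulA => h.
have -> : ip ((f' \* g) + (f \* g')) phi = ip f' (g \* phi) + ip f (g' \* phi).
  have i1 := L2_integrable2 f2' gp2; have i2 := L2_integrable2 f2 g'p2.
  have := RintegralD measurableT i1 i2; rewrite /inner => <-.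
  by congr (Rintegral _ _ _); apply/funext => x /=; rewrite mulrDl !mulrA.
by lra.
Qed.

Lemma Linfty_bdd f : Lspace T2 +oo%E f ->
  [/\ periodic T2 f, measurable_fun (setT : set PL) f & bdd f].
Proof.
move=> [pf]; rewrite inE => /andP[]; rewrite !inE/= => mf.
rewrite /finite_norm unlock; case: ifPn => [mu0 fin|mu0 _]; last first.
  split => //; exists 0; exists setT; split => //.
  by apply/eqP; rewrite -measure_le0 leNgt.
split => //; exists (fine (ess_sup mu (abse \o (EFin \o f)))).
have ge0 : (0 <= ess_sup mu (abse \o (EFin \o f)))%E.
  by apply: ess_sup_gee => //; apply: aeW => x; exact: abse_ge0.
apply: (ae_mono (ess_sup_ge mu (abse \o (EFin \o f)))) => x.
by rewrite -[X in (_ <= X)%E]fineK ?lee_fin// ge0_fin_numE.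
Qed.

(** The truncations of f are admissible in the definition of [Hspace], and their
    gradients converge to that of f. *)
Lemma divergence_free_H1 (v : vfield R) f (f' : 'I_2 -> R * R -> R) : Hspace v ->
  L2 f -> (forall j, L2 (f' j)) -> (forall j, weak j f (f' j)) ->
  \sum_(j < 2) ip (v j) (f' j) = 0.
Proof.
move=> [v2 _ vdiv] f2 f2' wf; have [p tp] := truncation_exists f2.
have c j : ip (pd j (p n)) (v j) @[n --> \oo] --> ip (f' j) (v j).
  exact: (truncation_cvg (f2' j) (v2 j) (truncation_partial f2 (f2' j) (wf j) tp)).
have cs : \sum_(j < 2) ip (pd j (p n)) (v j) @[n --> \oo] -->
    \sum_(j < 2) ip (f' j) (v j) by apply: cvg_big => [|j _]; [exact: add_continuous|exact: c].
have e : (fun n => \sum_(j < 2) ip (pd j (p n)) (v j)) = fun=> 0.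
  apply/funext => n.
  apply: etrans (vdiv _ (truncation_periodic n tp) (truncation_smooth n tp)).
  by apply: eq_bigr => j _; exact: innerC.
rewrite e in cs.
have h : \sum_(j < 2) ip (f' j) (v j) = 0 by exact: (cvg_unique _ cs (cvg_cst _)).
rewrite -[RHS]h.
by apply: eq_bigr => j _; exact: innerC.
Qed.

(** Sobolev embedding: the truncations of f are bounded uniformly by
    [smooth_sup], as the L^2 norms of their derivatives do not exceed those of
    f, and an L^2 limit inherits the bound. *)
Lemma H2_bdd f : H2 f -> bdd f.
Proof.
move=> hf; have f1 := H2_H1 hf; have f2 := H1_L2 f1.
have [d0 w0] := H1_wpartial 0 f1; have [d1 w1] := H1_wpartial 1 f1.
have [d10 w10] := H1_wpartial 1 (H2_wpartial 0 hf).
have [p tp] := truncation_exists f2.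
have tp0 := truncation_partial f2 d0 w0 tp.
have tp1 := truncation_partial f2 d1 w1 tp.
have tp10 := truncation_partial d0 d10 w10 tp0.
pose L := (pi *+ 2 : R); have L0 : 0 < L by exact: L_gt0.
pose m0 := fine (mu setT).
have m0E : (m0%:E = mu setT)%E.
  by rewrite fineK// ge0_fin_numE//; exact: mufin.
have absint g q n : L2 g -> truncation g q -> (\int[mu]_z `|q n z|%:E <= (m0 + ip g g)%:E)%E.
  move=> g2 tq; have q2 := truncation_L2 n tq.
  have iqq := L2_integrable2 q2 q2.
  have bound : ip (q n) (q n) <= ip g g.
    have [Wq gq] := tq n.
    exact: (span_proj_bounded HT (@fourier_L2 R) g2 Wq gq).
  apply: (@le_trans _ _ (\int[mu]_z (1 + (q n \* q n) z)%:E)%E).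
    apply: ge0_mono_integral => z _; rewrite lee_fin//=.
    by have := sqr_ge0 (`|q n z| - 1); have := real_normK (num_real (q n z)); nra.
  have i1 := integrable_cstT mufin 1.
  have -> : (\int[mu]_z (1 + (q n \* q n) z)%:E =
     \int[mu]_z 1%:E + \int[mu]_z ((q n \* q n) z)%:E)%E.
    exact: (integralD_EFin measurableT i1 iqq).
  rewrite integral_cst//= mul1e -m0E EFinD leeD2l//.
  rewrite -[leLHS]fineK ?lee_fin//; exact: integrable_fin_num.
pose C := (m0 + ip f f) + L * (m0 + ip (wp 1 f) (wp 1 f)) +
  L * (m0 + ip (wp 0 f) (wp 0 f) + L * (m0 + ip (wp 1 (wp 0 f)) (wp 1 (wp 0 f)))).
exists (C / (L * L)).
apply: (L2_lim_bounded (p := p) mufin f2.2).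
- by move=> n; have [] := truncation_L2 n tp.
- move=> n; apply: (ae_mono (@ae_cell R)) => x cx.
  have := smooth_sup (truncation_smooth n tp) cx.
  rewrite -/L ler_pdivlMr ?mulr_gt0// mulrC -lee_fin => h.
  have LE : (0 <= L%:E)%E by rewrite lee_fin ltW.
  have a0 := absint _ _ n f2 tp; have a1 := absint _ _ n d1 tp1.
  have a2 := absint _ _ n d0 tp0; have a3 := absint _ _ n d10 tp10.
  have k := leeD (leeD a0 (lee_wpmul2l LE a1))
    (lee_wpmul2l LE (leeD a2 (lee_wpmul2l LE a3))).
  by apply: (le_trans h); apply: (le_trans k); rewrite -!(EFinM, EFinD).
- exact: truncation_cvg_sq.
Qed.

End products.

(** * Vector fields on the torus *)

Section vector_calculus.
Context {R : realType}.
Implicit Types (u v w e m : vfield R) (i j : 'I_2).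
Local Notation mu := (@torus_measure R T2).
Local Notation PL := (measurableTypeR R * measurableTypeR R)%type.
Local Notation L2 := (Lspace (@T2 R) 2%:E).
Local Notation wp i f := (wpartial (@T2 R) i f).
Local Notation weak i f g := (weak_partial (@T2 R) i f g).
Local Notation H1 := (sobolev (@T2 R) 1 2%:E).
Local Notation H2 := (sobolev (@T2 R) 2 2%:E).
Local Notation ip := (inner (@T2 R)).
Local Notation HT := (@semi_inner_torus R).
Local Notation bdd f := (exists M : R, {ae mu, forall x : PL, `|f x| <= M}).

Lemma semi_inner_vec : semi_inner (@L2vec R) innerv.
Proof.
split.
- by move=> i; exact: (si0 HT).
- by move=> a u w hu hw i; have [_ h _ _ _] := HT; exact: h.
- by move=> u w hu hw; apply: eq_bigr => i _; exact: innerC.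
- move=> a u w z hu hw hz; rewrite /innerv mulr_sumr -big_split /=.
  by apply: eq_bigr => i _; exact: (si_linl HT).
- by move=> u hu; apply: sumr_ge0 => i _; exact: (si_ge0 HT).
Qed.

Definition H1vec : set (vfield R) := [set u | forall i, H1 (u i)].
Definition gradip u w : R :=
  \sum_(i < 2) \sum_(j < 2) ip (wp j (u i)) (wp j (w i)).

Lemma semi_inner_grad : semi_inner H1vec gradip.
Proof.
have dL2 u i j : H1vec u -> L2 (wp j (u i)).
  by move=> hu; have [] := H1_wpartial j (hu i).
split.
- move=> i; apply: (H1_intro (g := fun _ => 0)) => [|j|j]; try exact: (si0 HT).
  move=> phi pphi sphi; rewrite !(si_0l HT) ?oppr0//; first exact: smooth_L2.
  by apply: smooth_L2; [exact: periodic_partial|exact: smooth_partial].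
- by move=> a u w hu hw i; exact: H1_lin.
- by move=> u w hu hw; do 2!apply: eq_bigr => ? _; exact: innerC.
- move=> a u w z hu hw hz; rewrite /gradip mulr_sumr -big_split /=.
  apply: eq_bigr => i _; rewrite mulr_sumr -big_split /=.
  apply: eq_bigr => j _; rewrite -(si_linl HT); [|exact: dL2..].
  apply: ip_ael; last exact: (wpartial_lin j a (hu i) (hw i)).
  + by have [] := H1_wpartial j (H1_lin a (hu i) (hw i)).
  + by have [_ h _ _ _] := HT; apply: h; exact: dL2.
  + exact: dL2.
- by move=> u hu; do 2!(apply: sumr_ge0 => ? _); apply: (si_ge0 HT); exact: dL2.
Qed.

Lemma Hspace_lin a u w : Hspace u -> Hspace w -> Hspace (a *: u + w).
Proof.
move=> [u2 u0 ud] [w2 w0 wd]; have [_ hlin _ _ _] := semi_inner_vec.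
split; first exact: hlin.
- move=> i; have iu := L1_integrable (L2_L1 (u2 i)).
  have iw := L1_integrable (L2_L1 (w2 i)).
  have iau := integrableZl measurableT a iu.
  have h1 := RintegralD measurableT iau iw.
  have h2 := RintegralZl a measurableT iu.
  apply: etrans h1 _; rewrite [X in X + _]h2.
  by rewrite [X in _ * X]u0 [X in _ + X]w0 mulr0 addr0.
- move=> phi pphi sphi.
  have d2 j : L2 (fun x => 'D_(dir j) phi x).
    by apply: smooth_L2; [exact: periodic_partial|exact: smooth_partial].
  have hu := ud _ pphi sphi; have hw := wd _ pphi sphi.
  transitivity (a * (\sum_(j < 2) ip (u j) (fun x => 'D_(dir j) phi x)) +
    \sum_(j < 2) ip (w j) (fun x => 'D_(dir j) phi x)).
    rewrite mulr_sumr -big_split /=.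
    by apply: eq_bigr => j _; exact: (si_linl HT).
  by rewrite hu hw mulr0 addr0.
Qed.

Lemma Vspace_lin a u w : Vspace u -> Vspace w -> Vspace (a *: u + w).
Proof.
move=> [hu su] [hw sw]; split; first exact: Hspace_lin.
by move=> i; exact: H1_lin.
Qed.

Lemma subE u w : u - w = -1 *: w + u.
Proof. by rewrite scaleN1r addrC. Qed.

Lemma HspaceB u w : Hspace u -> Hspace w -> Hspace (u - w).
Proof. by move=> hu hw; rewrite subE; exact: Hspace_lin. Qed.

Lemma VspaceB u w : Vspace u -> Vspace w -> Vspace (u - w).
Proof. by move=> hu hw; rewrite subE; exact: Vspace_lin. Qed.

Lemma HspaceD u w : Hspace u -> Hspace w -> Hspace (u + w).
Proof. by move=> hu hw; rewrite -[u]scale1r; exact: Hspace_lin. Qed.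

Lemma Hspace_L2 u : Hspace u -> L2vec u. Proof. by case. Qed.

Lemma Vspace_H1 u : Vspace u -> H1vec u. Proof. by case. Qed.

Lemma DAspace_V u : DAspace u -> Vspace u.
Proof. by move=> [hu su]; split => // i; exact: H2_H1. Qed.

Lemma H2_measurable_bdd f : H2 f -> [/\ periodic T2 f,
  measurable_fun (setT : set PL) f & bdd f].
Proof.
move=> hf; have f2 := H1_L2 (H2_H1 hf); split; first by case: f2.
- exact: L2_measurable.
- exact: H2_bdd.
Qed.

Lemma L2_sum (F : 'I_2 -> R * R -> R) : (forall j, L2 (F j)) ->
  L2 (\sum_(j < 2) F j).
Proof.
move=> h; elim/big_rec: _ => [|j f _ f2]; first exact: (si0 HT).
by apply: (siD HT) => //; exact: h.
Qed.

Lemma Rintegral_sum (F : 'I_2 -> PL -> R) :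
  (forall j, mu.-integrable setT (EFin \o F j)) ->
  Rintegral mu setT (fun x => \sum_(j < 2) F j x) =
  \sum_(j < 2) Rintegral mu setT (F j).
Proof.
move=> iF; rewrite !big_ord_recl big_ord0 addr0.
rewrite -(RintegralD measurableT (iF _) (iF _)).
by congr (Rintegral _ _ _); apply/funext => x; rewrite !big_ord_recl big_ord0 addr0.
Qed.

Lemma advection_L2 v e : DAspace v -> H1vec e -> L2vec (advection v e).
Proof.
move=> [_ hv] he i; rewrite /advection.
have h j : L2 (fun x => v j x * wp j (e i) x).
  have [pv mv bv] := H2_measurable_bdd (hv j).
  have [d2 _] := H1_wpartial j (he i).
  rewrite (_ : (fun x => _) = wp j (e i) \* v j); first exact: L2_mul_bdd.
  by apply/funext => x; rewrite mulrC.
rewrite (_ : (fun x => _) = \sum_(j < 2) (fun x => v j x * wp j (e i) x)).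
  exact: L2_sum.
by apply/funext => x; rewrite fct_sumE.
Qed.

Lemma H1_sq f : H1 f -> bdd f -> forall i, weak i (f \* f) (2 *: (f \* wp i f)) /\
  L2 (f \* f) /\ L2 (f \* wp i f).
Proof.
move=> hf bf i; have [pf _] := H1_L2 hf; have mf := L2_measurable (H1_L2 hf).
have [d2 wd] := H1_wpartial i hf.
have ff2 := L2_mul_bdd (H1_L2 hf) pf mf bf.
have fd2 : L2 (f \* wp i f).
  rewrite (_ : _ \* _ = wp i f \* f); first exact: L2_mul_bdd.
  by apply/funext => x /=; rewrite mulrC.
split => //; rewrite (_ : 2 *: _ = (wp i f \* f) + (f \* wp i f)).
  by apply: weak_mul => //; exact: H1_L2.
by apply/funext => x; rewrite !fctE /GRing.scale/=; ring.
Qed.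

(** (v . grad e) . e is half of v . grad |e|^2, and v is orthogonal to
    gradients; boundedness of e makes |e|^2 an admissible potential. *)
Lemma innerv_advection_self v e : Hspace v -> H1vec e -> (forall i, bdd (e i)) ->
  L2vec (advection v e) -> innerv (advection v e) e = 0.
Proof.
move=> hv he be ave2.
have key i : ip (advection v e i) (e i) = \sum_(j < 2) ip (v j) (e i \* wp j (e i)).
  have iv j : mu.-integrable setT (EFin \o (v j \* (e i \* wp j (e i)))).
    apply: L2_integrable2; first exact: Hspace_L2.
    by have [_ []] := H1_sq (he i) (be i) j.
  apply: etrans (Rintegral_sum iv).
  congr (Rintegral _ _ _); apply/funext => x.
  rewrite /advection /= mulr_suml; apply: eq_bigr => j _.
  by rewrite mulrAC mulrA.
rewrite /innerv big1// => i _; rewrite key.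
have := divergence_free_H1 hv (f := e i \* e i) (f' := fun j => 2 *: (e i \* wp j (e i))).
have sq := H1_sq (he i) (be i).
move=> /(_ (sq 0).2.1 (fun j => siZ HT 2 (sq j).2.2) (fun j => (sq j).1)) h.
suff : 2 * (\sum_(j < 2) ip (v j) (e i \* wp j (e i))) = 0 by lra.
rewrite -[RHS]h mulr_sumr; apply: eq_bigr => j _; rewrite (si_Zr HT)//.
- exact: Hspace_L2.
- exact: (sq j).2.2.
Qed.

End vector_calculus.

Section vector_identities.
Context {R : realType}.
Implicit Types (u v w e m : vfield R) (i j : 'I_2) (f g : R * R -> R).
Local Notation mu := (@torus_measure R T2).
Local Notation PL := (measurableTypeR R * measurableTypeR R)%type.
Local Notation mufin := (@torus_finite R).
Local Notation L2 := (Lspace (@T2 R) 2%:E).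
Local Notation wp i f := (wpartial (@T2 R) i f).
Local Notation weak i f g := (weak_partial (@T2 R) i f g).
Local Notation H1 := (sobolev (@T2 R) 1 2%:E).
Local Notation H2 := (sobolev (@T2 R) 2 2%:E).
Local Notation ip := (inner (@T2 R)).
Local Notation HV := (@semi_inner_vec R).
Local Notation HG := (@semi_inner_grad R).
Local Notation bdd f := (exists M : R, {ae mu, forall x : PL, `|f x| <= M}).

Lemma H2_lin a f g : H2 f -> H2 g -> H2 (a *: f + g).
Proof.
move=> hf hg; have [f1 g1] := (H2_H1 hf, H2_H1 hg).
have [fg2 _] := H1_lin a f1 g1; split => // i.
exists (a *: wp i f + wp i g); split; last by apply: H1_lin; exact: H2_wpartial.
have [? ?] := H1_wpartial i f1; have [? ?] := H1_wpartial i g1.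
by apply: weak_lin => //; exact: H1_L2.
Qed.

Lemma ae_forall2 (Q : 'I_2 -> PL -> Prop) :
  (forall i, {ae mu, forall x, Q i x}) -> {ae mu, forall x, forall i, Q i x}.
Proof.
move=> h; apply: (ae_mono2 (h 0) (h 1)) => x h0 h1 i.
by case: (ord2P i) => ->.
Qed.

Lemma DAspaceB u w : DAspace u -> DAspace w -> DAspace (u - w).
Proof.
move=> [hu su] [hw sw]; split; first exact: HspaceB.
by rewrite subE => i; exact: H2_lin.
Qed.

Lemma bounded_sobolev_L2 k f : sobolev T2 k +oo%E f -> L2 f /\ bdd f.
Proof.
have h : Lspace T2 +oo%E f -> L2 f /\ bdd f.
  move=> /Linfty_bdd[pf mf [M fM]]; split; last by exists M.
  by split => //; exact: (L2_bounded mufin mf fM).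
by case: k => [|k] [fy _]; exact: h.
Qed.

(** Both terms of the product rule are in L^2 because the coefficient and its
    first derivatives are bounded. *)
Lemma H1_mul_bounded f c : H1 f -> sobolev T2 1 +oo%E c -> H1 (f \* c).
Proof.
move=> hf hm; have [m2 bm] := bounded_sobolev_L2 hm.
have f2 := H1_L2 hf; have mm := L2_measurable m2.
have [g wg] : exists g : 'I_2 -> R * R -> R,
    forall i, weak i c (g i) /\ sobolev T2 0 +oo%E (g i).
  by case: hm => _ h; have [g hg] := choice h; exists g.
have fm2 : L2 (f \* c) by apply: L2_mul_bdd => //; case: m2.
apply: (H1_intro (g := fun i => (wp i f \* c) + (f \* g i))) => // i.
- have [d2 _] := H1_wpartial i hf; have [_ /bounded_sobolev_L2[g2 bg]] := wg i.
  apply: L2_add; apply: L2_mul_bdd => //; [by case: m2|by case: g2|].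
  exact: L2_measurable.
- have [d2 wd] := H1_wpartial i hf; have [wgi /bounded_sobolev_L2[g2 bg]] := wg i.
  exact: weak_mul.
Qed.

Lemma sobolev_pred k q f : sobolev T2 k.+1 q f -> sobolev T2 k q f.
Proof.
elim: k f => [|k ih] f [f2 h]; first by [].
by split => // i; have [g [wg hg]] := h i; exists g; split => //; exact: ih.
Qed.

Lemma H1_dot e m : H1vec e -> (forall i, sobolev T2 1 +oo%E (m i)) -> H1 (dot e m).
Proof.
move=> he hm; rewrite (_ : dot e m = \sum_(i < 2) (e i \* m i)); last first.
  by apply/funext => x; rewrite fct_sumE.
elim/big_rec: _ => [|i f _ hf].
  by have := si0 HG; exact: (fun h => h 0).
by rewrite -[X in X + _]scale1r; apply: H1_lin => //; exact: H1_mul_bounded.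
Qed.

Lemma ip_sum_l (F : 'I_2 -> R * R -> R) g : (forall j, L2 (F j)) -> L2 g ->
  ip (fun x => \sum_(j < 2) F j x) g = \sum_(j < 2) ip (F j) g.
Proof.
move=> F2 g2; have iF j := L2_integrable2 (F2 j) g2.
apply: etrans (Rintegral_sum iF); congr (Rintegral _ _ _).
by apply/funext => x /=; rewrite mulr_suml.
Qed.

Lemma weak_laplacian_L2 u : DAspace u -> L2vec (weak_laplacian u).
Proof.
move=> [_ hu] i; rewrite /weak_laplacian.
rewrite (_ : (fun x => _) = \sum_(j < 2) wp j (wp j (u i))); last first.
  by apply/funext => x; rewrite fct_sumE.
by apply: L2_sum => j; have [] := H1_wpartial j (H2_wpartial j (hu i)).
Qed.

Lemma innerv_laplacian u w : DAspace u -> H1vec w ->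
  innerv (weak_laplacian u) w = - gradip u w.
Proof.
move=> [_ hu] hw; rewrite /innerv /gradip -sumrN; apply: eq_bigr => i _.
have dd j := H1_wpartial j (H2_wpartial j (hu i)).
have dw j := H1_wpartial j (hw i).
rewrite ip_sum_l => [|j|]; [|by case: (dd j)|exact: H1_L2].
rewrite -sumrN; apply: eq_bigr => j _.
have [dd2 wdd] := dd j; have [dw2 wdw] := dw j.
have d2 := H1_L2 (H2_wpartial j (hu i)).
by rewrite (weak_parts d2 dd2 (H1_L2 (hw i)) dw2 wdd wdw) opprK.
Qed.

Lemma innerv_ae u u' w : L2vec u -> L2vec u' -> L2vec w -> ae_eqv u u' ->
  innerv u w = innerv u' w.
Proof.
move=> hu hu' hw uu'; apply: eq_bigr => i _; apply: ip_ael => //.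
by apply: (ae_mono uu').
Qed.

Lemma trilinearE u v w : L2vec (advection u v) -> L2vec w ->
  trilinear u v w = innerv (advection u v) w.
Proof.
move=> h hw; rewrite /trilinear /dot.
by apply: Rintegral_sum => i; exact: (L2_integrable2 (h i) (hw i)).
Qed.

(** With e = v - u the difference of the convection terms is (v . grad) e +
    (e . grad) u, and the first of these is orthogonal to e. *)
Lemma innerv_advection_sub u v : DAspace u -> DAspace v ->
  innerv (advection v v - advection u u) (v - u) = trilinear (v - u) u (v - u).
Proof.
move=> hu hv; have he := DAspaceB hv hu; set e := v - u in he *.
have [[u1 v1] e1] := (Vspace_H1 (DAspace_V hu), Vspace_H1 (DAspace_V hv),
  Vspace_H1 (DAspace_V he)).
have e2 := Hspace_L2 he.1.
have avv := advection_L2 hv v1; have auu := advection_L2 hu u1.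
have ave := advection_L2 hv e1; have aeu := advection_L2 he u1.
have -> : innerv (advection v v - advection u u) e =
    innerv (advection v e + advection e u) e.
  apply: innerv_ae => //; [exact: (siB HV)|exact: (siD HV)|].
  have dE i j := wpartial_lin j (-1) (u1 i) (v1 i).
  apply: (ae_mono (ae_forall2 (fun i => ae_forall2 (dE i)))) => x dEx i.
  have d j : wp j (e i) x = wp j (v i) x - wp j (u i) x.
    have -> : e i = -1 *: u i + v i by rewrite /e -[RHS]/((-1 *: u + v) i) -subE.
    by rewrite dEx !fctE /GRing.scale/=; ring.
  rewrite /advection !fctE -sumrB -big_split /=; apply: eq_bigr => j _.
  rewrite d (_ : e j x = v j x - u j x)//; ring.
rewrite (si_Dl HV)// trilinearE//.
rewrite innerv_advection_self ?add0r//; first exact: hv.1.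
by move=> i; apply: H2_bdd; exact: he.2.
Qed.

(** The feedback acts along m, so only its product with e . m is seen. *)
Lemma innerv_nudging (g : R * R -> R) e m : L2 g -> L2vec e ->
  (forall i, sobolev T2 1 +oo%E (m i)) ->
  L2vec (fun i x => g x * m i x) /\
  innerv (fun i x => g x * m i x) e = ip g (dot e m).
Proof.
move=> g2 e2 hm; have h i := bounded_sobolev_L2 (hm i).
have gm2 i : L2 (g \* m i).
  by have [m2 bm] := h i; apply: L2_mul_bdd => //; [case: m2|exact: L2_measurable].
split; first exact: gm2.
have iF i := L2_integrable2 (gm2 i) (e2 i).
rewrite /innerv; apply/esym; apply: etrans (Rintegral_sum iF).
congr (Rintegral _ _ _); apply/funext => x; rewrite /dot /= mulr_sumr.
by apply: eq_bigr => i _; ring.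
Qed.

Lemma projection_inner (P : vfield R -> vfield R) F w : leray_projection P ->
  L2vec F -> Hspace w -> Hspace (P F) /\ innerv (P F) w = innerv F w.
Proof.
move=> hP F2 hw; have [hPF h] := hP F F2; split => //.
have := h w hw; rewrite (si_Bl HV)//; [by lra|exact: Hspace_L2..].
Qed.

End vector_identities.

(** * The energy estimate at a fixed time *)

Section energy_estimate.
Context {R : realType}.
Implicit Types (u v w e m : vfield R) (i j : 'I_2) (f g : R * R -> R).
Local Notation mu := (@torus_measure R T2).
Local Notation L2 := (Lspace (@T2 R) 2%:E).
Local Notation wp i f := (wpartial (@T2 R) i f).
Local Notation ip := (inner (@T2 R)).
Local Notation HT := (@semi_inner_torus R).
Local Notation HV := (@semi_inner_vec R).
Local Notation HG := (@semi_inner_grad R).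

(** The tangent of the concave function ln at 1 + a, weakened by 1 + a >= a. *)
Lemma ln_tangent (a x : R) : 0 < a -> 0 <= x ->
  ln (1 + x) <= ln (1 + a) + x / a.
Proof.
move=> a0 x0; have a1 : 0 < 1 + a by lra.
have e : 1 + x = (1 + a) * (1 + (x - a) / (1 + a)) by field; lra.
have h1 : (x - a) / (1 + a) <= x / a.
  rewrite ler_pdivrMr// mulrDr mulr1 mulrAC -mulrA divff ?gt_eqF// mulr1.
  have : 0 <= x / a by rewrite divr_ge0// ltW.
  by lra.
have hm1 : -1 < (x - a) / (1 + a).
  by rewrite ltr_pdivlMr//; lra.
rewrite e lnM ?posrE//; last by lra.
by rewrite lerD2l (le_trans _ h1)// le_ln1Dx.
Qed.

(** The value of Bstar is what makes the logarithmic growth absorbable: the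
    tangent is taken at a = 4 C A / nu, so that the remainder is nu G / 4. *)
Lemma log_absorb (nu A C mu G rho Hn l : R) : 0 < nu -> 0 <= A -> 0 <= rho ->
  rho <= Hn -> Hn <= C * G -> 0 <= G ->
  A * (1 + ln (1 + 4 * C * A / nu)) <= mu ->
  l = (if rho == 0 then 1 else 1 + ln (1 + Hn / rho)) ->
  A * l * rho <= mu * rho + nu / 4 * G.
Proof.
move=> nu0 A0 rho0 rH HC G0 hmu ->.
have [->|rn0] := eqVneq rho 0.
  by rewrite !mulr0 add0r mulr_ge0//; lra.
have rpos : 0 < rho by rewrite lt_neqAle eq_sym rn0.
have CG : 0 < C * G by apply: lt_le_trans HC; exact: lt_le_trans rH.
have Gpos : 0 < G by rewrite lt_neqAle eq_sym G0 andbT; apply: contraTneq CG => ->; rewrite mulr0 ltxx.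
have Cpos : 0 < C by rewrite -(pmulr_lgt0 _ Gpos).
have x0 : 0 <= Hn / rho by rewrite divr_ge0// (le_trans rho0).
move: A0; rewrite le_eqVlt => /predU1P[A0|Apos].
  by move: hmu; rewrite -A0 !mul0r => hmu; rewrite addr_ge0 ?mulr_ge0//; lra.
set a := 4 * C * A / nu in hmu *.
have a0 : 0 < a by rewrite divr_gt0// !mulr_gt0.
have h := ln_tangent a0 x0.
have h1 : A * (Hn / rho / a) * rho <= nu / 4 * G.
  rewrite (_ : _ * rho = nu / 4 * (Hn / C)); last by rewrite /a; field; rewrite !gt_eqF.
  by rewrite ler_wpM2l ?ler_pdivrMr// ?[G * C]mulrC//; lra.
have h2 : A * (1 + ln (1 + Hn / rho)) * rho <=
    A * (1 + ln (1 + a)) * rho + A * (Hn / rho / a) * rho.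
  rewrite -mulrDl -mulrDr ler_wpM2r// ler_wpM2l ?(ltW Apos)//.
  by rewrite -addrA lerD2l.
apply: (le_trans h2); apply: lerD => //.
by rewrite ler_wpM2r.
Qed.

(** Young's inequality: half of mu rho is spent on the interpolation error, the
    rest is the damping that the feedback provides. *)
Lemma nudging_young (mu rho D G k nu x s d : R) : 0 < mu ->
  s ^+ 2 = rho -> d ^+ 2 = D -> x <= k * d * s ->
  mu * (k ^+ 2 * D) <= nu / 4 * G ->
  mu * x - mu * rho <= - (mu / 2) * rho + nu / 8 * G.
Proof.
move=> mu0 <- <- hx hD.
have k2 : k * d * s <= s ^+ 2 / 2 + k ^+ 2 * d ^+ 2 / 2.
  rewrite -subr_ge0 (_ : _ - _ = (k * d - s) ^+ 2 / 2); last by field.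
  by rewrite divr_ge0// sqr_ge0.
have : mu * x <= mu * (s ^+ 2 / 2 + k ^+ 2 * d ^+ 2 / 2).
  by rewrite ler_wpM2l ?(ltW mu0)// (le_trans hx).
rewrite (_ : mu * (s ^+ 2 / 2 + k ^+ 2 * d ^+ 2 / 2) = mu / 2 * s ^+ 2 + mu * (k ^+ 2 * d ^+ 2) / 2); last by field.
by rewrite (_ : - (mu / 2) * _ = mu / 2 * s ^+ 2 - mu * s ^+ 2); [lra|field].
Qed.

(** The bookkeeping of the estimate in scalars.  Of the viscous term nu G, one
    half goes to the trilinear term, one eighth to the logarithm (which enters
    halved) and one eighth to the interpolation error; the remaining quarter
    gives the decay rate nu lam / 2 of the squared norm. *)
Lemma dissipation_balance (nu lam E G b b' N A l rho mu du dv gu gv au av F : R) :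
  0 < nu -> lam * E <= G -> du + nu * gu + au = F -> dv + nu * gv + av = F - N ->
  gv - gu = G -> av - au = b -> `|b| <= nu / 2 * G + b' -> b' <= A / 2 * l * rho ->
  A * l * rho <= mu * rho + nu / 4 * G -> - N <= - (mu / 2) * rho + nu / 8 * G ->
  2 * (dv - du) <= - (nu * lam / 2) * E.
Proof.
move=> nu0 hE hu hv hG hb bb bA ab hN.
have hb' := ler_norm (- b); rewrite normrN in hb'.
have nlam : nu * (lam * E) <= nu * G by rewrite ler_wpM2l ?(ltW nu0).
have e : nu * gv - nu * gu = nu * G by rewrite -hG mulrBr.
have -> : - (nu * lam / 2) * E = - (nu * (lam * E)) / 2 by field.
have e2 : A / 2 * l * rho = A * l * rho / 2 by field.
have e3 : nu / 2 * G = nu * G / 2 by field.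
have e4 : nu / 4 * G = nu * G / 4 by field.
have e5 : nu / 8 * G = nu * G / 8 by field.
have e6 : - (mu / 2) * rho = - (mu * rho / 2) by field.
rewrite e2 in bA; rewrite e3 in bb; rewrite e4 in ab; rewrite e5 e6 in hN.
lra.
Qed.

Lemma Hnorm_sq1 f : Hnorm_sq T2 1 f = ip f f + \sum_(i < 2) ip (wp i f) (wp i f).
Proof. by rewrite /=; congr (_ + _); apply: eq_bigr => i _; rewrite addr0. Qed.

(** At almost every time the difference of the two equations is paired with
    e = v - u.  The projection disappears because e is in H, the convection terms
    leave b(e, u, e), and the logarithm in its bound is absorbed by the feedback:
    this is where the lower bound on mu is used. *)
Lemma energy_dissipation (lam1 nu Km Cfr c1 mu0 h U0 U1 : R)
    (P : vfield R -> vfield R) (I : (R * R -> R) -> R * R -> R)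
    (f u v ut vt m : vfield R) :
  poincare_constant lam1 -> leray_projection P -> 0 < nu -> L2vec f ->
  (forall i, sobolev T2 2 +oo%E (m i)) -> trilinear_constant lam1 m Km ->
  frame_constant m Cfr ->
  linear_on_L2 I ->
  (forall g, sobolev T2 1 2%:E g ->
     Num.sqrt (ip (g - I g) (g - I g)) <= c1 * h * Num.sqrt
       (\sum_(i < 2) ip (wp i g) (wp i g))) ->
  0 < mu0 -> Bstar nu Km Cfr U1 <= mu0 ->
  c1 ^+ 2 * Cfr * mu0 * h ^+ 2 <= nu / 4 ->
  shear_small Km lam1 nu U0 m -> normL2 u <= U0 -> grad_norm u <= U1 ->
  DAspace u -> DAspace v -> L2vec ut -> L2vec vt ->
  ae_eqv (ut + nu *: stokes P u + bilinear P u u) f ->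
  ae_eqv (vt + nu *: stokes P v + bilinear P v v)
    (f - mu0 *: P (fun i x => I (dot (v - u) m) x * m i x)) ->
  2 * innerv (vt - ut) (v - u) <= - (nu * lam1 / 2) * innerv (v - u) (v - u).
Proof.
move=> [lam0 hlam] hP nu0 f2 hm [Km0 hK] hC [I2 _] hI mu00 hB hc hshear uU0 uU1
  hu hv ut2 vt2 equ eqv.
have he := DAspaceB hv hu; set e := v - u in he *.
have Ve := DAspace_V he; have e1 := Vspace_H1 Ve.
have [Vu Vv] := (DAspace_V hu, DAspace_V hv).
have [u1 v1] := (Vspace_H1 Vu, Vspace_H1 Vv).
have He := he.1; have e2 := Hspace_L2 He.
set r := dot e m; have hm1 i := sobolev_pred (hm i).
have r1 : sobolev T2 1 2%:E r by exact: H1_dot.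
have r2 := H1_L2 r1; have Ir2 : L2 (I r) by exact: I2.
have [n2 nE] := innerv_nudging Ir2 e2 hm1.
have auu := advection_L2 hu u1; have avv := advection_L2 hv v1.
have [lu lv] := (weak_laplacian_L2 hu, weak_laplacian_L2 hv).
have [hPu Pu] := projection_inner hP lu He.
have [hPv Pv] := projection_inner hP lv He.
have [hBu Bu] := projection_inner hP auu He.
have [hBv Bv] := projection_inner hP avv He.
have [hN N] := projection_inner hP n2 He.
have [hN2 Pl2u Pl2v] : [/\ L2vec (P (fun i x => I r x * m i x)),
  L2vec (P (weak_laplacian u)) & L2vec (P (weak_laplacian v))].
  by split; exact: Hspace_L2.
have sum_inner w (wt A' B' : vfield R) : L2vec w -> L2vec wt -> L2vec A' -> L2vec B' ->
    L2vec (wt + nu *: A' + B') /\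
    innerv (wt + nu *: A' + B') w = innerv wt w + nu * innerv A' w + innerv B' w.
  move=> w2 wt2 A2 B2; have nA := siZ HV nu A2; have wA := siD HV wt2 nA.
  split; first exact: (siD HV wA B2).
  by rewrite (si_Dl HV wA B2 w2) (si_Dl HV wt2 nA w2) (si_Zl HV nu A2 w2).
have Eu : innerv ut e + nu * gradip u e + innerv (advection u u) e = innerv f e.
  have [S2 SE] := sum_inner e ut _ _ e2 ut2 (siN HV Pl2u) (Hspace_L2 hBu).
  rewrite -(innerv_ae S2 f2 e2 equ) SE Bu (si_Nl HV Pl2u e2) Pu.
  by rewrite innerv_laplacian// opprK.
have Ev : innerv vt e + nu * gradip v e + innerv (advection v v) e =
    innerv f e - mu0 * ip (I r) r.
  have [S2 SE] := sum_inner e vt _ _ e2 vt2 (siN HV Pl2v) (Hspace_L2 hBv).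
  have nN := siZ HV mu0 hN2.
  have F2 := siB HV f2 nN.
  have e3 := innerv_ae S2 F2 e2 eqv.
  rewrite SE Bv (si_Nl HV Pl2v e2) Pv (si_Bl HV f2 nN e2) (si_Zl HV mu0 hN2 e2) in e3.
  by rewrite N nE innerv_laplacian// opprK in e3.
set G := gradip e e; have G0 : 0 <= G by exact: (si_ge0 HG).
have GE : gradip v e - gradip u e = G by rewrite -(si_Bl HG).
have AE : innerv (advection v v) e - innerv (advection u u) e = trilinear e u e.
  by rewrite -(si_Bl HV)// innerv_advection_sub.
have g2 : grad_norm e ^+ 2 = G by exact: (si_sqrt_sqr HG).
have l2 : normL2 e ^+ 2 = innerv e e by exact: (si_sqrt_sqr HV).
have poin := hlam e Ve; rewrite g2 l2 in poin.
set rho := ip r r; have rho0 : 0 <= rho by exact: (si_ge0 HT).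
set D := \sum_(i < 2) ip (wp i r) (wp i r).
have D0 : 0 <= D.
  by apply: sumr_ge0 => i _; apply: (si_ge0 HT); have [] := H1_wpartial i r1.
have HnE : Hnorm_sq T2 1 r = rho + D by exact: Hnorm_sq1.
have HnC : rho + D <= Cfr * G by rewrite -HnE -g2; exact: hC.
have l0 : 1 <= log_factor r.
  rewrite /log_factor; case: ifP => // _; rewrite lerDl ln_ge0// lerDl.
  by rewrite HnE divr_ge0// addr_ge0.
have U10 : 0 <= U1 by apply: le_trans uU1; exact: sqrtr_ge0.
have shear_u : shear_small Km lam1 nu (normL2 u) m.
  apply: le_trans hshear; apply: lee_wpmul2r; first exact: Lnorm_ge0.
  rewrite lee_fin ler_wpM2l// mulr_ge0 ?invr_ge0 ?sqrtr_ge0//; exact: ltW.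
have tri : `|trilinear e u e| <= nu / 2 * G +
    Km / nu * grad_norm u ^+ 2 * log_factor r * rho.
  by rewrite -g2; exact: (hK nu u e nu0 Vu Ve shear_u).
set A := Astar nu Km U1.
have A0 : 0 <= A by rewrite /A /Astar mulr_ge0 ?sqr_ge0// divr_ge0 ?mulr_ge0// ltW.
have tri2 : Km / nu * grad_norm u ^+ 2 * log_factor r * rho <= A / 2 * log_factor r * rho.
  rewrite ler_wpM2r// ler_wpM2r//; first by apply: le_trans l0.
  rewrite (_ : A / 2 = Km / nu * U1 ^+ 2); last by rewrite /A /Astar; field; rewrite gt_eqF.
  rewrite ler_wpM2l ?divr_ge0 ?(ltW Km0) ?(ltW nu0)//.
  by rewrite ler_sqr ?nnegrE ?sqrtr_ge0.
have absorb : A * log_factor r * rho <= mu0 * rho + nu / 4 * G.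
  apply: (@log_absorb nu A Cfr mu0 G rho (rho + D)) => //; first by rewrite lerDl.
  by rewrite /log_factor HnE.
have nudge : - (mu0 * ip (I r) r) <= - (mu0 / 2) * rho + nu / 8 * G.
  have rI2 : L2 (r - I r) := siB HT r2 Ir2.
  have cs := le_trans (ler_norm _) (si_CS HT rI2 r2).
  have hIr := hI r r1; rewrite -/D in hIr.
  have e3 : ip (I r) r = rho - ip (r - I r) r by rewrite (si_Bl HT r2 Ir2 r2) opprB addrC subrK.
  rewrite e3 mulrBr opprB.
  have k1 : ip (r - I r) r <= c1 * h * Num.sqrt D * Num.sqrt rho.
    by apply: (le_trans cs); rewrite ler_wpM2r// sqrtr_ge0.
  have k3 : mu0 * ((c1 * h) ^+ 2 * D) <= nu / 4 * G.
    apply: (@le_trans _ _ (c1 ^+ 2 * Cfr * mu0 * h ^+ 2 * G)); last by rewrite ler_wpM2r.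
    rewrite (_ : _ * G = mu0 * ((c1 * h) ^+ 2 * (Cfr * G))); last by ring.
    rewrite ler_wpM2l ?(ltW mu00)// ler_wpM2l ?sqr_ge0//.
    by apply: le_trans HnC; rewrite lerDr.
  exact: (nudging_young mu00 (sqr_sqrtr rho0) (sqr_sqrtr D0) k1 k3).
rewrite (si_Bl HV vt2 ut2 e2).
exact: (dissipation_balance nu0 poin Eu Ev GE AE tri tri2 absorb nudge).
Qed.

End energy_estimate.

(** * Smooth bumps and steps on the line *)

Section bump.
Context {R : realType}.
Implicit Types (P : {poly R}) (k : nat) (x y : R).

Let W : {poly R} := 'X - 'X^2.

Let WE x : W.[x] = x * (1 - x).
Proof. by rewrite /W !hornerE; ring. Qed.

(** The functions P(x) w^-k exp(-1/w), w = x (1 - x), on ]0, 1[: unlike the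
    single bump exp(-1/w), this family is stable under differentiation, so one
    computation of a derivative gives smoothness of all orders. *)
Definition bump P k x : R :=
  if 0 < x < 1 then P.[x] * ((x * (1 - x))^-1 ^+ k) * expR (- (x * (1 - x))^-1)
  else 0.

Definition dbump P k : {poly R} :=
  P^`() * W ^+ 2 - k%:R *: (P * W^`() * W) + P * W^`().

Lemma bump_support P k x : ~~ (0 < x < 1) -> bump P k x = 0.
Proof. by rewrite /bump => /negbTE ->. Qed.

Let bump_in P k x : 0 < x < 1 -> is_derive x 1 (bump P k) (bump (dbump P k) k.+2 x).
Proof.
move=> /[dup] x01 /andP[x0 x1].
have w0 : W.[x] != 0 by rewrite WE mulf_neq0 ?gt_eqF// subr_gt0.
have d1 := is_derive_poly P x.
have du := is_deriveV w0 (is_derive_poly W x).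
have dk := is_derive1_comp (is_derive_poly 'X^k _) du.
have de := is_derive1_comp (is_derive_expR _) (is_deriveN du).
have := is_deriveM (is_deriveM d1 dk) de.
set f := (X in is_derive _ _ X); set df := (X in is_derive _ _ _ X) => D.
have -> : bump (dbump P k) k.+2 x = df.
  rewrite /df /bump x01 /dbump /GRing.scale /= -!WE !fctE derivXn /=.
  move: w0; generalize W => V v0; rewrite !hornerE hornerMn ?hornerXn.
  set v := V.[x] in v0 *; set e := expR _; set p := P.[x]; set q := (P^`()).[x].
  set z := (V^`()).[x]; have vv : v ^- 2 = v^-1 * v^-1 by rewrite -invfM -expr2.
  have vK : v * v^-1 = 1 by rewrite divff.
  move: vK; rewrite vv; move: (v^-1) => u vK.
  have r : k%:R * u ^+ k = (u ^+ k.-1 *+ k) * u.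
    by case: (k) => [|n]; rewrite ?mul0r ?mulr0n ?mul0r// mulr_natl exprSr mulrnAl.
  set n2 := (X in _ * X * e = _).
  have -> : n2 = u * u ^+ k by rewrite -exprS.
  rewrite /=; move: (u ^+ k) (u ^+ k.-1 *+ k) r => t t1 r.
  transitivity (q * (v * u) * (v * u) * t * e - k%:R * t * (p * z * (v * u) * u * e)
    + p * z * u * u * t * e); first by ring.
  by rewrite vK r; ring.
apply: (near_eq_is_derive _ D).
have : \near x, x \in `]0, 1[ by apply: near_in_itvoo; rewrite in_itv.
apply: filterS => y; rewrite in_itv/= => y01.
by rewrite /f /bump y01 !fctE /= hornerXn -!WE.
Qed.

(** The exponential beats any power of 1/w: exp(1/w) >= (1/w)^(k+2) / (k+2)!.
    The surplus w^2 yields a vanishing derivative at 0 and 1. *)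
Let bump_bound P k : exists2 C, 0 <= C & forall y, 0 < y < 1 ->
  `|bump P k y| <= C * (y * (1 - y)) ^+ 2.
Proof.
exists ((\sum_(i < size P) `|P`_i|) * (k.+2)`!%:R).
  by rewrite mulr_ge0// sumr_ge0.
move=> y /[dup] y01 /andP[y0 y1].
have w0 : 0 < y * (1 - y) by rewrite mulr_gt0// subr_gt0.
rewrite /bump y01; set w := y * (1 - y) in w0 *.
have hP : `|P.[y]| <= \sum_(i < size P) `|P`_i|.
  rewrite horner_coef (le_trans (ler_norm_sum _ _ _))// ler_sum// => i _.
  rewrite normrM ler_piMr// normrX exprn_ile1//.
  by rewrite ger0_norm ltW.
rewrite !normrM -!mulrA; apply: ler_pM => //.
have := @expR_ge1Dxn R w^-1 k.+1; rewrite invr_ge0 (ltW w0) => /(_ isT) he.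
have f0 : 0 < (k.+2)`!%:R :> R by rewrite ltr0n fact_gt0.
have {}he : w^-1 ^+ k.+2 / (k.+2)`!%:R <= expR w^-1 by apply: le_trans he; rewrite lerDr.
rewrite (ger0_norm (expR_ge0 _)) expRN ger0_norm; last by rewrite exprn_ge0// invr_ge0 ltW.
rewrite ler_pdivrMr ?expR_gt0//.
apply: (@le_trans _ _ ((k.+2)`!%:R * w ^+ 2 * (w^-1 ^+ k.+2 / (k.+2)`!%:R))); last first.
  by rewrite ler_wpM2l// mulr_ge0 ?(ltW f0)// sqr_ge0.
rewrite le_eqVlt; apply/orP; left; apply/eqP.
by rewrite !exprVn !exprS; field; rewrite !gt_eqF ?exprn_gt0.
Qed.

Let bump_out P k x : ~~ (0 < x < 1) -> is_derive x 1 (bump P k) 0.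
Proof.
move=> nx; have [C C0 hC] := bump_bound P k.
have bnd y : `|bump P k y| <= C * (y - x) ^+ 2.
  have [y01|ny] := boolP (0 < y < 1); last first.
    by rewrite bump_support// normr0 mulr_ge0// sqr_ge0.
  apply: (le_trans (hC y y01)); rewrite ler_wpM2l//.
  have /andP[y0 y1] := y01.
  have hw : 0 <= y * (1 - y) by rewrite ltW// mulr_gt0// subr_gt0.
  move: nx; rewrite negb_and -!leNgt => /orP[x0|x1].
    rewrite ler_sqr ?nnegrE//; last by lra.
    apply: (@le_trans _ _ y); last by lra.
    by rewrite ler_piMr//; lra.
  rewrite -[X in _ <= X]sqrrN opprB ler_sqr ?nnegrE//; last by lra.
  apply: (@le_trans _ _ (1 - y)); last by lra.
  by rewrite ler_piMl//; lra.
suff cv : (fun h : R => h^-1 *: ((bump P k \o shift x) (h *: 1) - bump P k x))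
    @ (0 : R)^' --> (0 : R).
  by split; [apply/cvg_ex; exists 0|exact: cvg_lim cv].
apply/cvgrPdist_le => e e0.
have : \forall h \near (0 : R)^', `|h| <= e / (C + 1).
  by apply: dnbhs0_le; rewrite divr_gt0// ltr_wpDl.
apply: filterS2 (nbhs_dnbhs_neq (0 : R)).
move=> h h0 hh; rewrite sub0r normrN /= (bump_support _ _ nx) subr0 normrM normfV.
rewrite ler_pdivrMl ?normr_gt0//.
have := bnd (h *: 1 + x); rewrite addrK /GRing.scale /= mulr1 => hb.
apply: (le_trans hb); rewrite -(real_normK (num_real h)) expr2 mulrCA ler_wpM2l//.
move: hh; rewrite ler_pdivlMr ?ltr_wpDl// => hh.
by apply: le_trans hh; rewrite mulrC ler_wpM2l// lerDl.
Qed.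

Lemma is_derive_bump P k x : is_derive x 1 (bump P k) (bump (dbump P k) k.+2 x).
Proof.
have [x01|nx] := boolP (0 < x < 1); first exact: bump_in.
by rewrite bump_support//; exact: bump_out.
Qed.

Lemma bump_continuous P k : continuous (bump P k).
Proof.
move=> x; apply: differentiable_continuous; apply/derivable1_diffP.
by have [] := is_derive_bump P k x.
Qed.

End bump.

Section smooth_step.
Context {R : realType}.
Local Notation leb := (@lebesgue_measure R).

Let beta : R -> R := bump 1 0.

Lemma beta_ge0 x : 0 <= beta x.
Proof.
rewrite /beta /bump; case: ifP => // _.
by rewrite ?hornerE ?expr0 ?mul1r ?mulr1 expR_ge0.
Qed.

Lemma beta_gt0 x : 0 < x < 1 -> 0 < beta x.
Proof. by rewrite /beta /bump => ->; rewrite ?hornerE ?expr0 ?mul1r ?mulr1 expR_gt0. Qed.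

Lemma beta_antiderivative : exists g : R -> R, forall x : R, is_derive x 1 g (beta x).
Proof.
have cb : continuous beta by exact: bump_continuous.
have ib : leb.-integrable setT (EFin \o beta).
  have -> : EFin \o beta = (EFin \o beta) \_ `[0, 1]%classic.
    apply/funext => x; rewrite patchE; case: ifPn => // /negP h /=.
    rewrite /beta bump_support//; apply/negP => /andP[x0 x1]; apply: h.
    by rewrite inE/= in_itv/= !ltW.
  have i01 := @continuous_compact_integrable R beta `[0, 1]%classic
    (@segment_compact _ _ _) (continuous_subspaceT cb).
  by move/integrable_mkcond : i01; apply.
exists (fun x => \int[leb]_(t in [set` Interval -oo%O (BRight x)]) beta t)%R => x.
have x1 : x < x + 1 by rewrite ltrDl.
have ix : leb.-integrable [set` Interval -oo%O (BRight (x + 1))] (EFin \o beta).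
  by apply: integrableS ib.
have [] := continuous_FTC1 x1 ix _ (cb x); first exact: ltNyr.
move=> d e.
by apply: DeriveDef; [exact: d|rewrite -derive1E; exact: e].
Qed.

Lemma smooth_step : exists (theta : R -> R) (c : R), [/\ 0 < c,
  forall x : R, is_derive x 1 theta (beta x), forall x, x <= 0 -> theta x = 0,
  forall x, 1 <= x -> theta x = c & forall x, 0 <= theta x <= c].
Proof.
have [g dg] := beta_antiderivative.
have cg : continuous g.
  by move=> x; apply: differentiable_continuous; apply/derivable1_diffP; have [] := dg x.
have mvt x y : x <= y -> exists2 z, x <= z <= y & g y - g x = beta z * (y - x).
  move=> xy; have [z] := MVT_segment xy (fun z _ => dg z) (continuous_subspaceT cg).
  by rewrite in_itv/=; exists z.
have mono x y : x <= y -> g x <= g y.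
  move=> xy; have [z _ e] := mvt _ _ xy; rewrite -subr_ge0 e mulr_ge0 ?beta_ge0//.
  by rewrite subr_ge0.
have gl x : x <= 0 -> g x = g 0.
  move=> x0; have [z /andP[_ z0]] := mvt _ _ x0; rewrite /beta bump_support ?mul0r.
    by move/eqP; rewrite subr_eq0 => /eqP.
  by rewrite negb_and -leNgt z0.
have gr x : 1 <= x -> g x = g 1.
  move=> x1; have [z /andP[z1 _]] := mvt _ _ x1; rewrite /beta bump_support ?mul0r.
    by move/eqP; rewrite subr_eq0 => /eqP.
  by rewrite negb_and -!leNgt z1 orbT.
exists (fun x => g x - g 0), (g 1 - g 0); split.
- have h : 4^-1 <= 3 / 4 :> R by lra.
  have [z /andP[z1 z2] e] := mvt _ _ h.
  have b0 : 0 < beta z by apply: beta_gt0; apply/andP; split; lra.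
  have : 0 < g (3 / 4) - g 4^-1 by rewrite e mulr_gt0//; lra.
  have : g 0 <= g 4^-1 by apply: mono; lra.
  have : g (3 / 4) <= g 1 by apply: mono; lra.
  by move: (g _) (g _) (g _) (g _) => a b c d; lra.
- move=> x; have := is_deriveB (dg x) (is_derive_cst (g 0) x 1); rewrite subr0.
  by [].
- by move=> x /gl ->; rewrite subrr.
- by move=> x /gr ->.
- move=> x; rewrite subr_ge0 lerD2r; have [x0|x0] := leP x 0.
    by rewrite (gl _ x0) lexx mono.
  rewrite (mono _ _ (ltW x0))/=; have [x1|x1] := leP x 1; first exact: mono.
  by rewrite (gr _ (ltW x1)).
Qed.

Section test.
Variables (theta : R -> R) (c k s t : R).
Hypothesis dtheta : forall x : R, is_derive x 1 theta (beta x).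
Hypothesis theta0 : forall x, x <= 0 -> theta x = 0.
Hypothesis theta1 : forall x, 1 <= x -> theta x = c.

Let form a (P : {poly R}) j tau : R :=
  a * (bump P j (k * (tau - s)) - bump P j (k * (tau - t))).

Definition plateau tau : R := theta (k * (tau - s)) - theta (k * (tau - t)).

Let affine (r x : R) : is_derive x 1 (fun tau : R => k * (tau - r)) k.
Proof.
have := is_deriveZ k (is_deriveB (is_derive_id x (1 : R)) (is_derive_cst r x (1 : R))).
by rewrite subr0 /GRing.scale/= mulr1.
Qed.

Let form_derive a P j (x : R) : is_derive x 1 (form a P j) (form (a * k) (dbump P j) j.+2 x).
Proof.
have h r := is_derive1_comp (g := fun tau => k * (tau - r))
  (is_derive_bump P j (k * (x - r))) (affine r x).
have := is_deriveZ a (is_deriveB (h s) (h t)).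
rewrite /form (_ : a *: _ = a * k * (bump (dbump P j) j.+2 (k * (x - s)) -
   bump (dbump P j) j.+2 (k * (x - t))))//.
by rewrite /GRing.scale/=; ring.
Qed.

Lemma is_derive_step (r x : R) :
  is_derive x 1 (fun tau => theta (k * (tau - r))) (k * beta (k * (x - r))).
Proof.
rewrite mulrC; exact: (is_derive1_comp (g := fun tau => k * (tau - r))
  (dtheta (k * (x - r))) (affine r x)).
Qed.

Lemma is_derive_plateau (x : R) :
  is_derive x 1 plateau (k * beta (k * (x - s)) - k * beta (k * (x - t))).
Proof. exact: (is_deriveB (is_derive_step s x) (is_derive_step t x)). Qed.

Let form_derive1n n a P j : exists a' P' j', derive1n n (form a P j) = form a' P' j'.
Proof.
elim: n => [|n [a' [P' [j' e]]]]; first by exists a, P, j.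
exists (a' * k), (dbump P' j'), j'.+2; rewrite derive1nS e; apply/funext => x.
by rewrite derive1E; have [_ ->] := form_derive a' P' j' x.
Qed.

(** All derivatives of positive order of a plateau have the same shape [form]:
    two copies of one function of the bump family. *)
Lemma plateau_test T : 0 < k -> 0 < s -> s <= t -> t + k^-1 < T ->
  test_function T plateau.
Proof.
move=> k0 s0 st tT; split.
  case=> [|n] x; first by have [] := is_derive_plateau x.
  rewrite derive1Sn (_ : plateau^`()%classic = form k 1 0); last first.
    by apply/funext => y; rewrite derive1E; have [_ ->] := is_derive_plateau y; rewrite -mulrBr.
  have [a [P [j ->]]] := form_derive1n n k 1 0.
  by have [] := form_derive a P j x.
exists s, (t + k^-1); split => // tau; rewrite negb_and -!ltNge => /orP[h|h].
  by rewrite /plateau !theta0 ?subrr// pmulr_rle0// subr_le0 ltW// (lt_le_trans h).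
have ht : 1 <= k * (tau - t) by rewrite -ler_pdivrMl// mulr1 lerBrDl ltW.
rewrite /plateau !theta1 ?subrr//; apply: le_trans ht _.
by rewrite ler_wpM2l ?(ltW k0)// lerB.
Qed.

End test.
End smooth_step.

(** * Distributional derivatives in time *)

Section weak_FTC.
Context {R : realType}.
Local Notation leb := (@lebesgue_measure R).
Variables (T : R) (F G : R -> R).
Hypothesis cF : {within `[0, T], continuous F}.
Hypothesis iG : leb.-integrable `]0, T[%classic (EFin \o G).

Let D : set R := `]0, T[%classic.
Let mD : measurable D. Proof. exact: measurable_itv. Qed.

Let continuous_integrable (f : R -> R) : {within `[0, T], continuous f} ->
  leb.-integrable D (EFin \o f).
Proof.
move=> cf.
have i := @continuous_compact_integrable R f `[0, T]%classic (@segment_compact _ _ _) cf.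
by apply: (integrableS _ _ _ i) => //; exact: subset_itv_oo_cc.
Qed.

Section kernel.
Variables (theta : R -> R) (c : R).
Hypothesis dtheta : forall x : R, is_derive x 1 theta (bump 1 0 x).
Hypothesis theta0 : forall x : R, x <= 0 -> theta x = 0.
Hypothesis theta1 : forall x, 1 <= x -> theta x = c.

Let K (k s tau : R) : R := k * bump 1 0 (k * (tau - s)).

Let cK k s : continuous (K k s).
Proof.
move=> x; apply: cvgM; first exact: cvg_cst.
apply: (continuous_comp (f := fun tau : R => k * (tau - s))).
  by apply: cvgM; [exact: cvg_cst|apply: cvgB; [exact: cvg_id|exact: cvg_cst]].
exact: bump_continuous.
Qed.

Let K_mass k s : 0 < k -> 0 < s -> s + k^-1 <= T -> \int[leb]_(x in D) K k s x = c.
Proof.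
move=> k0 s0 sT; have T0 : 0 < T by apply: lt_le_trans sT; rewrite addr_gt0 ?invr_gt0.
have mK (A : set R) : measurable_fun A (EFin \o K k s).
  by apply/measurable_EFinP; apply: measurable_funTS; apply: continuous_measurable_fun.
rewrite /Rintegral -(integral_itv_bndoo true false (mK _)).
have d x := is_derive_step k dtheta s x.
rewrite (FTC_line (g := fun tau => theta (k * (tau - s))) T0)//.
- rewrite /= theta1 ?theta0 ?subr0//.
    by rewrite pmulr_rle0// subr_le0 ltW.
  by rewrite -ler_pdivrMl// mulr1 lerBrDl.
- by move=> t; have [] := d t.
Qed.

Let within_kernel k s (f : R -> R) : {within `[0, T], continuous f} ->
  {within `[0, T], continuous (fun x => K k s x * f x)}.
Proof.
move=> cf x; have cKs : {within `[0, T], continuous (K k s)}.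
  by apply: continuous_subspaceT; exact: cK.
exact: (cvgM (cKs x) (cf x)).
Qed.

(** K k s is a probability density up to the factor c, carried by
    [s, s + 1/k]. *)
Lemma mollify k s eta : 0 < k -> 0 < s -> s + k^-1 <= T ->
  (forall x, s <= x <= s + k^-1 -> `|F x - F s| <= eta) ->
  `|\int[leb]_(x in D) (K k s x * F x) - c * F s| <= eta * c.
Proof.
move=> k0 s0 sT hF.
have iK : leb.-integrable D (EFin \o K k s).
  by apply: (@continuous_integrable (K k s)); apply: continuous_subspaceT; exact: cK.
have cKF := @within_kernel k s.
have iKF := continuous_integrable (cKF _ cF).
have cB : {within `[0, T], continuous (fun x => F x - F s)}.
  by move=> x; apply: cvgB; [exact: cF|exact: cvg_cst].
have iB := continuous_integrable (cKF _ cB).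
rewrite -(K_mass k0 s0 sT) -RintegralZr// -RintegralZl// -RintegralB//.
  under eq_Rintegral do rewrite -mulrBr.
  apply: (le_trans (le_normr_Rintegral _ iB)) => //.
  apply: le_Rintegral => //.
  - exact: integrable_norm.
  - by under [X in _.-integrable _ X]eq_fun do rewrite EFinM; exact: integrableZl.
  move=> x _; have [/andP[x0 x1]|nx] := boolP (0 < k * (x - s) < 1); last first.
    by rewrite /K bump_support// !mulr0 mul0r normr0.
  rewrite normrM ger0_norm; last by rewrite mulr_ge0 ?(ltW k0)// beta_ge0.
  rewrite mulrC ler_wpM2r//; first by rewrite mulr_ge0 ?(ltW k0)// beta_ge0.
  apply: hF; move: x0 x1; rewrite pmulr_rgt0// subr_gt0 -ltr_pdivlMl// mulr1.
  by rewrite ltrBlDl => /ltW-> /ltW.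
under [X in _.-integrable _ X]eq_fun do rewrite EFinM.
exact: integrableZr.
Qed.

(** With this factor the steps of the plateaus at t are at most half as wide as
    the room left before T. *)
Let k0 t : R := 2 / (T - t).
Let kn t n : R := k0 t * n.+1%:R.

Let kn_gt0 t n : t < T -> 0 < kn t n.
Proof. by move=> tT; rewrite /kn /k0 mulr_gt0// divr_gt0// subr_gt0. Qed.

Let kn_small t n : t < T -> t + (kn t n)^-1 < T.
Proof.
move=> tT; have d : 0 < T - t by rewrite subr_gt0.
rewrite -ltrBrDl invfM /k0 invf_div; apply: (@le_lt_trans _ _ ((T - t) / 2)).
  by rewrite ler_piMr ?divr_ge0 ?(ltW d)// invf_le1 ?ltr0n// ler1n.
by lra.
Qed.

Let kn_cvg t e : t < T -> 0 < e -> \forall n \near \oo, (kn t n)^-1 <= e.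
Proof.
move=> tT e0; have k00 : 0 < k0 t by rewrite /k0 divr_gt0// subr_gt0.
have e' : 0 < e * k0 t by rewrite mulr_gt0.
near=> n; rewrite /kn invfM -ler_pdivlMl ?invr_gt0// invrK mulrC.
by apply/ltW; near: n; exact: near_infty_natSinv_lt (PosNum e').
Unshelve. all: by end_near.
Qed.

(** Only the right neighbourhood matters, since the kernels sit to the right of
    s; halving d turns the open ball into a closed interval. *)
Let near_F s e : 0 < s -> s < T -> 0 < e -> exists2 d, 0 < d &
  forall x, s <= x <= s + d -> x <= T -> `|F x - F s| <= e.
Proof.
move=> s0 sT e0.
have hF : F x @[x --> s] --> F s.
  have [ci _ _] := (continuous_within_itvP F (lt_trans s0 sT)).1 cF.
  by apply: ci; rewrite in_itv/= s0.
have /cvgrPdist_le/(_ e e0)/nbhs_ballP[d /= d0 hd] := hF.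
exists (d / 2); first by rewrite divr_gt0.
move=> x /andP[x1 x2] _; rewrite distrC; apply: hd; rewrite /ball/=.
by rewrite ltr_norml; apply/andP; split; lra.
Qed.

Let mollify_cvg s t : 0 < s -> s <= t -> t < T -> 0 < c ->
  \int[leb]_(x in D) (K (kn t n) s x * F x) @[n --> \oo] --> c * F s.
Proof.
move=> s0 st tT c0; apply/cvgrPdist_le => e e0.
have sT := le_lt_trans st tT.
have [d d0 hd] := near_F s0 sT (divr_gt0 e0 c0).
near=> n; have kd : (kn t n)^-1 <= d by near: n; exact: kn_cvg.
have ks : s + (kn t n)^-1 <= T.
  by apply: le_trans (ltW (kn_small n tT)); rewrite lerD2r.
rewrite distrC -[e](divfK (lt0r_neq0 c0)); apply: mollify => //; first exact: kn_gt0.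
move=> x /andP[x1 x2]; apply: hd; last exact: le_trans x2 ks.
by rewrite x1 (le_trans x2)// lerD2l.
Unshelve. all: by end_near.
Qed.

Hypothesis c_gt0 : 0 < c.
Hypothesis theta_range : forall x, 0 <= theta x <= c.
Hypothesis weak : forall psi, test_function T psi ->
  \int[leb]_(x in D) (derive1 psi x * F x) = - \int[leb]_(x in D) (psi x * G x).

Let psi s t n := plateau theta (kn t n) s t.

Let psi_bound s t n x : `|psi s t n x| <= c.
Proof.
rewrite /psi /plateau; move: (theta_range (kn t n * (x - s))) (theta_range (kn t n * (x - t))).
by move: (theta _) (theta _) => a b h1 h2; rewrite ler_norml; apply/andP; split; lra.
Qed.

Let step_cvg t r x : t < T ->
  theta (kn t n * (x - r)) @[n --> \oo] --> (if r < x then c else 0).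
Proof.
move=> tT; case: ifPn => [rx|]; last first.
  rewrite -leNgt => xr; apply: cvg_near_cst; apply: nearW => n; apply: theta0.
  by rewrite pmulr_rle0 ?kn_gt0// subr_le0.
apply: cvg_near_cst; have xr : 0 < x - r by rewrite subr_gt0.
apply: filterS (kn_cvg tT xr) => n h; apply: theta1.
by rewrite -ler_pdivrMl ?kn_gt0// mulr1.
Qed.

Let psi_G s t : 0 < s -> s <= t -> t < T ->
  \int[leb]_(x in D) (psi s t n x * G x) @[n --> \oo] -->
  c * \int[leb]_(x in `]s, t]) G x.
Proof.
move=> s0 st tT.
have sub : `]s, t]%classic `<=` D.
  by move=> x; rewrite /D /= !in_itv/= => /andP[a b]; rewrite (lt_trans s0 a) (le_lt_trans b tT).
have iGs : leb.-integrable `]s, t]%classic (EFin \o G) by apply: integrableS iG.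
have iGD : leb.-integrable setT (EFin \o (G \_ D)).
  by rewrite -restrict_EFin; move/integrable_mkcond : iG; apply.
have mG : measurable_fun setT (G \_ D) by apply/measurable_EFinP; exact: measurable_int iGD.
have E n : \int[leb]_(x in D) (psi s t n x * G x) =
    \int[leb]_x (psi s t n x * (G \_ D) x).
  rewrite Rintegral_mkcond; apply: eq_Rintegral => x _.
  by rewrite !patchE; case: ifP => _ //; rewrite mulr0.
have -> : c * \int[leb]_(x in `]s, t]) G x =
    \int[leb]_x (((if s < x then c else 0) - (if t < x then c else 0)) * (G \_ D) x).
  rewrite -RintegralZl// Rintegral_mkcond; apply: eq_Rintegral => x _.
  rewrite !patchE; case: ifPn => [/set_mem xst|nx].
    rewrite mem_set; last exact: sub.
    by move: xst; rewrite /= in_itv/= => /andP[-> h]; rewrite ltNge h subr0.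
  case: (x \in D); last by rewrite mulr0.
  have : ~~ (s < x <= t).
    by apply: contra nx => h; rewrite inE/= in_itv.
  case: ltP => sx; case: ltP => tx //=; rewrite ?subrr ?subr0 ?mul0r// => _.
  by move: tx; rewrite ltNge (le_trans sx st).
under eq_fun do rewrite E.
apply: (@Rintegral_dominated _ _ _ leb _ _ (fun x => c * `|(G \_ D) x|)).
- move=> n; apply: measurable_funM => //; apply: continuous_measurable_fun.
  by move=> x; apply: differentiable_continuous; apply/derivable1_diffP;
    have [] := is_derive_plateau (kn t n) s t dtheta x.
- apply: measurable_funM => //; apply: measurable_funB; apply: measurable_fun_ifT => //;
  exact: measurable_fun_ltr.
- under [X in _.-integrable _ X]eq_fun do rewrite EFinM.
  apply: integrableZl => //; apply: integrable_norm.
  exact: iGD.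
- by apply: aeW => x n; rewrite normrM ler_wpM2r ?psi_bound.
- apply: aeW => x; apply: cvgM; last exact: cvg_cst.
  by apply: cvgB; exact: step_cvg.
Qed.

(** The derivatives of the plateaus are approximate identities at s and t, and
    the plateaus tend to c times the indicator of ]s, t]. *)
Lemma weak_FTC_step s t : 0 < s -> s <= t -> t < T ->
  F t - F s = \int[leb]_(x in `]s, t]) G x.
Proof.
move=> s0 st tT; apply: (mulfI (lt0r_neq0 c_gt0)).
have t0 := lt_le_trans s0 st.
have c1 := cvgB (mollify_cvg s0 st tT c_gt0) (mollify_cvg t0 (lexx t) tT c_gt0).
have c2 : (- \int[leb]_(x in D) (psi s t n x * G x))%R @[n --> \oo] -->
    - (c * \int[leb]_(x in `]s, t]) G x).
  by apply: cvgN; exact: psi_G.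
have iKF n r : leb.-integrable D (EFin \o (fun x => K (kn t n) r x * F x)).
  by apply: continuous_integrable; exact: within_kernel.
have E n : \int[leb]_(x in D) (K (kn t n) s x * F x) - \int[leb]_(x in D) (K (kn t n) t x * F x)
    = - \int[leb]_(x in D) (psi s t n x * G x).
  rewrite -RintegralB// -weak; last first.
    exact: (plateau_test dtheta theta0 theta1 (kn_gt0 n tT) s0 st (kn_small n tT)).
  apply: eq_Rintegral => x _; rewrite derive1E.
  by have [_ ->] := is_derive_plateau (kn t n) s t dtheta x; rewrite -mulrBl.
have c3 : (- \int[leb]_(x in D) (psi s t n x * G x))%R @[n --> \oo] --> c * F s - c * F t.
  by under eq_fun do rewrite -E; exact: c1.
have e : c * F s - c * F t = - (c * \int[leb]_(x in `]s, t]) G x).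
  exact: (cvg_unique _ c3 c2).
by rewrite mulrBr -[RHS]opprK -e opprB.
Qed.

End kernel.

(** The du Bois-Reymond lemma, tested with smoothed indicators of ]s, t]. *)
Lemma weak_FTC : (forall psi, test_function T psi ->
    \int[leb]_(x in D) (derive1 psi x * F x) = - \int[leb]_(x in D) (psi x * G x)) ->
  forall s t, 0 < s -> s <= t -> t < T -> F t - F s = \int[leb]_(x in `]s, t]) G x.
Proof.
move=> weak s t s0 st tT.
have [theta [c [c0 dth th0 th1 thr]]] := @smooth_step R.
exact: (weak_FTC_step dth th0 th1 c0 thr weak s0 st tT).
Qed.

End weak_FTC.

(** * Borel versions of vector valued functions *)

Section almost_everywhere_measurable.
Context d (X : measurableType d) (R : realType).
Variable mu : {measure set X -> \bar R}.

(** The integral of a nonmeasurable nonnegative function is still a lower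
    integral, squeezed between two measurable modifications of g on a null set. *)
Lemma ge0_ae_eq_integralW (D : set X) (f g : X -> \bar R) : measurable D ->
  (forall x, D x -> 0 <= f x)%E -> (forall x, 0 <= g x)%E -> measurable_fun setT g ->
  {ae mu, forall x, D x -> f x = g x} ->
  (\int[mu]_(x in D) f x = \int[mu]_(x in D) g x)%E.
Proof.
move=> mD f0 g0 mg [N [mN N0 sN]].
have out x : D x -> ~ N x -> f x = g x.
  by move=> Dx nN; apply: contrapT => h; apply: nN; apply: sN => /(_ Dx).
pose lo x := if x \in N then 0%E else g x.
pose hi x := if x \in N then +oo%E else g x.
have mN' : measurable_fun setT (fun x => x \in N) 
  by apply: (measurable_fun_bool true); rewrite setTI preimage_mem_true.
have mlo : measurable_fun D lo.
  by apply: measurable_funTS; apply: measurable_fun_ifT.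
have mhi : measurable_fun D hi.
  by apply: measurable_funTS; apply: measurable_fun_ifT.
have eqN (h : X -> \bar R) : (forall x, ~ N x -> h x = g x) ->
    {ae mu, forall x, D x -> h x = g x}.
  move=> hg; exists N; split => // x /=; apply: contra_notP => nN _.
  exact: hg.
have lo0 x : (0 <= lo x)%E by rewrite /lo; case: ifP.
have hi0 x : (0 <= hi x)%E by rewrite /hi; case: ifP.
have -> : (\int[mu]_(x in D) g x = \int[mu]_(x in D) lo x)%E.
  apply: ge0_ae_eq_integral => //; first exact: measurable_funTS.
  apply: ae_mono (eqN lo _) _ => [x nN|x h Dx]; last by rewrite h.
  by rewrite /lo memNset.
apply/eqP; rewrite eq_le; apply/andP; split.
  have -> : (\int[mu]_(x in D) lo x = \int[mu]_(x in D) hi x)%E.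
    apply: ge0_ae_eq_integral => //.
    exists N; split => // x /=; apply: contra_notP => nN _.
    by rewrite /lo /hi !memNset.
  apply: ge0_mono_integral => // x Dx; rewrite /hi; case: ifPn => [_|]; first exact: leey.
  by move=> /negP h; rewrite out// => /mem_set.
apply: ge0_mono_integral => // x Dx; rewrite /lo; case: ifPn => [_|]; first exact: f0.
by move=> /negP h; rewrite out// => /mem_set.
Qed.

Lemma ae_eq_RintegralW (D : set X) (f g : X -> R) : measurable D ->
  measurable_fun setT g -> {ae mu, forall x, D x -> f x = g x} ->
  Rintegral mu D f = Rintegral mu D g.
Proof.
move=> mD mg fg; rewrite /Rintegral [in LHS]integralE [in RHS]integralE.
have mE : measurable_fun setT (EFin \o g) by exact/measurable_EFinP.
congr (fine (_ - _)%E); apply: ge0_ae_eq_integralW => //.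
- exact: measurable_funepos.
- by apply: (ae_mono fg) => x h Dx; rewrite !funeposE /= h.
- exact: measurable_funeneg.
- by apply: (ae_mono fg) => x h Dx; rewrite !funenegE /= h.
Qed.

(** The limit exists only almost everywhere and Borel sets are not complete, so
    f is put to zero on a measurable null set; the last clause lets bounds that
    hold everywhere for f pass to g. *)
Lemma ae_limit_measurable (D : set X) (s : nat -> X -> R) (f : X -> R) :
  measurable D -> (forall k, measurable_fun setT (s k)) ->
  {ae mu, forall x, D x -> s k x @[k --> \oo] --> f x} ->
  exists g, [/\ measurable_fun setT g, {ae mu, forall x, D x -> g x = f x} &
    forall x, g x = f x \/ g x = 0].
Proof.
move=> mD ms [N [mN N0 sN]]; pose E := D `\` N.
have mE : measurable E by exact: measurableD.
exists (f \_ E); split.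
- apply: (measurable_fun_cvg (h := fun k => s k \_ E)) => [k|x _].
    by apply: (measurable_restrictT _ mE).1; exact: measurable_funTS.
  rewrite patchE; case: ifPn => [/set_mem[Dx nN]|nE].
    rewrite (_ : (fun k => _) = fun k => s k x); last first.
      by apply/funext => k; rewrite patchE mem_set.
    by apply: contrapT => h; apply: nN; apply: sN => /(_ Dx).
  rewrite (_ : (fun k => _) = fun=> 0); first exact: cvg_cst.
  by apply/funext => k; rewrite patchE (negbTE nE).
- exists N; split => // x /=; apply: contra_notP => nN Dx.
  by rewrite patchE mem_set.
- by move=> x; rewrite patchE; case: ifP => _; [left|right].
Qed.

Lemma integrable_of_square (D : set X) (f : X -> R) : measurable D ->
  (mu D < +oo)%E -> measurable_fun setT f ->
  mu.-integrable D (EFin \o (fun x => f x ^+ 2)) -> mu.-integrable D (EFin \o f).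
Proof.
move=> mD fin mf if2; have mE : measurable_fun D (EFin \o f).
  by apply/measurable_EFinP; exact: measurable_funTS.
have iC : mu.-integrable D (EFin \o (fun=> 1 : R)).
  apply: measurable_bounded_integrable => //.
  by exists 1; split => // M M1 x _ /=; rewrite normr1 ltW.
apply: (le_integrable mD mE _ (integrableD mD iC if2)) => t _ /=.
rewrite lee_fin [X in _ <= X]ger0_norm ?addr_ge0 ?sqr_ge0//.
have := sqr_ge0 (`|f t| - 1); rewrite sqrrB1 real_normK ?num_real//.
have := normr_ge0 (f t); lra.
Qed.

End almost_everywhere_measurable.

Lemma cvg_dist_le (R : realType) (s r : nat -> R) l C :
  (forall n, `|s n - l| <= C * r n) -> r n @[n --> \oo] --> (0 : R) ->
  s n @[n --> \oo] --> l.
Proof.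
move=> h cr; have c0 : C * r n @[n --> \oo] --> (0 : R).
  by rewrite -[0](mulr0 C); apply: cvgM => //; exact: cvg_cst.
apply/cvgrPdist_le => e e0; move/cvgrPdist_le : c0 => /(_ e e0).
apply: filterS => n; rewrite sub0r normrN => /(le_trans (ler_norm _)).
by rewrite distrC; exact: le_trans.
Qed.

Section bochner.
Context {R : realType}.
Local Notation leb := (@lebesgue_measure R).
Let HV := @semi_inner_vec R.

Let simple_sum n (E : 'I_n -> set R) (z : 'I_n -> vfield R) (s : R -> vfield R) :
  (forall t i x, s t i x = \sum_(j < n) \1_(E j) t * z j i x) ->
  forall t, s t = \sum_(j < n) \1_(E j) t *: z j.
Proof.
move=> sE t; apply/funext => i; apply/funext => x; rewrite sE.
by elim/big_ind2 : _ => // a1 b1 a2 b2 -> ->.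
Qed.

Lemma simple_inner_measurable (s : R -> vfield R) w :
  simple_in (@Hspace R) s -> Hspace w -> measurable_fun setT (fun t => innerv (s t) w).
Proof.
move=> [n [E [z [mEz sE]]]] hw.
rewrite (_ : (fun t => _) = fun t => \sum_(j < n) \1_(E j) t * innerv (z j) w).
  by apply: measurable_sum => j; apply: measurable_funM => //;
    apply: measurable_indic; have [] := mEz j.
apply/funext => t; rewrite (simple_sum sE) (si_sum_l HV)//; last exact: Hspace_L2.
by move=> j; apply: Hspace_L2; have [] := mEz j.
Qed.

Lemma simple_normL2_measurable (s : R -> vfield R) :
  simple_in (@Hspace R) s -> measurable_fun setT (fun t => normL2 (s t)).
Proof.
move=> [n [E [z [mEz sE]]]].
have z2 j : L2vec (z j) by apply: Hspace_L2; have [] := mEz j.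
have ms : measurable_fun (setT : set R) (Num.sqrt : R -> R).
  by apply: continuous_measurable_fun; exact: sqrt_continuous.
apply: (measurableT_comp ms).
rewrite (_ : (fun t => _) = fun t =>
    \sum_(j < n) \1_(E j) t * innerv (s t) (z j)).
  apply: measurable_sum => j; apply: measurable_funM.
    by apply: measurable_indic; have [] := mEz j.
  by apply: simple_inner_measurable; [exists n, E, z|have [] := mEz j].
apply/funext => t; rewrite [X in innerv X _](simple_sum sE).
rewrite (si_sum_l HV)//; last by rewrite (simple_sum sE); exact: (si_sum HV).
apply: eq_bigr => j _; congr (_ * _); apply: (si_sym HV) => //.
by rewrite (simple_sum sE); exact: (si_sum HV).
Qed.

Lemma simple_L2vec (s : R -> vfield R) t : simple_in (@Hspace R) s -> L2vec (s t).
Proof.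
move=> [n [E [z [mEz sE]]]]; rewrite (simple_sum sE); apply: (si_sum HV) => j.
by apply: Hspace_L2; have [] := mEz j.
Qed.

Variables (T : R) (g : R -> vfield R).
Hypothesis bg : bochner_L2 T (@Hspace R) normL2 g.
Let D : set R := `]0, T[%classic.
Let mD : measurable D. Proof. exact: measurable_itv. Qed.
Let inD t : D t <-> 0 < t < T. Proof. by rewrite /D /= in_itv. Qed.

Lemma bochner_mem : {ae leb, forall t, D t -> Hspace (g t)}.
Proof.
have [[s [ss cs]] _] := bg.
by apply: (ae_mono cs) => t h /inD/h[].
Qed.

(** t |-> innerv (g t) w need not be Borel measurable itself; as an almost
    everywhere limit of simple functions it has a Borel version. *)
Lemma bochner_inner w : Hspace w -> exists G : R -> R,
  measurable_fun setT G /\ {ae leb, forall t, D t -> G t = innerv (g t) w}.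
Proof.
move=> hw; have [[s [ss cs]] _] := bg.
have [|G [mG GE _]] := @ae_limit_measurable _ _ _ leb D
    (fun k t => innerv (s k t) w) (fun t => innerv (g t) w) mD
    (fun k => simple_inner_measurable (ss k) hw); last by exists G.
apply: (ae_mono cs) => t h /inD/h[gt c].
apply: (cvg_dist_le (C := normL2 w) _ c) => k.
have s2 := simple_L2vec t (ss k); have g2 := Hspace_L2 gt; have w2 := Hspace_L2 hw.
rewrite -(si_Bl HV s2 g2 w2) mulrC; exact: (si_CS HV (siB HV s2 g2) w2).
Qed.

(** The norm of g is bounded by 1 + its square, hence integrable in time. *)
Lemma bochner_norm : exists gam : R -> R, [/\ measurable_fun setT gam,
  leb.-integrable D (EFin \o gam) & {ae leb, forall t, D t -> gam t = normL2 (g t)}].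
Proof.
have [[s [ss cs]] fin] := bg.
have [|G [mG GE Gor]] := @ae_limit_measurable _ _ _ leb D
    (fun k t => normL2 (s k t)) (fun t => normL2 (g t)) mD
    (fun k => simple_normL2_measurable (ss k)).
  apply: (ae_mono cs) => t h /inD/h[gt c].
  apply: (cvg_dist_le (C := 1) _ c) => k; rewrite mul1r.
  exact: (si_dist HV (simple_L2vec t (ss k)) (Hspace_L2 gt)).
exists G; split => //.
have mS : measurable_fun D (EFin \o (fun t => G t ^+ 2)).
  by apply/measurable_EFinP; apply: measurable_funX; exact: measurable_funTS.
have iS : leb.-integrable D (EFin \o (fun t => G t ^+ 2)).
  apply/integrableP; split => //; apply: le_lt_trans fin.
  apply: ge0_mono_integral => t _; first exact: abse_ge0.
  rewrite /= lee_fin ger0_norm ?sqr_ge0//.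
  by case: (Gor t) => ->//; rewrite expr0n sqr_ge0.
apply: integrable_of_square => //.
rewrite /= /D lebesgue_measure_itv/=; case: ifP => _; exact: ltry.
Qed.

End bochner.

(** * Decay from an integrated differential inequality *)

Section interval_chain.
Context {R : realType}.

(** Let p be the supremum of the points related to a.  The local hypothesis at p
    joins such a point just before p to points beyond p, unless p = b. *)
Lemma interval_chain (Q : R -> R -> Prop) (a b : R) : a <= b -> Q a a ->
  (forall s r t, a <= s -> s <= r -> r <= t -> t <= b -> Q s r -> Q r t -> Q s t) ->
  (forall p, a <= p <= b -> exists2 d, 0 < d & forall s t, a <= s -> s <= t -> t <= b ->
     p - d < s -> t < p + d -> Q s t) ->
  Q a b.
Proof.
move=> ab Qa tr loc; pose S := [set x | a <= x <= b /\ Q a x].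
have Sa : S a by split => //; rewrite lexx.
have hS : has_sup S by split; [exists a|exists b => x [/andP[]]].
have ap : a <= sup S by apply: ub_le_sup => //; case: hS.
have pb : sup S <= b by apply: ge_sup; [exists a|move=> x [/andP[]]].
have [d d0 hd] := loc _ (introT andP (conj ap pb)).
have [x [/andP[ax xb] Qx] dx] := sup_adherent d0 hS.
have xp : x <= sup S by apply: ub_le_sup; [case: hS|split => //; rewrite ax].
pose y := Num.min b (sup S + d / 2).
have xy : x <= y by rewrite /y le_min xb (le_trans xp)// lerDl divr_ge0// ltW.
have yb : y <= b by rewrite /y ge_min lexx.
have Qy : Q a y.
  apply: (tr _ x) => //; apply: hd => //.
  by rewrite /y gt_min; apply/orP; right; rewrite ltrD2l ltr_pdivrMr// ltr_pMr// ltr1n.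
have yp : y <= sup S.
  by apply: ub_le_sup; [case: hS|split => //; rewrite yb (le_trans ax)].
have [yE|yE] : y = b \/ y = sup S + d / 2.
- by rewrite /y; case: leP => _; [left|right].
- by rewrite -yE.
- by move: yp; rewrite yE gerDl leNgt divr_gt0.
Qed.

Lemma within_modulus (d : R -> R) (A : set R) (t w : R) :
  d @ within A (nbhs t) --> (0 : R) -> 0 < w ->
  exists2 e, 0 < e & forall s, A s -> `|s - t| < e -> d s <= w.
Proof.
move=> /cvgrPdist_le/[apply]; rewrite near_withinE => /nbhs_ballP[e /= e0 he].
exists e => // s As st; have := he s; rewrite /ball/= distrC => /(_ st As).
by rewrite sub0r normrN; apply: le_trans; exact: ler_norm.
Qed.

End interval_chain.

Lemma ae_le_Rintegral d (X : measurableType d) (R : realType)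
  (mu : {measure set X -> \bar R}) (D : set X) (f g : X -> R) : measurable D ->
  mu.-integrable D (EFin \o f) -> mu.-integrable D (EFin \o g) ->
  {ae mu, forall x, D x -> f x <= g x} -> Rintegral mu D f <= Rintegral mu D g.
Proof.
move=> mD fi gi fg; rewrite -subr_ge0 -RintegralB// Rintegral_mkcond.
have mh : measurable_fun setT ((fun x => g x - f x) \_ D).
  apply: (measurable_restrictT _ mD).1; apply: measurable_funB;
    apply/measurable_EFinP; [exact: measurable_int gi|exact: measurable_int fi].
rewrite (@ae_eq_RintegralW _ _ _ mu setT _ (fun x => `|((fun x => g x - f x) \_ D) x|))//.
- by apply: Rintegral_ge0 => x _.
- exact: measurableT_comp.
- apply: (ae_mono fg) => x h _; rewrite patchE; case: ifPn => [/set_mem Dx|_].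
    by rewrite ger0_norm// subr_ge0 h.
  by rewrite normr0.
Qed.

Section semi_inner_step.
Context {R : realType} {V : lmodType R} (S : set V) (B : V -> V -> R).
Hypothesis HB : semi_inner S B.

(** x + y = 2 z + (x - z) + (y - z): the dissipation at an intermediate state z
    controls the pairing with the sum of the states at both ends. *)
Lemma si_shift_bound (c w : R) g x y z : S g -> S x -> S y -> S z ->
  Num.sqrt (B (x - z) (x - z)) <= w -> Num.sqrt (B (y - z) (y - z)) <= w ->
  2 * B g z <= - c * B z z ->
  B g (x + y) <= - c * B z z + 2 * w * Num.sqrt (B g g).
Proof.
move=> Sg Sx Sy Sz hx hy hz.
have Sxz := siB HB Sx Sz; have Syz := siB HB Sy Sz.
have b a : S a -> Num.sqrt (B a a) <= w -> B g a <= w * Num.sqrt (B g g).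
  move=> Sa ha; apply: (le_trans (ler_norm _)); apply: (le_trans (si_CS HB Sg Sa)).
  by rewrite mulrC ler_wpM2r// sqrtr_ge0.
have bx := b _ Sxz hx; have by_ := b _ Syz hy.
have e : B g (x + y) = 2 * B g z + B g (x - z) + B g (y - z).
  by rewrite (si_Dr HB)// !(si_Br HB)//; ring.
rewrite e; move: bx by_ hz; move: (B g z) (B g (x - z)) (B g (y - z)) (B z z) (Num.sqrt _).
by move=> p q r k n; lra.
Qed.

End semi_inner_step.

Section decay.
Context {R : realType}.
Local Notation leb := (@lebesgue_measure R).
Variables (T : R).
Let D : set R := `]0, T[%classic.

(** From 1 - c (t - s) <= exp (- c (t - s)).  The error is w times an additive
    function of the interval, so errors add up along a subdivision. *)
Lemma decay_step (c w : R) (phi G gam : R -> R) (s t : R) : 0 <= c ->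
  0 < s -> s <= t -> t < T ->
  leb.-integrable D (EFin \o G) -> leb.-integrable D (EFin \o gam) -> 0 <= phi s ->
  phi t - phi s = \int[leb]_(x in `]s, t]) G x ->
  {ae leb, forall x, s < x <= t -> G x <= - c * (phi s - w) + 2 * w * gam x} ->
  phi t <= expR (- c * (t - s)) * phi s +
    w * (c * (t - s) + 2 * \int[leb]_(x in `]s, t]) gam x).
Proof.
move=> c0 s0 st tT iG igam phi0 E hG.
have sub : `]s, t]%classic `<=` D.
  by move=> x; rewrite /D /= !in_itv/= => /andP[a b]; rewrite (lt_trans s0 a) (le_lt_trans b tT).
have iG' : leb.-integrable `]s, t]%classic (EFin \o G).
  by apply: integrableS iG => //; exact: measurable_itv.
have ig' : leb.-integrable `]s, t]%classic (EFin \o gam).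
  by apply: integrableS igam => //; exact: measurable_itv.
have ig2 : leb.-integrable `]s, t]%classic (EFin \o (fun x => 2 * w * gam x)).
  under [X in _.-integrable _ X]eq_fun do rewrite EFinM.
  by apply: integrableZl.
have ic : leb.-integrable `]s, t]%classic (EFin \o (fun=> - c * (phi s - w))).
  apply: measurable_bounded_integrable => //.
    by rewrite /= lebesgue_measure_itv/=; case: ifP => _; exact: ltry.
  by exists `|- c * (phi s - w)|; split => // M hM x _ /=; exact: ltW.
have mono : \int[leb]_(x in `]s, t]) G x <=
    \int[leb]_(x in `]s, t]) (- c * (phi s - w) + 2 * w * gam x).
  apply: ae_le_Rintegral => //.
  pose f1 := EFin \o (fun _ : R => - c * (phi s - w)).
  pose f2 := EFin \o (fun x => 2 * w * gam x).
  have h := @integrableD _ _ R leb `]s, t]%classic (measurable_itv _) f1 f2 ic ig2.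
  exact: h.
rewrite RintegralD// RintegralZl// Rintegral_cst// in mono.
have len : fine (leb `]s, t]%classic) = t - s.
  rewrite lebesgue_measure_itv/= lte_fin; case: ltP => //= ts.
  by rewrite (le_anti (introT andP (conj st ts))) subrr.
rewrite len -E in mono.
have ex := ler_wpM2r phi0 (expR_ge1Dx (- c * (t - s))).
move: mono ex; set I := \int[leb]_(x in _) _; set ee := expR _.
move: I ee (t - s) => I ee l; set p := phi s; set q := phi t => h1 h2.
have -> : w * (c * l + 2 * I) = (- c * (p - w) * l + 2 * w * I) - (- c * l * p) by ring.
have h3 : (1 + - c * l) * p = p - c * l * p by ring.
by rewrite h3 in h2; lra.
Qed.

End decay.

Lemma perturbed_bound (R : realType) (eps pt ps p0 E F : R) : 0 < eps -> 0 <= p0 ->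
  0 <= F -> F <= 1 -> `|ps - p0| <= eps / 2 -> `|E - F| <= eps / 2 / (p0 + 1) ->
  pt <= F * ps -> pt <= E * p0 + eps.
Proof.
move=> e0 p00 F0 F1; have p1 : 0 < p0 + 1 by rewrite ltr_wpDl.
move=> hp; rewrite ler_pdivlMr// => h2 h3.
move: hp; rewrite ler_norml => /andP[_ h1].
have h4 : F * ps <= F * p0 + eps / 2.
  apply: (@le_trans _ _ (F * (p0 + eps / 2))); first by rewrite ler_wpM2l//; lra.
  by rewrite mulrDr lerD2l ler_piMl//; lra.
have h5 : F * p0 <= E * p0 + `|E - F| * (p0 + 1).
  rewrite -lerBlDl -mulrBl; apply: (@le_trans _ _ (`|E - F| * p0)).
    by rewrite ler_wpM2r// distrC ler_norm.
  by rewrite ler_wpM2l// lerDl.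
by lra.
Qed.

Lemma chained_bound (R : realType) (X Y pr ps w kt kr ks : R) :
  X * pr <= X * (Y * ps + w * (kr - ks)) -> X * (w * (kr - ks)) <= w * (kr - ks) ->
  X * pr + w * (kt - kr) <= X * Y * ps + w * (kt - ks).
Proof.
move=> h1 h2; have -> : X * Y * ps + w * (kt - ks) = X * (Y * ps + w * (kr - ks)) +
  w * (kt - kr) + (w * (kr - ks) - X * (w * (kr - ks))) by ring.
by lra.
Qed.

Section evolution_inequality.
Context {R : realType}.
Local Notation leb := (@lebesgue_measure R).
Let HV := @semi_inner_vec R.
Variables (T c t0 : R) (e g : R -> vfield R) (gam : R -> R).
Let D : set R := `]0, T[%classic.
Hypothesis c0 : 0 <= c.
Hypothesis t00 : 0 <= t0.
Hypothesis ce : continuous_in T (@Hspace R) normL2 e.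
Hypothesis gam0 : forall t, 0 <= gam t.
Hypothesis igam : leb.-integrable D (EFin \o gam).
Hypothesis hgam : {ae leb, forall t, D t -> L2vec (g t) /\ normL2 (g t) <= gam t}.
Hypothesis prim : forall w, Hspace w -> exists G : R -> R,
  [/\ leb.-integrable D (EFin \o G), {ae leb, forall t, D t -> G t = innerv (g t) w} &
  forall s t, 0 < s -> s <= t -> t < T ->
    innerv (e t) w - innerv (e s) w = \int[leb]_(x in `]s, t]) G x].
Hypothesis diss : {ae leb, forall t, t0 <= t -> D t ->
  2 * innerv (g t) (e t) <= - c * innerv (e t) (e t)}.

Let phi t := innerv (e t) (e t).
Let eH t : 0 <= t <= T -> Hspace (e t). Proof. by move/ce => []. Qed.
Let e2 t : 0 <= t <= T -> L2vec (e t). Proof. by move/eH/Hspace_L2. Qed.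
Let phi_ge0 t : 0 <= t <= T -> 0 <= phi t.
Proof. by move=> /e2 h; exact: (si_ge0 HV). Qed.

(** phi = n^2 changes by at most r (2 n + r) when the norm changes by r, which
    explains the three bounds in the choice of r. *)
Let phi_near p w : 0 <= p <= T -> 0 < w -> exists2 d, 0 < d &
  forall s, 0 <= s <= T -> `|s - p| < d ->
    normL2 (e s - e p) <= w /\ `|phi s - phi p| <= w.
Proof.
move=> hp w0; set n := normL2 (e p); have n0 : 0 <= n by exact: sqrtr_ge0.
have k0 : 0 < 2 * n + 1 by rewrite ltr_wpDl// mulr_ge0.
pose r := Num.min w (Num.min 1 (w / (2 * n + 1))).
have r0 : 0 < r by rewrite /r !lt_min w0 ltr01 divr_gt0.
have [_ cp] := ce hp.
have [d d0 hd] := within_modulus cp r0.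
exists d => // s hs sp; have hr := hd s hs sp.
have rw : r <= w by rewrite /r ge_min lexx.
have r1 : r <= 1 by rewrite /r !ge_min lexx orbT.
have rk : r * (2 * n + 1) <= w by rewrite -ler_pdivlMr// /r !ge_min lexx !orbT.
split; first exact: le_trans rw.
have di : `|normL2 (e s) - n| <= r by apply: le_trans hr; exact: (si_dist HV (e2 hs) (e2 hp)).
have E1 : phi s = normL2 (e s) ^+ 2 by rewrite (si_sqrt_sqr HV)//; exact: e2.
have E2 : phi p = n ^+ 2 by rewrite (si_sqrt_sqr HV)//; exact: e2.
have ns0 : 0 <= normL2 (e s) by exact: sqrtr_ge0.
rewrite E1 E2 subr_sqr normrM; apply: le_trans rk.
apply: ler_pM => //; rewrite ger0_norm ?addr_ge0//.
by move: di; rewrite ler_norml => /andP[_ h]; lra.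
Qed.

Let kappa a x := c * x + 2 * \int[leb]_(y in `]a, x]) gam y.

Let kappaB a s t : 0 < a -> a <= s -> s <= t -> t < T ->
  kappa a t - kappa a s = c * (t - s) + 2 * \int[leb]_(x in `]s, t]) gam x.
Proof.
move=> a0 as_ st tT.
rewrite -(@Rintegral_itvB _ gam (BRight a) (BRight t) s).
- by rewrite /kappa; ring.
- apply: integrableS igam => //; first exact: measurable_itv.
  by move=> x; rewrite /D /= !in_itv/= => /andP[h k]; rewrite (lt_trans a0 h) (le_lt_trans k tT).
- by rewrite bnd_simp.
- by rewrite bnd_simp.
Qed.

(** The decay estimate with an error proportional to w; [decay_pos] lets w tend
    to zero. *)
Let Q a w s t := phi t <= expR (- c * (t - s)) * phi s + w * (kappa a t - kappa a s).

(** phi t - phi s is the pairing of the increment e t - e s with e s + e t, which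
    is a fixed vector, so that the time derivative of e only has to be tested
    against constants. *)
Let Q_local a b w p : 0 < a -> t0 <= a -> b < T -> 0 < w -> a <= p <= b ->
  exists2 d, 0 < d & forall s t, a <= s -> s <= t -> t <= b ->
     p - d < s -> t < p + d -> Q a w s t.
Proof.
move=> a0 ta bT w0 /andP[ap pb].
have hp : 0 <= p <= T by rewrite (le_trans (ltW a0) ap) (le_trans pb (ltW bT)).
have w20 : 0 < w / 2 by rewrite divr_gt0.
have [d d0 hd] := phi_near hp w20; exists d => // s t as_ st tb ps tp.
have s0 := lt_le_trans a0 as_; have tT := le_lt_trans tb bT.
have near x : s <= x <= t -> [/\ 0 <= x <= T, normL2 (e x - e p) <= w / 2 & `|phi x - phi p| <= w / 2].
  move=> /andP[sx xt]; have hx : 0 <= x <= T.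
    by rewrite (le_trans (ltW s0) sx) (le_trans xt (ltW tT)).
  have [|h1 h2] := hd x hx; last by split.
  by rewrite ltr_norml; apply/andP; split; lra.
have [hs ns ps1] := near s (introT andP (conj (lexx s) st)).
have [ht nt pt1] := near t (introT andP (conj st (lexx t))).
have Hw := HspaceD (eH hs) (eH ht).
have [G [iG hG EG]] := prim Hw.
rewrite /Q kappaB//; apply: (@decay_step R T c w phi G gam) => //; first exact: phi_ge0.
- rewrite -EG// /phi (si_Dr HV)// ?(si_Dr HV)//; try exact: e2.
  by rewrite (si_sym HV (e2 ht) (e2 hs)); ring.
have h3 : {ae leb, forall x, (D x -> L2vec (g x) /\ normL2 (g x) <= gam x) /\
    (t0 <= x -> D x -> 2 * innerv (g x) (e x) <= - c * innerv (e x) (e x))}.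
  by apply: (ae_mono2 hgam diss) => x h1 h2; split.
apply: (ae_mono2 h3 hG) => x [h1 h2] h4 /andP[sx xt].
have Dx : D x by rewrite /D /= in_itv/= (lt_trans s0 sx) (le_lt_trans xt tT).
have [hx nx px] := near x (introT andP (conj (ltW sx) xt)).
have [gx gn] := h1 Dx; rewrite (h4 Dx).
have tri y : 0 <= y <= T -> normL2 (e y - e p) <= w / 2 -> normL2 (e y - e x) <= w.
  move=> hy ny; rewrite (_ : e y - e x = (e y - e p) + (e p - e x)); last first.
    by rewrite addrA subrK.
  have sy := siB HV (e2 hy) (e2 hp); have sx' := siB HV (e2 hp) (e2 hx).
  apply: (le_trans (si_triangle HV sy sx')).
  rewrite [X in _ + X](_ : _ = normL2 (e x - e p)); first by rewrite [w]splitr lerD.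
  by rewrite /normL2 (si_sq_subC HV (e2 hp) (e2 hx)).
have dx : 2 * innerv (g x) (e x) <= - c * innerv (e x) (e x).
  by apply: h2 => //; apply: le_trans (ltW sx); exact: le_trans ta as_.
have bd := si_shift_bound HV gx (e2 hs) (e2 ht) (e2 hx) (tri _ hs ns) (tri _ ht nt) dx.
apply: (le_trans bd); rewrite -/(phi x) -/(normL2 (g x)); apply: lerD.
  rewrite !mulNr lerN2 ler_wpM2l//.
  by move: ps1 px; rewrite !ler_norml => /andP[_ k1] /andP[k2 _]; lra.
by rewrite ler_wpM2l// mulr_ge0// ltW.
Qed.

Let kappa_mono a s t : 0 < a -> a <= s -> s <= t -> t < T -> 0 <= kappa a t - kappa a s.
Proof.
move=> a0 as_ st tT; rewrite kappaB// addr_ge0// mulr_ge0// ?subr_ge0//.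
exact: Rintegral_ge0.
Qed.

Let decay_pos a b : 0 < a -> t0 <= a -> a <= b -> b < T ->
  phi b <= expR (- c * (b - a)) * phi a.
Proof.
move=> a0 ta ab bT.
have QT w : 0 < w -> Q a w a b.
  move=> w0; apply: (interval_chain (Q := Q a w) ab).
  - by rewrite /Q !subrr !mulr0 expR0 mul1r addr0.
  - move=> s r t as_ sr rt tb; rewrite /Q => q1 q2; apply: (le_trans q2).
    have ee : expR (- c * (t - s)) = expR (- c * (t - r)) * expR (- c * (r - s)).
      by rewrite -expRD; congr expR; ring.
    have k0 := kappa_mono a0 as_ sr (le_lt_trans rt (le_lt_trans tb bT)).
    have e1 : expR (- c * (t - r)) <= 1.
      by rewrite -expR0 ler_expR mulNr oppr_le0 mulr_ge0// subr_ge0.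
    have h1 := ler_wpM2l (expR_ge0 (- c * (t - r))) q1.
    have h2 : expR (- c * (t - r)) * (w * (kappa a r - kappa a s)) <= w * (kappa a r - kappa a s).
      by rewrite ler_piMl// mulr_ge0// ltW.
    by rewrite ee; exact: chained_bound h1 h2.
  - by move=> p hp; exact: Q_local.
have K0 := kappa_mono a0 (lexx a) ab bT.
apply/ler_addgt0Pr => eps eps0; set K := kappa a b - kappa a a in K0.
have K1 : 0 < K + 1 by rewrite ltr_wpDl.
apply: (le_trans (QT (eps / (K + 1)) (divr_gt0 eps0 K1))).
rewrite lerD2l -/K -mulrA ler_piMr ?(ltW eps0)//.
by rewrite mulrC ler_pdivrMr// mul1r lerDl.
Qed.

(** The estimate holds from every positive time on, where the time derivative is
    tested; continuity extends it to t0, which may be 0. *)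
Lemma evolution_decay t : t0 <= t -> t < T -> phi t <= expR (- c * (t - t0)) * phi t0.
Proof.
rewrite le_eqVlt => /orP[/eqP <- _|tt tT].
  by rewrite subrr mulr0 expR0 mul1r.
have h0 : 0 <= t0 <= T by rewrite t00 (le_trans (ltW tt) (ltW tT)).
apply/ler_addgt0Pr => eps eps0.
have ce' : {for t0, continuous (fun s => expR (- c * (t - s)) : R)}.
  apply: (continuous_comp (f := fun s : R => - c * (t - s))); last exact: continuous_expR.
  by apply: cvgM; [exact: cvg_cst|apply: cvgB; [exact: cvg_cst|exact: cvg_id]].
have p1 : 0 < phi t0 + 1 by rewrite ltr_wpDl// phi_ge0.
have e2' : 0 < eps / 2 by rewrite divr_gt0.
have [d d0 hd] := phi_near h0 e2'.
have e3 : 0 < eps / 2 / (phi t0 + 1) by rewrite divr_gt0.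
move/cvgrPdist_le : ce' => /(_ _ e3)/nbhs_ballP[d' /= d'0 hd'].
pose r := Num.min (Num.min d d') (t - t0) / 2.
have r0 : 0 < r by rewrite divr_gt0// !lt_min d0 d'0 subr_gt0.
have rm : r < Num.min (Num.min d d') (t - t0).
  by rewrite /r ltr_pdivrMr// ltr_pMr ?ltr1n// !lt_min d0 d'0 subr_gt0.
move: rm; rewrite !lt_min => /andP[/andP[rd rd'] rt].
have st : t0 + r <= t by rewrite -lerBrDl ltW.
have hs : 0 <= t0 + r <= T by rewrite (addr_ge0 t00 (ltW r0)) (le_trans st (ltW tT)).
have dist : `|t0 + r - t0| = r by rewrite addrAC subrr add0r gtr0_norm.
have [|_ ph] := hd _ hs; first by rewrite dist.
have ex : `|expR (- c * (t - t0)) - expR (- c * (t - (t0 + r)))| <= eps / 2 / (phi t0 + 1).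
  by apply: hd'; rewrite /ball/= distrC dist.
have s0 : 0 < t0 + r by rewrite ltr_wpDl.
have := decay_pos s0 _ st tT; rewrite lerDl => /(_ (ltW r0)) main.
have E1 : expR (- c * (t - (t0 + r))) <= 1.
  by rewrite -expR0 ler_expR mulNr oppr_le0 mulr_ge0// subr_ge0.
have E0 := expR_ge0 (- c * (t - (t0 + r))).
have pp := phi_ge0 h0.
exact: (perturbed_bound eps0 pp E0 E1 ph ex main).
Qed.

End evolution_inequality.

(** * Strong solutions and synchronization *)

Lemma subrACA (V : zmodType) (a b c d : V) : a - b - (c - d) = a - c - (b - d).
Proof. by rewrite !opprB addrACA [RHS]addrACA [- c - b]addrC. Qed.

Section strong_solutions.
Context {R : realType}.
Local Notation leb := (@lebesgue_measure R).
Let HV := @semi_inner_vec R.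
Implicit Types (u ut v : R -> vfield R) (T : R).

Lemma within_squeeze (d d' : R -> R) (A : set R) (t C : R) :
  (forall s, A s -> `|d' s| <= C * d s) ->
  d @ within A (nbhs t) --> (0 : R) -> d' @ within A (nbhs t) --> (0 : R).
Proof.
move=> h cd; apply/cvgrPdist_le => e e0; rewrite near_withinE.
have C1 : 0 < `|C| + 1 by rewrite ltr_wpDl.
move/cvgrPdist_le : cd => /(_ _ (divr_gt0 e0 C1)); rewrite near_withinE.
apply: filterS => s hs As; have := hs As; rewrite !sub0r !normrN ler_pdivlMr// => ds.
apply: (le_trans (h s As)); apply: le_trans ds; apply: (le_trans (ler_norm _)).
by rewrite normrM mulrC ler_wpM2l// lerDl.
Qed.

(** Poincare's inequality applies to the increments, which lie in V. *)
Lemma continuous_V_H (lam : R) u T : poincare_constant lam ->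
  continuous_in T (@Vspace R) grad_norm u -> continuous_in T (@Hspace R) normL2 u.
Proof.
move=> [lam0 hlam] cu t ht; have [ut ct] := cu t ht; split; first by case: ut.
apply: (within_squeeze (C := (Num.sqrt lam)^-1)) ct => s hs.
have [us _] := cu s hs; have hl := hlam _ (VspaceB us ut).
have sl : 0 < Num.sqrt lam by rewrite sqrtr_gt0.
rewrite ger0_norm ?sqrtr_ge0// ler_pdivlMl//.
move: hl; rewrite -[lam in lam * _](sqr_sqrtr (ltW lam0)) -exprMn.
by rewrite ler_sqr// nnegrE ?mulr_ge0 ?sqrtr_ge0.
Qed.

Lemma continuous_H_sub u v T : continuous_in T (@Hspace R) normL2 u ->
  continuous_in T (@Hspace R) normL2 v ->
  continuous_in T (@Hspace R) normL2 (fun t => v t - u t).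
Proof.
move=> cu cv t ht; have [hu du] := cu t ht; have [hv dv] := cv t ht.
split; first exact: HspaceB.
have ds : (fun s => normL2 (v s - v t) + normL2 (u s - u t)) @
    within [set s | 0 <= s <= T] (nbhs t) --> (0 : R).
  by have := cvgD dv du; rewrite addr0; apply.
apply: (within_squeeze (C := 1)) ds => s hs; rewrite mul1r.
have [us _] := cu s hs; have [vs _] := cv s hs.
rewrite ger0_norm ?sqrtr_ge0//.
have U2 := siB HV (Hspace_L2 us) (Hspace_L2 hu).
have V2 := siB HV (Hspace_L2 vs) (Hspace_L2 hv).
rewrite subrACA.
apply: (le_trans (si_triangle HV V2 (siN HV U2))); rewrite lerD2l.
by rewrite (si_sqN HV U2).
Qed.

Lemma inner_continuous u w T : continuous_in T (@Hspace R) normL2 u -> Hspace w ->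
  {within `[0, T], continuous (fun t => innerv (u t) w)}.
Proof.
move=> cu hw; apply/subspace_continuousP => t; rewrite /= in_itv/= => ht.
have [hu du] := cu t ht.
apply/cvgrPdist_le => e e0; rewrite near_withinE.
have w1 : 0 < normL2 w + 1 by rewrite ltr_wpDl// sqrtr_ge0.
move/cvgrPdist_le : du => /(_ _ (divr_gt0 e0 w1)); rewrite near_withinE.
apply: filterS => s hs; rewrite /= in_itv/= => As; have := hs As.
rewrite sub0r normrN ger0_norm ?sqrtr_ge0// ler_pdivlMr// => ds.
have [us _] := cu s As; rewrite distrC.
have U2 := siB HV (Hspace_L2 us) (Hspace_L2 hu).
rewrite -(si_Bl HV (Hspace_L2 us) (Hspace_L2 hu) (Hspace_L2 hw)).
apply: (le_trans (si_CS HV U2 (Hspace_L2 hw))); apply: le_trans ds.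
by rewrite ler_wpM2l ?sqrtr_ge0// lerDl.
Qed.

Lemma test_function_continuous T psi : test_function T psi -> continuous (psi : R -> R).
Proof.
move=> [d _] t; apply: differentiable_continuous; apply/derivable1_diffP.
exact: (d 0 t).
Qed.

(** Pairing with w turns the time derivative into a scalar distributional
    derivative, and its Borel version G does not change the integrals. *)
Lemma inner_primitive u ut w T : continuous_in T (@Hspace R) normL2 u ->
  bochner_L2 T (@Hspace R) normL2 ut -> time_derivative T u ut -> Hspace w ->
  exists G : R -> R, [/\ leb.-integrable `]0, T[%classic (EFin \o G),
    {ae leb, forall t, `]0, T[%classic t -> G t = innerv (ut t) w} &
    forall s t, 0 < s -> s <= t -> t < T ->
      innerv (u t) w - innerv (u s) w = \int[leb]_(x in `]s, t]) G x].
Proof.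
move=> cu but td hw; have [G [mG GE]] := bochner_inner but hw.
have [gam [mgam igam gamE]] := bochner_norm but.
have mem := bochner_mem but.
have iG : leb.-integrable `]0, T[%classic (EFin \o G).
  apply/integrable_mkcond; first exact: measurable_itv.
  rewrite restrict_EFin.
  apply: (@integrable_ae_le _ _ _ leb _ ((fun t => gam t * normL2 w) \_ `]0, T[%classic)).
  - apply: (measurable_restrictT _ _).1; first exact: measurable_itv.
    exact: measurable_funTS.
  - rewrite -restrict_EFin; apply/(integrable_mkcond _ _).1; first exact: measurable_itv.
    under [X in _.-integrable _ X]eq_fun do rewrite EFinM.
    by apply: integrableZr => //; exact: measurable_itv.
  - have h : {ae leb, forall t, `]0, T[%classic t -> Hspace (ut t) /\ G t = innerv (ut t) w}.
      by apply: (ae_mono2 mem GE) => t h1 h2 Dt; split; [exact: h1|exact: h2].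
    apply: (ae_mono2 gamE h) => t h1 h2; rewrite !patchE.
    case: ifPn => [/set_mem Dt|_]; last by rewrite normr0.
    have [ht ->] := h2 Dt; rewrite (h1 Dt).
    exact: (si_CS HV (Hspace_L2 ht) (Hspace_L2 hw)).
exists G; split => //.
apply: (weak_FTC (inner_continuous cu hw) iG) => psi tpsi.
rewrite (td psi w tpsi hw); congr (- _); apply: ae_eq_RintegralW.
- exact: measurable_itv.
- apply: measurable_funM => //; apply: continuous_measurable_fun.
  exact: test_function_continuous tpsi.
- by apply: (ae_mono GE) => t h Dt; rewrite h.
Qed.

End strong_solutions.

Lemma ess_sup_from_le (R : realType) (t0 U : R) (N : R -> R) :
  ess_sup_from t0 N = U%:E ->
  {ae @lebesgue_measure R, forall t, t0 <= t -> N t <= U}.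
Proof.
move=> hU; have h := ess_sup_ge
  (mrestr (@lebesgue_measure R) (measurable_itv `[t0, +oo[)) (fun t => (N t)%:E).
apply: (ae_mono (mrestr_ae h)) => t ht t0t.
have Dt : `[t0, +oo[%classic t by rewrite /= in_itv/= t0t.
by have := ht Dt; rewrite -/(ess_sup_from t0 N) hU lee_fin.
Qed.

Lemma bochner_ae_mem (R : realType) (T : R) (X : set (vfield R)) N u :
  bochner_L2 T X N u -> {ae @lebesgue_measure R, forall t, 0 < t < T -> X (u t)}.
Proof. by move=> [[s [_ cs]] _]; apply: (ae_mono cs) => t h /h[]. Qed.

Theorem theorem7p2 (R : realType)
  (lam1 : R) (hlam1 : poincare_constant lam1)
  (P : vfield R -> vfield R) (hP : leray_projection P)
  (nu : R) (hnu : 0 < nu)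
  (f : vfield R) (hf : Hspace f)
  (u0 : vfield R) (hu0 : Vspace u0)
  (u : R -> vfield R) (hu : strong_solution P nu (fun=> f) u0 u)
  (t0 : R) (ht0 : 0 <= t0)
  (U0 U1 : R)
  (hU0 : ess_sup_from t0 (fun t => normL2 (u t)) = U0%:E)
  (hU1 : ess_sup_from t0 (fun t => grad_norm (u t)) = U1%:E)
  (m : vfield R) (hm : forall i, sobolev T2 2 +oo%E (m i))
  (hm1 : unit_field m)
  (Ly Ls : R) (Phib : torus (Ly, Ls) -> torus (@T2 R))
  (Phi : vfield R) (q : R * R -> R)
  (hcov : controlled_adapted_covering m Phib Phi q)
  (Km : R) (hKm : trilinear_constant lam1 m Km)
  (Cfr : R) (hCfr : frame_constant m Cfr)
  (hsmall : shear_small Km lam1 nu U0 m)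
  (Ih : R -> (R * R -> R) -> R * R -> R) (c0 c1 : R)
  (hc0 : 0 < c0) (hc1 : 0 < c1) (hIh : interpolant_family Ih c0 c1)
  (mu h : R) (hmu : 0 < mu) (hh : 0 < h)
  (hmuB : Bstar nu Km Cfr U1 <= mu)
  (hmuh : c1 ^+ 2 * Cfr * mu * h ^+ 2 <= nu / 4)
  (v0 : vfield R) (hv0 : Vspace v0)
  (v : R -> vfield R)
  (hv : strong_solution P nu (nudged_forcing P f mu (Ih h) m u v) v0 v) :
  forall t, t0 <= t ->
    normL2 (v t - u t) ^+ 2 <=
    expR (- (nu * lam1 / 2) * (t - t0)) * normL2 (v t0 - u t0) ^+ 2.
Proof.
move=> t t0t; have HV := @semi_inner_vec R.
(* A horizon beyond t, since the time derivative is only tested inside ]0, T[. *)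
pose T := t + 1; have tT : t < T by rewrite /T ltrDl.
have T0 : 0 < T by exact: le_lt_trans (le_trans ht0 t0t) tT.
have lam0 : 0 < lam1 by case: hlam1.
have [cu bu [ut [hut pdeu]] _] := hu; have [cv bv [vt [hvt pdev]] _] := hv.
have [but tdu] := hut T T0; have [bvt tdv] := hvt T T0.
have cuH := continuous_V_H hlam1 (cu T T0); have cvH := continuous_V_H hlam1 (cv T T0).
have ce := continuous_H_sub cuH cvH.
have [gu [_ igu guE]] := bochner_norm but; have [gv [_ igv gvE]] := bochner_norm bvt.
have mem : {ae @lebesgue_measure R, forall s, `]0, T[%classic s ->
    L2vec (ut s) /\ L2vec (vt s)}.
  apply: (ae_mono2 (bochner_mem but) (bochner_mem bvt)) => s h1 h2 Ds.
  by split; [exact: Hspace_L2 (h1 Ds)|exact: Hspace_L2 (h2 Ds)].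
pose gam s := `|gv s| + `|gu s|.
have inT s : 0 <= s <= T -> L2vec (v s - u s).
  by move=> hs; have [es _] := ce s hs; exact: Hspace_L2 es.
have hT0 : 0 <= t0 <= T by rewrite ht0 (le_trans t0t (ltW tT)).
have hT : 0 <= t <= T by rewrite (le_trans ht0 t0t) (ltW tT).
rewrite /normL2 (si_sqrt_sqr HV (inT t hT)) (si_sqrt_sqr HV (inT t0 hT0)).
have rate0 : 0 <= nu * lam1 / 2 by rewrite divr_ge0// mulr_ge0// ltW.
apply: (@evolution_decay R T (nu * lam1 / 2) t0 (fun s => v s - u s)
  (fun s => vt s - ut s) gam) => //.
- by move=> s; rewrite addr_ge0.
- have iv : (@lebesgue_measure R).-integrable `]0, T[%classic (EFin \o (fun s => `|gv s|)).
    exact: integrable_norm.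
  have iu : (@lebesgue_measure R).-integrable `]0, T[%classic (EFin \o (fun s => `|gu s|)).
    exact: integrable_norm.
  exact: (@integrableD _ _ R (@lebesgue_measure R) `]0, T[%classic (measurable_itv _) _ _ iv iu).
- have hae : {ae @lebesgue_measure R, forall s, `]0, T[%classic s ->
      gu s = normL2 (ut s) /\ gv s = normL2 (vt s)}.
    by apply: (ae_mono2 guE gvE) => s h1 h2 Ds; split; [exact: h1|exact: h2].
  apply: (ae_mono2 mem hae) => s h1 h2 Ds; have [u2 v2] := h1 Ds; have [eu ev] := h2 Ds.
  split; first exact: (siB HV v2 u2).
  apply: (le_trans (si_triangle HV v2 (siN HV u2))).
  by rewrite (si_sqN HV u2) /gam eu ev; apply: lerD; exact: ler_norm.
- move=> w hw.
  have [Gu [iGu GuE Pu]] := inner_primitive cuH but tdu hw.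
  have [Gv [iGv GvE Pv]] := inner_primitive cvH bvt tdv hw.
  have w2 := Hspace_L2 hw.
  exists (fun s => Gv s - Gu s); split.
  + exact: (@integrableB _ _ R (@lebesgue_measure R) `]0, T[%classic (measurable_itv _) _ _ iGv iGu).
  + have hae : {ae @lebesgue_measure R, forall s, `]0, T[%classic s ->
        Gu s = innerv (ut s) w /\ Gv s = innerv (vt s) w}.
      by apply: (ae_mono2 GuE GvE) => s h1 h2 Ds; split; [exact: h1|exact: h2].
    apply: (ae_mono2 mem hae) => s h1 h2 Ds; have [u2 v2] := h1 Ds; have [eu ev] := h2 Ds.
    by rewrite eu ev (si_Bl HV v2 u2 w2).
  + move=> s r s0 sr rT.
    have sub : `]s, r]%classic `<=` `]0, T[%classic.
      by move=> x; rewrite /= !in_itv/= => /andP[a b]; rewrite (lt_trans s0 a) (le_lt_trans b rT).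
    have iu : (@lebesgue_measure R).-integrable `]s, r]%classic (EFin \o Gu).
      by apply: integrableS iGu => //; exact: measurable_itv.
    have iv : (@lebesgue_measure R).-integrable `]s, r]%classic (EFin \o Gv).
      by apply: integrableS iGv => //; exact: measurable_itv.
    rewrite RintegralB// -Pu// -Pv//.
    have hs : 0 <= s <= T by rewrite (ltW s0) (le_trans sr (ltW rT)).
    have hr : 0 <= r <= T by rewrite (le_trans (ltW s0) sr) (ltW rT).
    have [us _] := cuH s hs; have [vs _] := cvH s hs.
    have [ur _] := cuH r hr; have [vr _] := cvH r hr.
    rewrite (si_Bl HV (Hspace_L2 vr) (Hspace_L2 ur) w2).
    by rewrite (si_Bl HV (Hspace_L2 vs) (Hspace_L2 us) w2) subrACA.
(* It remains to collect the null sets off which the energy estimate applies. *)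
have DA : {ae @lebesgue_measure R, forall s, 0 < s < T -> DAspace (u s) /\ DAspace (v s)}.
  apply: (ae_mono2 (bochner_ae_mem (bu T T0)) (bochner_ae_mem (bv T T0))) => s h1 h2 hs.
  by split; [exact: h1|exact: h2].
have bounds : {ae @lebesgue_measure R, forall s, t0 <= s ->
    normL2 (u s) <= U0 /\ grad_norm (u s) <= U1}.
  apply: (ae_mono2 (ess_sup_from_le hU0) (ess_sup_from_le hU1)) => s h1 h2 hs.
  by split; [exact: h1|exact: h2].
have spaces := ae_mono2 DA mem (fun s h1 h2 => conj h1 h2).
have pdes := ae_mono2 pdeu pdev (fun s h1 h2 => conj h1 h2).
have all1 := ae_mono2 spaces pdes (fun s h1 h2 => conj h1 h2).
apply: (ae_mono2 all1 bounds) => s [[h1 h2] [h3 h4]] h5 t0s Ds.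
have hs : 0 < s < T by move: Ds; rewrite /= in_itv.
have s0 : 0 < s by case/andP: hs.
have [uD vD] := h1 hs; have [ut2 vt2] := h2 Ds; have [uU0 uU1] := h5 t0s.
have [lin _ intp] := hIh h hh.
exact: (energy_dissipation hlam1 hP hnu (Hspace_L2 hf) hm hKm hCfr lin intp hmu hmuB
  hmuh hsmall uU0 uU1 uD vD ut2 vt2 (h3 s0) (h4 s0)).
Qed.
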